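(* Let $(x^i_k)_{i\in[n],k\in[K]}$ and $(\hat x^i_k)_{i\in[n],k\in[K]}$ denote the iterates of Interacting Particle Dynamics (IPD) and the Covariance Corrected Random Batch Method (CC-RBM) with batch sizes $B,B'$ respectively, with the same initial distribution, the same step size $\eta>0$ and the same diffusion strength $\sigma>0$. Suppose $\|\mathbf K^{ij}_k(\hat x^i_k,\hat x^j_k)\|\le M$ holds almost surely for every $k\in\{0,1,\dots,K\}$ and $i,j\in[n]$. Then, for every $\eta\le\frac{B\sigma^2}{40M^2d}$, up to a universal multiplicative constant, $$\mathsf{KL}\left(\mathrm{Law}\big((\hat x^i_k)_{i\in[n],k\in[K]}\big)\,\big\|\,\mathrm{Law}\big((x^i_k)_{i\in[n],k\in[K]}\big)\right)\lesssim\frac{\eta^2M^4nK}{B^2B'\sigma^4}+\frac{\eta^3M^6nK}{B^3\sigma^6}+\frac{d\,\eta^3M^6nK(1+\log B)^2}{B^4\sigma^6}.$$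
   Context: $[m]=\{1,\dots,m\}$. There are $n$ particles in $\mathbb R^d$, with external forces $\mathbf g^i_k:\mathbb R^d\to\mathbb R^d$ and interaction forces $\mathbf K^{ij}_k:\mathbb R^d\times\mathbb R^d\to\mathbb R^d$ ($i,j\in[n]$, $k\ge0$). The initial positions of the $n$ particles have an arbitrary joint distribution. IPD: $x^i_{k+1}=x^i_k+\eta\,\mathbf g^i_k(x^i_k)+\frac\eta n\sum_{j=1}^n\mathbf K^{ij}_k(x^i_k,x^j_k)+\sqrt\eta\,\sigma\,\epsilon^i_k$ for $i\in[n]$, with $\epsilon^i_k\sim\mathcal N(0,I)$ i.i.d. and independent of the initial positions. CC-RBM with $B,B'\in[n]$: at each step $k$ and for each $i$ draw $I^{i1}_k,\dots,I^{iB}_k$ and $J^{i1}_k,\bar J^{i1}_k,\dots,J^{iB'}_k,\bar J^{iB'}_k$ i.i.d. uniform on $[n]$, independent of everything else. Put $\hat{\mathbf K}^i_k(\hat x_k)=\frac1B\sum_{j=1}^B\mathbf K_k^{iI^{ij}_k}(\hat x^i_k,\hat x_k^{I^{ij}_k})$, $v^{il}_k=\mathbf K^{iJ^{il}_k}_k(\hat x^i_k,\hat x_k^{J^{il}_k})-\mathbf K^{i\bar J^{il}_k}_k(\hat x^i_k,\hat x_k^{\bar J^{il}_k})$, and $\hat\Sigma^i_k=\frac1{2BB'}\sum_{l=1}^{B'}v^{il}_k(v^{il}_k)^T$. Then $$\hat x^i_{k+1}=\hat x^i_k+\eta\,\mathbf g^i_k(\hat x^i_k)+\eta\,\hat{\mathbf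 K}^i_k(\hat x_k)+\sigma\sqrt\eta\left(I-\tfrac{\eta}{2\sigma^2}\hat\Sigma^i_k\right)\epsilon^i_k,$$ with $\epsilon^i_k\sim\mathcal N(0,I)$ i.i.d., independent of everything else. *)

(* Defs.v *)
From HB Require Import structures.
From mathcomp Require Import all_boot all_order all_algebra.
From mathcomp Require Import all_classical all_reals all_analysis.

Set Implicit Arguments.
Unset Strict Implicit.
Unset Printing Implicit Defensive.

Import Order.TTheory GRing.Theory Num.Theory.
Import numFieldNormedType.Exports.

Local Open Scope classical_set_scope.
Local Open Scope ring_scope.

(* The sigma-algebra on matrices generated by the entries; on 'cV[R]_d with R
   a realType this is the Borel sigma-algebra of R^d. *)
Definition matrix_display : measure_display -> measure_display.
Proof. exact. Qed.

Section measurable_matrix.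
Context disp (S : measurableType disp) (m n : nat).

Definition mx_measurable : set (set 'M[S]_(m, n)) :=
  <<s \bigcup_(p : 'I_m * 'I_n)
        preimage_set_system setT (fun A : 'M[S]_(m, n) => A p.1 p.2)
          measurable >>.

Let mx_measurable0 : mx_measurable set0.
Proof. exact: sigma_algebra0. Qed.

Let mx_measurableC A : mx_measurable A -> mx_measurable (~` A).
Proof. exact: sigma_algebraC. Qed.

Let mx_measurable_bigcup (F : (set 'M[S]_(m, n))^nat) :
  (forall i, mx_measurable (F i)) -> mx_measurable (\bigcup_i F i).
Proof. exact: sigma_algebra_bigcup. Qed.

HB.instance Definition _ := @isMeasurable.Build (matrix_display disp)
  'M[S]_(m, n) mx_measurable mx_measurable0 mx_measurableC mx_measurable_bigcup.

End measurable_matrix.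

(* The norm provided by the library on 'cV[R]_d is the max norm. *)
Definition enorm (R : realType) (d : nat) (v : 'cV[R]_d) : R :=
  Num.sqrt (\sum_(a < d) v a 0 ^+ 2).

Section tuple_of_mfun.
Context disp disp' (T : measurableType disp) (S : measurableType disp').

Definition tuple_fun (m : nat) (X : 'I_m -> {mfun T >-> S}) : T -> m.-tuple S :=
  fun w => [tuple X i w | i < m].

Variables (m : nat) (X : 'I_m -> {mfun T >-> S}).

Lemma measurable_tuple_fun : measurable_fun setT (tuple_fun X).
Proof.
apply/measurable_fun_tnthP => i.
rewrite (_ : _ \o _ = X i); first exact: measurable_funPT.
by apply/funext => w /=; rewrite tnth_mktuple.
Qed.

HB.instance Definition _ :=
  isMeasurableFun.Build _ _ _ _ (tuple_fun X) measurable_tuple_fun.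

End tuple_of_mfun.

Section probability_notions.
Context disp (T : measurableType disp) (R : realType).

(* If mu << nu, the negative part of ln (dmu/dnu) is mu-integrable, so the
   integral is well defined in [0, +oo]. *)
Definition KL (mu nu : probability T R) : \bar R :=
  if `[< mu `<< nu >]
  then (\int[mu]_y lne (Radon_Nikodym (charge_of_finite_measure mu) nu y))%E
  else +oo%E.

Definition generated_sigma disp' (S : measurableType disp') (X : T -> S) :
  set (set T) := preimage_set_system setT X measurable.

(* Mutual independence of a family of sigma-algebras. *)
Definition mutually_independent (P : probability T R) (I : eqType)
    (F : I -> set (set T)) : Prop :=
  forall (s : seq I) (A : I -> set T), uniq s ->
    (forall i, i \in s -> F i (A i)) ->
    (P (\bigcap_(i in [set` s]) A i) = \prod_(i <- s) P (A i))%E.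

(* X ~ N(0, I_d) *)
Definition std_gaussian (P : probability T R) (d : nat)
    (X : T -> 'cV[R]_d) : Prop :=
  (forall (a : 'I_d) (A : set R), measurable A ->
     P ((fun w => X w a 0) @^-1` A) = normal_prob 0 1 A) /\
  mutually_independent P (fun a : 'I_d => generated_sigma (fun w => X w a 0)).

(* 'I_n is not pointed when n = 0, hence not a measurableType: the
   measurability of an index variable is stated on singletons. *)
Definition uniform_index (P : probability T R) (n : nat) (I : T -> 'I_n) : Prop :=
  forall i : 'I_n, measurable (I @^-1` [set i]) /\
                   P (I @^-1` [set i]) = (n%:R^-1)%:E.

Definition index_sigma (n : nat) (I : T -> 'I_n) : set (set T) :=
  preimage_set_system setT I setT.

End probability_notions.

(* In the maps below, z is the configuration of the particles at the current
   time, and g and F are the forces at that time. *)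
Section one_step.
Context (R : realType) (d n : nat).
Implicit Types (g : 'I_n -> 'cV[R]_d -> 'cV[R]_d)
  (F : 'I_n -> 'I_n -> 'cV[R]_d -> 'cV[R]_d -> 'cV[R]_d)
  (z : 'I_n -> 'cV[R]_d) (i : 'I_n) (e : 'cV[R]_d).

Definition ipd_step (eta sigma : R) g F z i e : 'cV[R]_d :=
  z i + eta *: g i (z i)
  + (eta / n%:R) *: (\sum_(j < n) F i j (z i) (z j))
  + (Num.sqrt eta * sigma) *: e.

Definition batch_force (B : nat) F z i (I : 'I_B -> 'I_n) : 'cV[R]_d :=
  B%:R^-1 *: \sum_(j < B) F i (I j) (z i) (z (I j)).

Definition batch_cov (B B' : nat) F z i (J Jbar : 'I_B' -> 'I_n) : 'M[R]_d :=
  let v l := F i (J l) (z i) (z (J l)) - F i (Jbar l) (z i) (z (Jbar l)) in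
  (2 * B%:R * B'%:R)^-1 *: \sum_(l < B') (v l *m (v l)^T).

Definition ccrbm_step (B B' : nat) (eta sigma : R) g F z i
    (I : 'I_B -> 'I_n) (J Jbar : 'I_B' -> 'I_n) e : 'cV[R]_d :=
  z i + eta *: g i (z i) + eta *: batch_force F z i I
  + (sigma * Num.sqrt eta) *:
      ((1%:M - (eta / (2 * sigma ^+ 2)) *: batch_cov B F z i J Jbar) *m e).

End one_step.

(* Index set of the independent sources of randomness of CC-RBM; the initial
   positions form a single source, since they may be mutually dependent. *)
Inductive source (n B B' : nat) : Type :=
| Init
| Noise of nat & 'I_n
| Batch of nat & 'I_n & 'I_B
| Cov of nat & 'I_n & 'I_B'
| Covbar of nat & 'I_n & 'I_B'.

HB.instance Definition _ n B B' := gen_eqMixin (source n B B').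

Section dynamics.
Context disp (T : measurableType disp) (R : realType) (P : probability T R).
Context (d n : nat).
Variables (eta sigma : R).
Variables (g : nat -> 'I_n -> 'cV[R]_d -> 'cV[R]_d)
  (F : nat -> 'I_n -> 'I_n -> 'cV[R]_d -> 'cV[R]_d -> 'cV[R]_d).
Variables (x eps : nat -> 'I_n -> {RV P >-> 'cV[R]_d}).

Record is_IPD : Prop := {
  ipd_gaussian : forall k i, std_gaussian P (eps k i) ;
  ipd_independent : mutually_independent P
    (fun s : option (nat * 'I_n) =>
       if s is Some (k, i) then generated_sigma (eps k i)
       else generated_sigma (tuple_fun (x 0%N))) ;
  ipd_recursion : forall k i w,
    x k.+1 i w =
      ipd_step eta sigma (g k) (F k) (fun j => x k j w) i (eps k i w)
}.

Variables (B B' : nat).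
Variables (I : nat -> 'I_n -> 'I_B -> T -> 'I_n)
  (J Jbar : nat -> 'I_n -> 'I_B' -> T -> 'I_n).

Record is_CCRBM : Prop := {
  ccrbm_gaussian : forall k i, std_gaussian P (eps k i) ;
  ccrbm_uniform_I : forall k i j, uniform_index P (I k i j) ;
  ccrbm_uniform_J : forall k i l, uniform_index P (J k i l) ;
  ccrbm_uniform_Jbar : forall k i l, uniform_index P (Jbar k i l) ;
  ccrbm_independent : mutually_independent P
    (fun s : source n B B' =>
       match s with
       | Init => generated_sigma (tuple_fun (x 0%N))
       | Noise k i => generated_sigma (eps k i)
       | Batch k i j => index_sigma (I k i j)
       | Cov k i l => index_sigma (J k i l)
       | Covbar k i l => index_sigma (Jbar k i l)
       end) ;
  ccrbm_recursion : forall k i w,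
    x k.+1 i w =
      ccrbm_step eta sigma (g k) (F k) (fun j => x k j w) i
        (fun j => I k i j w) (fun l => J k i l w) (fun l => Jbar k i l w)
        (eps k i w)
}.

Definition initial_law : probability (n.-tuple 'cV[R]_d) R :=
  distribution P (tuple_fun (x 0%N)).

(* Joint law of the positions of all particles at times 1, ..., K. *)
Definition path_law (K : nat) : probability (K.-tuple (n.-tuple 'cV[R]_d)) R :=
  distribution P (tuple_fun (fun k : 'I_K => tuple_fun (x k.+1))).

End dynamics.

(* Main.v *)
Require Import Defs.
From HB Require Import structures.
From mathcomp Require Import all_boot all_order all_algebra.
From mathcomp Require Import all_classical all_reals all_analysis.
From mathcomp Require Import measurable_realfun.
From mathcomp Require Import ring lra zify.

Set Implicit Arguments.
Unset Strict Implicit.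
Unset Printing Implicit Defensive.

Import Order.TTheory GRing.Theory Num.Theory.
Import numFieldNormedType.Exports.

Local Open Scope classical_set_scope.
Local Open Scope ring_scope.

(** One step of CC-RBM is a step of IPD in which the Gaussian noise [e] is replaced by
    [U + (I - S/2) e] ([ccrbm_stepE]). Here [U] is the centred error of the random batch, divided by
    the noise amplitude, and [S] is an unbiased estimate of the covariance of [U] built from
    independent pairs. The relevant scale is [a = eta M^2 / (sigma^2 B)]: [|U|^2] is typically of
    order [a], and [S <= 2a]. The new noise has mean zero, and its covariance is the identity up to
    the estimation error of [S] and the term [S^2/4].

    Closeness of the noise to [N(0, I)] is measured in chi-square. Fix the pairs and put
    [A = I - S/2], [w = A^-1 U]. Pulled back by [A], the two laws have densities [p] (a mixture of
    Gaussian translates by [w]) and [q] (a quotient of Gaussian densities) with respect to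
    [N(0, I)]. Since [q >= 1/2], the integral of [p^2/q] is at most 1 plus twice the integral of
    [(p - q)^2] ([int_ppq], [chi2_step]). Expanding the integrals of [p^2], [p q] and [q^2] to
    second order bounds the latter by half the squared Frobenius norm of [E[w w^T] - (A^-2 - I)], up
    to order [a^3] ([white_fluct_mgf], [white_fluct_sqr]); the cubic remainder is free of the
    dimension because [|U|^2/(64 a)] has a bounded exponential moment ([exp_moment]). This matrix is
    the conjugate by [A^-1] of [Cov U - S + S^2/4], and the mean over the pairs of [|Cov U - S|^2]
    is of order [a^2/B'] ([avg_frob_cov]). So the second moment of the density is at most
    [1 + delta] with [delta = C (a^2/B' + a^3)] ([batch_chi2]).

    Moving the particles one at a time turns both dynamics into Markov chains ([ipd_chain],
    [ccrbm_chain]). The chi-square bound, in its dual form [chi2_le], multiplies along a chain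
    ([chi2_le_step]), which gives [(1 + delta)^(K n)] for the whole path ([path_chi2_le]). By
    Jensen, KL is at most the logarithm of this ([KL_le_ln]), hence at most [K n delta]. The numbers
    [K n a^2/B'] and [K n a^3] are the first two terms of the bound, and the third is
    nonnegative. *)

(** * Measurable matrices, densities and image measures *)

Section mx_measurability.
Context d d' (T : measurableType d) (S : measurableType d') (m n : nat).

Lemma measurable_mx_entry (i : 'I_m) (j : 'I_n) :
  measurable_fun setT (fun A : 'M[S]_(m, n) => A i j).
Proof.
move=> _ Y mY; apply: sub_sigma_algebra; exists (i, j) => //.
by exists Y.
Qed.

Lemma measurable_mxP (f : T -> 'M[S]_(m, n)) :
  (forall i j, measurable_fun setT (fun x => f x i j)) ->
  measurable_fun setT f.
Proof.
move=> mf; apply: (@measurability _ _ _ _ _ _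
  (\bigcup_(p : 'I_m * 'I_n) preimage_set_system setT
     (fun A : 'M[S]_(m, n) => A p.1 p.2) measurable)) => //.
move=> _ [_ [[i j] _ [B mB <-]] <-].
rewrite !setTI -[X in measurable X]setTI; exact: (mf i j measurableT _ mB).
Qed.

End mx_measurability.

Section density.
Context d (T : measurableType d) (R : realType) (mu : {measure set T -> \bar R}).
Variable f : {mfun T >-> R}.
Hypothesis f0 : forall x, 0 <= f x.

(* the hypothesis [f0] is an argument so that the measure instance can be inferred *)
Definition mdensity of (forall x, 0 <= f x) := fun (A : set T) => (\int[mu]_(x in A) (f x)%:E)%E.
Local Notation md := (mdensity f0).

Let mdensity0 : md set0 = 0%E.
Proof. by rewrite /mdensity integral_set0. Qed.

Let mdensity_ge0 A : (0 <= md A)%E.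
Proof. by apply: integral_ge0 => x _; rewrite lee_fin. Qed.

Let mdensity_sigma_additive : semi_sigma_additive md.
Proof.
apply: semi_sigma_additive_nng_induced => //; exact/measurable_EFinP.
Qed.

HB.instance Definition _ := isMeasure.Build _ _ _ md
  mdensity0 mdensity_ge0 mdensity_sigma_additive.

End density.

Section integral_density.
Import HBNNSimple.

(* Integration against a measure known only through its density. *)
Lemma ge0_integral_density d (T : measurableType d) (R : realType)
    (mu nu : {measure set T -> \bar R}) (f : T -> R) (g : T -> \bar R) :
  measurable_fun setT f -> (forall x, 0 <= f x) ->
  (forall A, measurable A -> nu A = \int[mu]_(x in A) (f x)%:E)%E ->
  measurable_fun setT g -> (forall x, 0 <= g x)%E ->
  (\int[nu]_x g x = \int[mu]_x (g x * (f x)%:E))%E.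
Proof.
move=> mf f0 nuE mg g0.
have mfE : measurable_fun setT (EFin \o f) by exact/measurable_EFinP.
pose h_ := nnsfun_approx measurableT mg.
have cvgh x : (h_ n x)%:E @[n --> \oo] --> g x.
  by apply: cvg_nnsfun_approx.
transitivity (limn (fun n => \int[nu]_x (h_ n x)%:E))%E.
  rewrite -monotone_convergence//.
  - by apply: eq_integral => x _; apply/esym/cvg_lim.
  - by move=> n; exact/measurable_EFinP.
  - by move=> n x _; rewrite lee_fin.
  - by move=> x _ a b ab; rewrite lee_fin; exact/lefP/nd_nnsfun_approx.
transitivity (limn (fun n => \int[mu]_x ((h_ n x)%:E * (f x)%:E)))%E; last first.
  rewrite -monotone_convergence//.
  - apply: eq_integral => x _; apply/cvg_lim => //.
    by apply: cvgeZr => //.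
  - by move=> n; apply: emeasurable_funM => //; exact/measurable_EFinP.
  - by move=> n x _; rewrite mule_ge0// lee_fin.
  - move=> x _ a b ab; rewrite lee_wpmul2r ?lee_fin//.
    exact/lefP/nd_nnsfun_approx.
congr (limn _); apply/funext => n.
rewrite integralT_nnsfun sintegralE.
under [RHS]eq_integral => x _.
  rewrite fimfunE -fsumEFin// ge0_mule_fsuml; last first.
    by move=> y; rewrite EFinM nnfun_muleindic_ge0.
  over.
rewrite ge0_integral_fsum//; last 2 first.
- move=> y; apply: emeasurable_funM => //.
  by apply/measurable_EFinP; exact: measurable_funM.
- by move=> y x _; apply: mule_ge0; rewrite ?lee_fin// -lee_fin EFinM nnfun_muleindic_ge0.
apply: eq_fsbigr => y /[!inE] -[t _ <-].
under eq_integral => x _ do rewrite EFinM -muleA.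
rewrite ge0_integralZl//; last 3 first.
- by apply: emeasurable_funM => //; exact/measurable_EFinP.
- by move=> x _; rewrite mule_ge0 ?lee_fin.
- by rewrite lee_fin.
congr (_ * _)%E.
rewrite nuE//.
rewrite integral_mkcond; apply: eq_integral => x _.
by rewrite -(setTI (_ @^-1` _)) epatch_indic/= muleC setTI.
Qed.
End integral_density.

Section push.
Context d d' (T1 : measurableType d) (T2 : measurableType d') (R : realType).

(** The measurability proof is an argument, so that the image under a plain function is a measure by
    construction. *)
Definition pushm (mu : {measure set T1 -> \bar R}) (f : T1 -> T2)
  (mf : measurable_fun setT f) : {measure set T2 -> \bar R}.
Proof.
pose F : {mfun T1 >-> T2} := HB.pack f (isMeasurableFun.Build _ _ _ _ f mf).
exact: (pushforward mu F).
Defined.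

Lemma pushmE mu f mf A : @pushm mu f mf A = mu (f @^-1` A).
Proof. by []. Qed.

Lemma ge0_integral_pushm mu f mf (g : T2 -> \bar R) :
  measurable_fun setT g -> (forall x, 0 <= g x)%E ->
  (\int[@pushm mu f mf]_x g x = \int[mu]_x g (f x))%E.
Proof. by move=> mg g0; rewrite ge0_integral_pushforward. Qed.

End push.

(** * Lebesgue and Gaussian integrals on the line *)

Section lebesgue_shift.
Variable R : realType.
Local Notation mu := (@lebesgue_measure R).

(** The image of Lebesgue measure under a translation gives every interval []a, b]] its length, and
    this characterises Lebesgue measure. *)
Lemma ge0_integral_lebesgue_shift (c : R) (g : R -> \bar R) :
  measurable_fun setT g -> (forall x, 0 <= g x)%E ->
  (\int[mu]_x g (x + c)%R = \int[mu]_x g x)%E.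
Proof.
move=> mg g0.
pose S : measurableTypeR R -> measurableTypeR R := fun x => x + c.
have mS : measurable_fun setT S by exact: measurable_funD.
rewrite -(ge0_integral_pushm mu mS)//.
apply: eq_measure_integral => A mA _.
apply/esym/(@lebesgue_measure_unique R (pushm mu mS)) => // _ [[a b] _ <-].
rewrite [RHS]pushmE [X in _ = mu X](_ : _ = `]a - c, b - c]%classic); last first.
  by apply/seteqP; split => x; rewrite /S/= !in_itv/= ltrBlDr lerBrDr.
rewrite !lebesgue_measure_itv/= !lte_fin ltrD2r; case: ifP => // _.
by rewrite -!EFinD; congr _%:E; ring.
Qed.

End lebesgue_shift.

Section normal_1d.
Variable R : realType.
Local Notation N01 := (normal_prob (0 : R) 1).
Local Notation mu := (@lebesgue_measure R).

Lemma normal_pdf01 (x : R) : normal_pdf 0 1 x = normal_peak 1 * expR (- x ^+ 2 / 2).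
Proof.
rewrite normal_pdfE ?oner_neq0// /normal_fun subr0 expr1n.
by [].
Qed.

Lemma ge0_integral_normal01 (g : R -> \bar R) :
  measurable_fun setT g -> (forall x, 0 <= g x)%E ->
  (\int[N01]_x g x = \int[mu]_x (g x * (normal_pdf 0 1 x)%:E))%E.
Proof.
move=> mg g0; apply: ge0_integral_density => //; first exact: measurable_normal_pdf.
by move=> x; exact: normal_pdf_ge0.
Qed.

(** The Cameron-Martin formula in dimension one: the exponential is the ratio of the density at
    [x - c] to the density at [x]. *)
Lemma normal01_shift (c : R) (g : R -> \bar R) :
  measurable_fun setT g -> (forall x, 0 <= g x)%E ->
  (\int[N01]_x g (x + c)%R =
   \int[N01]_x (g x * (expR (c * x - c ^+ 2 / 2))%:E))%E.
Proof.
move=> mg g0.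
have mpdf : measurable_fun setT (fun x : R => (normal_pdf 0 1 x)%:E).
  by apply/measurable_EFinP; exact: measurable_normal_pdf.
have mS (b : R) : measurable_fun setT (fun x : R => x + b).
  by exact: measurable_funD.
have mE : measurable_fun setT (fun x : R => (expR (c * x - c ^+ 2 / 2))%:E).
  apply/measurable_EFinP; apply: measurableT_comp => //.
  by apply: measurable_funB => //; exact: measurable_funM.
rewrite ge0_integral_normal01//; last exact: (measurableT_comp mg (mS c)).
rewrite ge0_integral_normal01; last 2 first.
- by apply: emeasurable_funM.
- by move=> x; rewrite mule_ge0// lee_fin expR_ge0.
rewrite -[RHS](ge0_integral_lebesgue_shift c); last 2 first.
- by apply: emeasurable_funM => //; exact: emeasurable_funM.
- by move=> x; rewrite !mule_ge0// lee_fin ?expR_ge0 ?normal_pdf_ge0.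
apply: eq_integral => x _; rewrite -muleA; congr (_ * _)%E.
rewrite -EFinM !normal_pdf01 mulrCA -expRD; congr (_ * expR _)%:E.
by field.
Qed.

(** The integrand times the normal density is [s] times the density of the centred normal law of
    standard deviation [s], where [s^2 = 1/(1 - t)]. *)
Lemma normal01_expR_sqr (t : R) : 0 <= t < 1 ->
  (\int[N01]_x (expR (t * x ^+ 2 / 2))%:E = ((Num.sqrt (1 - t))^-1)%:E)%E.
Proof.
move=> /andP[t0 t1].
have s0 : 0 < 1 - t by lra.
have r0 : 0 < Num.sqrt (1 - t) by rewrite sqrtr_gt0.
have mq : measurable_fun setT (fun x : R => (expR (t * x ^+ 2 / 2))%:E).
  apply/measurable_EFinP; apply: measurableT_comp => //.
  apply: measurable_funM => //; exact: measurable_funM.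
rewrite ge0_integral_normal01//.
pose s := (Num.sqrt (1 - t))^-1.
have sn0 : s != 0 by rewrite gt_eqF// invr_gt0.
transitivity (\int[mu]_x ((s)%:E * (normal_pdf 0 s x)%:E))%E; last first.
  rewrite ge0_integralZl//; last 3 first.
  - by apply/measurable_EFinP; exact: measurable_normal_pdf.
  - by move=> x _; rewrite lee_fin normal_pdf_ge0.
  - by rewrite lee_fin invr_ge0 ltW.
  by rewrite integral_normal_pdf mule1.
have peakE (u : R) : 0 < u -> normal_peak u = u^-1 * (Num.sqrt (pi *+ 2))^-1.
  move=> u0; rewrite /normal_peak -mulrnAr sqrtrM; last exact: sqr_ge0.
  by rewrite sqrtr_sqr gtr0_norm// invfM.
have pdfE (x : R) : expR (t * x ^+ 2 / 2) * normal_pdf 0 1 x = s * normal_pdf 0 s x.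
  rewrite normal_pdf01 normal_pdfE// /normal_fun subr0 mulrCA -expRD.
  have -> : normal_peak 1 = s * normal_peak s.
    by rewrite !peakE ?invr_gt0// invr1 mul1r mulrA mulfV ?mul1r.
  rewrite -[LHS]mulrA; congr (_ * (_ * expR _)).
  have -> : s ^+ 2 = (1 - t)^-1 by rewrite exprVn sqr_sqrtr// ltW.
  rewrite -[_^-1 *+ 2]mulr_natr invfM invrK; by field.
by apply: eq_integral => x _; rewrite -!EFinM pdfE.
Qed.

End normal_1d.

(** * Measurable linear algebra and the Euclidean dot product *)

Section linear_measurability.
Context d (T : measurableType d) (R : realType).

Definition dot (m : nat) (u v : 'cV[R]_m) : R := \sum_(a < m) u a 0 * v a 0.

Lemma measurable_mxD m n (f g : T -> 'M[R]_(m, n)) :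
  measurable_fun setT f -> measurable_fun setT g ->
  measurable_fun setT (fun x => f x + g x).
Proof.
move=> mf mg; apply: measurable_mxP => i j.
rewrite (_ : (fun _ => _) = (fun x => f x i j) \+ (fun x => g x i j)); last first.
  by apply/funext => x; rewrite mxE.
by apply: measurable_funD; exact: measurableT_comp (measurable_mx_entry i j) _.
Qed.

Lemma measurable_mxZ m n (c : R) (f : T -> 'M[R]_(m, n)) :
  measurable_fun setT f -> measurable_fun setT (fun x => c *: f x).
Proof.
move=> mf; apply: measurable_mxP => i j.
rewrite (_ : (fun _ => _) = (fun x => c * f x i j)); last first.
  by apply/funext => x; rewrite mxE.
apply: measurable_funM => //; exact: measurableT_comp (measurable_mx_entry i j) _.
Qed.

Lemma measurable_mx_sum m n (I : Type) (s : seq I) (F : I -> T -> 'M[R]_(m, n)) :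
  (forall i, measurable_fun setT (F i)) ->
  measurable_fun setT (fun x => \sum_(i <- s) F i x).
Proof.
move=> mF; elim: s => [|i s IH].
  under eq_fun do rewrite big_nil; exact: measurable_cst.
under eq_fun do rewrite big_cons; exact: measurable_mxD.
Qed.

Lemma measurable_mulmx m n p (A : T -> 'M[R]_(m, n)) (f : T -> 'M[R]_(n, p)) :
  measurable_fun setT A -> measurable_fun setT f ->
  measurable_fun setT (fun x => A x *m f x).
Proof.
move=> mA mf; apply: measurable_mxP => i j.
under eq_fun do rewrite mxE.
apply: measurable_sum => k.
by apply: measurable_funM; exact: measurableT_comp (measurable_mx_entry _ _) _.
Qed.

Lemma measurable_dot m (f g : T -> 'cV[R]_m) :
  measurable_fun setT f -> measurable_fun setT g ->
  measurable_fun setT (fun x => dot (f x) (g x)).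
Proof.
move=> mf mg; apply: measurable_sum => k.
by apply: measurable_funM; exact: measurableT_comp (measurable_mx_entry _ _) _.
Qed.

End linear_measurability.

Section dot_theory.
Context (R : realType) (d : nat).
Implicit Types u v w : 'cV[R]_d.

Lemma dotC u v : dot u v = dot v u.
Proof. by apply: eq_bigr => a _; rewrite mulrC. Qed.

Lemma dotDl u v w : dot (u + v) w = dot u w + dot v w.
Proof. by rewrite -big_split; apply: eq_bigr => a _; rewrite mxE mulrDl. Qed.

Lemma dotDr u v w : dot w (u + v) = dot w u + dot w v.
Proof. by rewrite !(dotC w) dotDl. Qed.

Lemma dotZl c u v : dot (c *: u) v = c * dot u v.
Proof. by rewrite mulr_sumr; apply: eq_bigr => a _; rewrite mxE mulrA. Qed.

Lemma dotZr c u v : dot u (c *: v) = c * dot u v.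
Proof. by rewrite dotC dotZl dotC. Qed.

Lemma dotNl u v : dot (- u) v = - dot u v.
Proof. by rewrite -scaleN1r dotZl mulN1r. Qed.

Lemma dotNr u v : dot u (- v) = - dot u v.
Proof. by rewrite dotC dotNl dotC. Qed.

Lemma dot0l u : dot 0 u = 0.
Proof. by rewrite -(scale0r u) dotZl mul0r. Qed.

Lemma dot0r u : dot u 0 = 0.
Proof. by rewrite dotC dot0l. Qed.

Lemma dot_suml (I : Type) (s : seq I) (P : pred I) (f : I -> 'cV[R]_d) v :
  dot (\sum_(i <- s | P i) f i) v = \sum_(i <- s | P i) dot (f i) v.
Proof.
by apply: (big_morph (fun u => dot u v)) => [x y|]; rewrite ?dotDl ?dot0l.
Qed.

Lemma dot_ge0 u : 0 <= dot u u.
Proof. by apply: sumr_ge0 => a _; rewrite -expr2 sqr_ge0. Qed.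

Lemma dot_eq0 u : dot u u = 0 -> u = 0.
Proof.
move=> /eqP; rewrite psumr_eq0; last by move=> a _; rewrite -expr2 sqr_ge0.
move=> /allP h; apply/colP => a; rewrite mxE.
by have := h a (mem_index_enum a); rewrite /= mulf_eq0 orbb => /eqP.
Qed.

Lemma dot_delta a v : dot (delta_mx a 0) v = v a 0.
Proof.
rewrite /dot (bigD1 a)//= big1 ?addr0 ?mxE ?eqxx ?mul1r// => b ba.
by rewrite mxE (negbTE ba) mul0r.
Qed.

Lemma dot_mulmx (A : 'M[R]_d) u v : dot (A *m u) v = dot u (A^T *m v).
Proof.
rewrite /dot; under eq_bigr do rewrite mxE mulr_suml.
rewrite exchange_big /=; apply: eq_bigr => a _.
rewrite mxE mulr_sumr; apply: eq_bigr => b _.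
by rewrite mxE mulrCA mulrA.
Qed.

Lemma dot_AMGM u v : 2 * `|dot u v| <= dot u u + dot v v.
Proof.
have h1 := dot_ge0 (u + v); have h2 := dot_ge0 (u - v).
rewrite !dotDl !dotDr ?dotNl ?dotNr (dotC v u) in h1 h2.
by case: (ger0P (dot u v)) => _; lra.
Qed.

Lemma dot_CauchySchwarz u v : dot u v ^+ 2 <= dot u u * dot v v.
Proof.
have [v0|v0] := eqVneq (dot v v) 0.
  by rewrite (dot_eq0 v0) !dot0r expr0n mulr0.
have vp : 0 < dot v v by rewrite lt_neqAle eq_sym v0 dot_ge0.
have := dot_ge0 (dot v v *: u - dot u v *: v).
rewrite !dotDl !dotDr ?dotNl ?dotNr !dotZl !dotZr (dotC v u) => h.
rewrite -(ler_pM2l vp) -subr_ge0; apply: le_trans h _.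
by rewrite le_eqVlt; apply/orP; left; apply/eqP; ring.
Qed.

End dot_theory.

(** * Standard Gaussian laws on columns and their translates *)

Lemma ge0_integral_mrestr dT (T : measurableType dT) (R : realType)
    (mu : {measure set T -> \bar R}) (D : set T) (mD : measurable D)
    (g : T -> \bar R) :
  measurable_fun setT g -> (forall x, 0 <= g x)%E ->
  (\int[mrestr mu mD]_x g x = \int[mu]_x (g x * (\1_D x)%:E))%E.
Proof.
move=> mg g0; apply: ge0_integral_density => //.
by move=> A mA; rewrite integral_indic// setIC.
Qed.

Section std_normal.
Context (R : realType) (d : nat).
Local Notation V := 'cV[R]_d.
Local Notation N01 := (normal_prob (0 : R) 1).

Definition rect (A : 'I_d -> set R) : set V := [set x | forall a, A a (x a 0)].

(** [N(0, I)] described by its values on boxes with measurable sides. Boxes are stable under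
    intersection and generate the sigma-algebra, so these values determine the law. *)
Definition std_normal (mu : set V -> \bar R) : Prop :=
  forall A : 'I_d -> set R, (forall a, measurable (A a)) ->
    mu (rect A) = (\prod_(a < d) N01 (A a))%E.

Lemma measurable_rect A : (forall a, measurable (A a)) -> measurable (rect A).
Proof.
move=> mA; rewrite (_ : rect A = \bigcap_a
    ((fun x : V => x a 0) @^-1` A a)).
  apply: fin_bigcap_measurable => [|a _]; first exact: finite_finset.
  rewrite -[X in measurable X]setTI.
  exact: (measurable_mx_entry a 0 measurableT (mA a)).
by apply/seteqP; split => x h a; [move=> _; exact: h|exact: h].
Qed.

Definition rects : set (set V) :=
  [set X | exists2 A, (forall a, measurable (A a)) & X = rect A].

Lemma rects_setI : setI_closed rects.
Proof.
move=> _ _ [A mA ->] [B mB ->]; exists (fun a => A a `&` B a).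
  by move=> a; exact: measurableI.
apply/seteqP; split => x /=.
  by move=> [h1 h2] a; split.
by move=> h; split => a; have [] := h a.
Qed.

Lemma measurable_rects : (@measurable _ V) = <<s rects >>.
Proof.
apply/seteqP; split.
  apply: smallest_sub; first exact: smallest_sigma_algebra.
  move=> _ [[a j] _ [B mB <-]]; rewrite setTI/=.
  apply: sub_sigma_algebra; exists (fun b => if b == a then B else setT).
    by move=> b; case: ifP.
  apply/seteqP; split => x /=.
    by move=> h b; case: ifP => [/eqP->|//]; rewrite ord1 in h *.
  by move=> /(_ a); rewrite eqxx ord1.
apply: smallest_sub; first exact: sigma_algebra_measurable.
by move=> _ [A mA ->]; exact: measurable_rect.
Qed.

Lemma rect_unique (m1 m2 : {measure set V -> \bar R}) :
  (m1 setT < +oo)%E ->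
  (forall A, (forall a, measurable (A a)) -> m1 (rect A) = m2 (rect A)) ->
  forall X, measurable X -> m1 X = m2 X.
Proof.
move=> m1oo m12 X mX; apply: (measure_unique rects (fun=> setT)) => //.
- exact: measurable_rects.
- exact: rects_setI.
- move=> _; exists (fun=> setT) => //.
  by apply/seteqP; split.
- by rewrite bigcup_const.
- by move=> _ [A mA ->]; exact: m12.
Qed.

Lemma std_normal_unique (m1 m2 : probability V R) :
  std_normal m1 -> std_normal m2 -> forall X, measurable X -> m1 X = m2 X.
Proof.
move=> h1 h2; apply: rect_unique => [|A mA]; first by rewrite ltey_eq fin_num_measure.
exact: etrans (h1 A mA) (esym (h2 A mA)).
Qed.

Lemma std_gaussian_std_normal dT (T : measurableType dT) (P : probability T R)
    (X : {RV P >-> V}) : std_gaussian P X -> std_normal (distribution P X).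
Proof.
move=> [law ind] A mA.
have := ind (enum 'I_d) (fun a => (fun w => X w a 0) @^-1` A a) (enum_uniq _).
rewrite big_enum/= => h.
transitivity (P (\bigcap_(i in [set` enum 'I_d]) ((fun w => X w i 0) @^-1` A i))).
  rewrite /distribution/= /pushforward; congr (P _); apply/seteqP; split => w hw a.
    by move=> _; exact: hw.
  by apply: (hw a); rewrite /= mem_enum.
rewrite h; first by apply: eq_bigr => a _; rewrite law.
by move=> a _; exists (A a) => //; rewrite setTI.
Qed.

Section coordinate_shift.
Variable mu : probability V R.
Hypothesis hmu : std_normal mu.
Variables (a : 'I_d) (c : R).

Let shift (x : V) : V := x + c *: delta_mx a 0.
Let mshift : measurable_fun setT shift.
Proof. by apply: measurable_mxD => //; exact: measurable_cst. Qed.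

Let dens (x : V) : R := expR (c * x a 0 - c ^+ 2 / 2).
Let mdens : measurable_fun setT dens.
Proof.
apply: measurableT_comp => //; apply: measurable_funB => //.
by apply: measurable_funM => //; exact: measurable_mx_entry.
Qed.


Let Ap (A : 'I_d -> set R) B b := if b == a then B else A b.

Let rest (A : 'I_d -> set R) := (\prod_(b < d | b != a) N01 (A b))%E.

Let mu_Ap A B : (forall b, measurable (A b)) -> measurable B ->
  mu (rect (Ap A B)) = (N01 B * rest A)%E.
Proof.
move=> mA mB; rewrite hmu; last by move=> b; rewrite /Ap; case: ifP.
rewrite (bigD1 a)//= /Ap eqxx; congr (_ * _)%E.
by apply: eq_bigr => b /negbTE->.
Qed.

Let rest_fin A : (forall b, measurable (A b)) -> rest A \is a fin_num.
Proof.
by move=> mA; apply: prode_fin_num => b _; apply: fin_num_measure; exact: mA.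
Qed.

(** On a box only the side [a] is moved, so the claim is the one-dimensional shift formula times the
    constant factor [rest A] contributed by the other coordinates. *)
Let shift_rect A : (forall b, measurable (A b)) ->
  mu (shift @^-1` rect A) = (\int[mu]_(x in rect A) (dens x)%:E)%E.
Proof.
move=> mA.
pose Bc := [set t : R | A a (t + c)].
have mBc : measurable Bc.
  rewrite -[X in measurable X]setTI.
  exact: (@measurable_funD _ _ _ _ id (cst c)).
have -> : shift @^-1` rect A = rect (Ap A Bc).
  apply/seteqP; split => x /= h b; have := h b; rewrite /Ap /shift !mxE eqxx andbT.
    by case: eqVneq => [->|_]; rewrite ?mulr1 ?mulr0 ?addr0.
  by case: eqVneq => [->|_]; rewrite ?mulr1 ?mulr0 ?addr0.
rewrite mu_Ap//.
pose A0 := Ap A setT.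
have mA0 b : measurable (A0 b) by rewrite /A0 /Ap; case: ifP.
have mrA0 : measurable (rect A0) by exact: measurable_rect.
(* The image under the coordinate [a] of [mu] restricted to the box whose side [a] is left free; by
   independence of the coordinates it is [rest A] times the normal law of the line. *)
pose nu := @pushm _ _ V (measurableTypeR R) R (mrestr mu mrA0) (fun x => x a 0)
  (measurable_mx_entry a 0).
pose phi (t : R) := (\1_(A a) t * expR (c * t - c ^+ 2 / 2))%:E.
have mphi : measurable_fun setT phi.
  apply/measurable_EFinP; apply: measurable_funM.
    exact: measurable_indic.
  apply: measurableT_comp => //.
  by apply: measurable_funB => //; exact: measurable_funM.
have phi0 t : (0 <= phi t)%E by rewrite lee_fin mulr_ge0// expR_ge0.
have nuE B : measurable B -> nu B = (\int[N01]_(x in B) (fine (rest A))%:E)%E.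
  move=> mB; rewrite integral_cst// fineK ?rest_fin// muleC -mu_Ap//.
  rewrite /nu pushmE /mrestr; congr (mu _).
  apply/seteqP; split => x /=; rewrite /A0 /Ap.
    by move=> [xB h] b; have := h b; case: eqVneq => [->|].
  move=> h; split; first by have := h a; rewrite eqxx.
  by move=> b; have := h b; case: eqVneq => [->|].
transitivity (\int[nu]_x phi x)%E.
  rewrite (ge0_integral_density _ _ nuE)//; last by move=> x; rewrite fine_ge0// prode_ge0.
  rewrite fineK ?rest_fin// ge0_integralZr//; last exact: prode_ge0.
  congr (_ * _)%E.
  rewrite -[N01 Bc]mul1e -integral_cst//.
  transitivity (\int[N01]_x (\1_(A a) (x + c))%:E)%E.
    rewrite integral_mkcond; apply: eq_integral => x _.
    rewrite /patch indicE; have [xB|xB] := pselect (A a (x + c)).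
      by rewrite !mem_set.
    by rewrite !memNset.
  rewrite (@normal01_shift _ c (fun x => (\1_(A a) x)%:E))//.
  by apply/measurable_EFinP; exact: measurable_indic.
rewrite ge0_integral_pushm// ge0_integral_mrestr//; last first.
  by apply: measurableT_comp; last exact: measurable_mx_entry.
rewrite [RHS]integral_mkcond; apply: eq_integral => x _.
rewrite /phi -EFinM /patch !indicE; have [hx|hx] := pselect (rect A x).
  have hA0 : rect A0 x by move=> b; rewrite /A0 /Ap; case: eqVneq.
  by rewrite (mem_set hx) (mem_set hA0) (mem_set (hx a)) mul1r mulr1.
rewrite (memNset hx).
have [xa|xa] := pselect (A a (x a 0)); last by rewrite memNset// !mul0r.
have hA0 : ~ rect A0 x.
  move=> hx0; apply: hx => b.
  by have := hx0 b; rewrite /A0 /Ap; case: eqVneq => [->|].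
by rewrite (memNset hA0) mulr0.
Qed.

(** The two sides are integrals against two finite measures that agree on boxes by [shift_rect],
    hence are equal. *)
Lemma coordinate_shift (f : V -> \bar R) :
  measurable_fun setT f -> (forall x, 0 <= f x)%E ->
  (\int[mu]_x f (x + c *: delta_mx a 0)%R =
   \int[mu]_x (f x * (expR (c * x a 0 - c ^+ 2 / 2))%:E))%E.
Proof.
move=> mf f0.
rewrite -(ge0_integral_pushm mu mshift)//.
pose D : {mfun V >-> R} := HB.pack dens (isMeasurableFun.Build _ _ _ _ dens mdens).
have D0 x : 0 <= D x by exact: expR_ge0.
apply: (ge0_integral_density mdens) => //.
apply: (@rect_unique (pushm mu mshift) (mdensity mu D0)).
  by rewrite pushmE preimage_setT ltey_eq fin_num_measure.
by move=> A mA; exact: (shift_rect mA).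
Qed.

End coordinate_shift.

(** The Cameron-Martin formula. Its validity for [u] and for [v] implies it for [u + v], so it is
    enough to have it for multiples of the basis vectors. *)
Lemma std_normal_shift (mu : probability V R) (w : V) (f : V -> \bar R) :
  std_normal mu -> measurable_fun setT f -> (forall x, 0 <= f x)%E ->
  (\int[mu]_x f (x + w)%R =
   \int[mu]_x (f x * (expR (dot w x - dot w w / 2))%:E))%E.
Proof.
move=> hmu.
pose P (w : V) := forall f : V -> \bar R, measurable_fun setT f -> (forall x, 0 <= f x)%E ->
  (\int[mu]_x f (x + w)%R =
   \int[mu]_x (f x * (expR (dot w x - dot w w / 2))%:E))%E.
have mexp (v : V) : measurable_fun setT (fun x : V => (expR (dot v x - dot v v / 2))%:E).
  apply/measurable_EFinP; apply: measurableT_comp => //.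
  by apply: measurable_funB => //; apply: measurable_dot => //; exact: measurable_cst.
have P0 : P 0.
  move=> g mg g0; apply: eq_integral => x _.
  by rewrite !dot0l mul0r subrr expR0 mule1 addr0.
have PD u v : P u -> P v -> P (u + v).
  move=> Pu Pv g mg g0.
  have mgv : measurable_fun setT (fun x : V => g (x + v)).
    apply: measurableT_comp => //; apply: measurable_mxD => //; exact: measurable_cst.
  under eq_integral => x _ do rewrite addrA.
  rewrite (Pu (fun x : V => g (x + v)))//.
  pose k (x : V) := (g x * (expR (dot u (x - v) - dot u u / 2))%:E)%E.
  transitivity (\int[mu]_x k (x + v)%R)%E.
    by apply: eq_integral => x _; rewrite /k addrK.
  rewrite Pv.
  - apply: eq_integral => x _; rewrite /k -muleA -EFinM -expRD.
    congr (_ * (expR _)%:E)%E.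
    by rewrite !dotDl !dotDr dotNr (dotC v u); field.
  - apply: emeasurable_funM => //; apply/measurable_EFinP; apply: measurableT_comp => //.
    apply: measurable_funB => //; apply: measurable_dot; first exact: measurable_cst.
    by apply: measurable_mxD => //; exact: measurable_cst.
  - by move=> x; rewrite mule_ge0// lee_fin expR_ge0.
have Pdelta a c : P (c *: delta_mx a 0).
  move=> g mg g0; rewrite (coordinate_shift hmu)//.
  apply: eq_integral => x _; congr (_ * (expR _)%:E)%E.
  by rewrite dotZl dotZl dotZr !dot_delta mxE !eqxx mulr1 expr2.
suff : P w by exact.
have -> : w = \sum_(a < d) w a 0 *: delta_mx a 0.
  rewrite {1}[w]matrix_sum_delta; apply: eq_bigr => a _.
  by rewrite big_ord1.
by apply: (big_ind P).
Qed.

End std_normal.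

(** * Linear changes of variables and Gaussian integrals of exponentials of quadratic forms *)

Section rotation_scalars.
Context (F : realFieldType) (r : F).
Hypothesis r2 : r ^+ 2 = 2.

Let r0 : r != 0. Proof. by apply/eqP => r0; move: r2; rewrite r0; lra. Qed.

Let rE : r = 2 * r^-1. Proof. by rewrite -r2 expr2 mulfK. Qed.

Let s2 : 2 * r^-1 ^+ 2 = 1. Proof. by rewrite exprVn r2 mulfV. Qed.

(** With [r] a square root of 2, [r - 1] is the tangent of half of 45 degrees and [r^-1] the sine of
    45 degrees: these are the coefficients in the decomposition of a plane rotation into three
    shears. *)
Lemma rotation_fst (x y : F) :
  x + - (r - 1) * y + - (r - 1) * (y + r^-1 * (x + - (r - 1) * y)) = r^-1 * (x - y).
Proof.
move: rE s2; generalize r^-1 => s -> h.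
apply/eqP; rewrite -subr_eq0.
have -> : x + - (2 * s - 1) * y + - (2 * s - 1) * (y + s * (x + - (2 * s - 1) * y))
  - s * (x - y) = (2 * s ^+ 2 - 1) * (- x + y * (2 * s - 2)) by ring.
by rewrite h subrr mul0r.
Qed.

Lemma rotation_snd (x y : F) : y + r^-1 * (x + - (r - 1) * y) = r^-1 * (x + y).
Proof. by field. Qed.

End rotation_scalars.

Section gaussian_calculus.
Context (R : realType) (d : nat).
Local Notation V := 'cV[R]_d.
Variable mu : probability V R.
Hypothesis hmu : std_normal mu.

Let int_cst (c : \bar R) : (\int[mu]_x c = c)%E.
Proof.
exact: etrans (integral_cst mu (@measurableT _ V) c)
  (etrans (congr1 (fun t => c * t)%E (probability_setT mu)) (mule1 c)).
Qed.

Definition rho (x : V) : R := expR (dot x x / 2).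

Let rho_ge0 x : 0 <= rho x. Proof. exact: expR_ge0. Qed.

Lemma measurable_expR_dot d1 (T : measurableType d1) (f g : T -> V) :
  measurable_fun setT f -> measurable_fun setT g ->
  measurable_fun setT (fun x => expR (dot (f x) (g x) / 2)).
Proof.
move=> mf mg; apply: measurableT_comp => //; apply: measurable_funM => //.
exact: measurable_dot.
Qed.

Let mrho : measurable_fun setT rho.
Proof. by apply: measurable_expR_dot; exact: measurable_id. Qed.

(** The shift formula for the constant function 1. *)
Lemma std_normal_mgf (w : V) :
  (\int[mu]_x (expR (dot w x))%:E = (expR (dot w w / 2))%:E)%E.
Proof.
have := std_normal_shift w hmu (measurable_cst (1 : \bar R)%E) (fun=> @lee01 R).
rewrite /= int_cst.
under eq_integral => x _ do rewrite mul1e expRD EFinM.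
have mE : measurable_fun setT (fun x : V => (expR (dot w x))%:E).
  apply/measurable_EFinP; apply: measurableT_comp => //.
  by apply: measurable_dot => //; exact: measurable_cst.
rewrite ge0_integralZr//= expRN => h.
have e0 : (expR (dot w w / 2))%:E != 0%E by rewrite eqe gt_eqF// expR_gt0.
rewrite -[LHS]mule1 -[X in (_ * X)%E](_ : ((expR (dot w w / 2))^-1%:E *
  (expR (dot w w / 2))%:E)%E = 1%E); last by rewrite -EFinM mulVf// gt_eqF// expR_gt0.
by rewrite muleA -h mul1e.
Qed.

(* [rho] is the density of (2 pi)^(-d/2) times Lebesgue measure, which is
   translation invariant. *)
Lemma rho_shift (w : V) (f : V -> \bar R) :
  measurable_fun setT f -> (forall x, 0 <= f x)%E ->
  (\int[mu]_x (f (x + w)%R * (rho x)%:E) = \int[mu]_x (f x * (rho x)%:E))%E.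
Proof.
move=> mf f0.
pose g (x : V) := (f x * (expR (dot (x - w) (x - w) / 2))%:E)%E.
have mw : measurable_fun setT (fun x : V => x - w).
  by apply: measurable_mxD => //; exact: measurable_cst.
have mg : measurable_fun setT g.
  by apply: emeasurable_funM => //; apply/measurable_EFinP; exact: measurable_expR_dot.
have g0 x : (0 <= g x)%E by rewrite mule_ge0// lee_fin expR_ge0.
transitivity (\int[mu]_x g (x + w)%R)%E.
  by apply: eq_integral => x _; rewrite /g addrK.
rewrite std_normal_shift//; apply: eq_integral => x _.
rewrite /g -muleA -EFinM -expRD; congr (_ * (expR _)%:E)%E.
by rewrite !dotDl !dotDr ?dotNl ?dotNr (dotC x w); field.
Qed.

(** Integrating against [rho x * rho y] and twice against [mu] is, up to a constant factor, Lebesgue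
    integration over pairs; thus the condition says that [phi] preserves volume on pairs. *)
Definition preserving (phi : V * V -> V * V) : Prop :=
  measurable_fun setT phi /\
  forall f : V * V -> \bar R, measurable_fun setT f -> (forall p, 0 <= f p)%E ->
    (\int[mu]_x \int[mu]_y (f (phi (x, y)) * (rho x * rho y)%:E) =
     \int[mu]_x \int[mu]_y (f (x, y) * (rho x * rho y)%:E))%E.

Lemma preserving_comp phi psi :
  preserving phi -> preserving psi -> preserving (phi \o psi).
Proof.
move=> [mphi Pphi] [mpsi Ppsi]; split; first exact: measurableT_comp.
move=> f mf f0 /=.
rewrite (Ppsi (f \o phi) (measurableT_comp mf mphi) (fun p => f0 (phi p))).
exact: Pphi.
Qed.

Definition shear1 (A : 'M[R]_d) (p : V * V) : V * V := (p.1 + A *m p.2, p.2).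
Definition shear2 (A : 'M[R]_d) (p : V * V) : V * V := (p.1, p.2 + A *m p.1).

(** For a fixed first component a shear translates the second, and [rho_shift] applies. The other
    kind of shear is treated alike after exchanging the integrals. *)
Lemma preserving_shear2 A : preserving (shear2 A).
Proof.
split.
  apply: measurable_fun_pair => //; apply: measurable_mxD => //.
  by apply: measurable_mulmx => //; exact: measurable_cst.
move=> f mf f0; apply: eq_integral => x _ /=.
have mfx : measurable_fun setT (fun y => f (x, y)).
  exact: (measurableT_comp mf (pair1_measurable x)).
transitivity (\int[mu]_y ((f (x, (y + A *m x)%R) * (rho x)%:E) * (rho y)%:E))%E.
  by apply: eq_integral => y _; rewrite EFinM muleA.
rewrite (rho_shift _ (f := fun y => f (x, y) * (rho x)%:E)%E).
- by apply: eq_integral => y _; rewrite EFinM muleA.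
- by apply: emeasurable_funM => //; exact: measurable_cst.
- by move=> y; rewrite mule_ge0// lee_fin.
Qed.

Let mrho2 : measurable_fun setT (fun p : V * V => (rho p.1 * rho p.2)%:E).
Proof. by apply/measurable_EFinP; apply: measurable_funM; exact: measurableT_comp. Qed.

Lemma preserving_shear1 A : preserving (shear1 A).
Proof.
have mshear : measurable_fun setT (shear1 A).
  apply: measurable_fun_pair => //; apply: measurable_mxD => //.
  by apply: measurable_mulmx => //; exact: measurable_cst.
split; first exact: mshear.
move=> f mf f0.
rewrite [LHS](fubini_tonelli (fun p => f (shear1 A p) * (rho p.1 * rho p.2)%:E)%E); last 2 first.
- by apply: emeasurable_funM => //; exact: measurableT_comp.
- by move=> p; rewrite mule_ge0// lee_fin mulr_ge0.
rewrite [RHS](fubini_tonelli (fun p => f p * (rho p.1 * rho p.2)%:E)%E); last 2 first.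
- by apply: emeasurable_funM.
- by move=> p; rewrite mule_ge0// lee_fin mulr_ge0.
apply: eq_integral => y _ /=.
have mfx : measurable_fun setT (fun x => f (x, y)).
  exact: (measurableT_comp mf (pair2_measurable y)).
transitivity (\int[mu]_x ((f ((x + A *m y)%R, y) * (rho y)%:E) * (rho x)%:E))%E.
  by apply: eq_integral => x _; rewrite mulrC EFinM muleA.
rewrite (rho_shift _ (f := fun x => f (x, y) * (rho y)%:E)%E).
- by apply: eq_integral => x _; rewrite mulrC EFinM muleA.
- by apply: emeasurable_funM => //; exact: measurable_cst.
- by move=> x; rewrite mule_ge0// lee_fin.
Qed.

(* Whitehead's lemma: diag(A, A^-1) is a product of shears. *)
Lemma preserving_diag (A A' : 'M[R]_d) : A *m A' = 1%:M -> A' *m A = 1%:M ->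
  preserving (fun p => (A *m p.1, A' *m p.2)).
Proof.
move=> AA' A'A.
pose w M M' := shear1 M \o shear2 (- M') \o shear1 M.
have Pw M M' : preserving (w M M') := preserving_comp
  (preserving_comp (preserving_shear1 M) (preserving_shear2 (- M')))
  (preserving_shear1 M).
have wE M M' p : M *m M' = 1%:M -> M' *m M = 1%:M ->
    w M M' p = (M *m p.2, - (M' *m p.1)).
  move=> MM' M'M; case: p => x y; rewrite /w /= /shear1 /shear2 /=.
  have -> : y + - M' *m (x + M *m y) = - (M' *m x).
    by rewrite mulNmx mulmxDr mulmxA M'M mul1mx opprD addrCA subrr addr0.
  by rewrite mulmxN mulmxA MM' mul1mx addrAC subrr add0r.
have := preserving_comp (Pw A A') (Pw (- 1%:M) (- 1%:M)).
have -> // : w A A' \o w (- 1%:M) (- 1%:M) = (fun p => (A *m p.1, A' *m p.2)).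
have N1 : - 1%:M *m - 1%:M = 1%:M :> 'M[R]_d by rewrite mulNmx mulmxN opprK mul1mx.
apply/funext => p; rewrite /comp wE// wE//=.
by rewrite !mulNmx !mul1mx opprK mulmxN opprK.
Qed.

(* Equal to |det A| when [A' = A^-1]. *)
Definition jacobian (A' : 'M[R]_d) : \bar R :=
  (\int[mu]_y (expR (dot y y / 2 - dot (A' *m y) (A' *m y) / 2))%:E)%E.

Lemma measurable_mulmx_cst d1 (T : measurableType d1) (A : 'M[R]_d) (f : T -> V) :
  measurable_fun setT f -> measurable_fun setT (fun x => A *m f x).
Proof. by move=> mf; apply: measurable_mulmx => //; exact: measurable_cst. Qed.

Lemma measurable_quad (A : 'M[R]_d) :
  measurable_fun setT (fun y : V => expR (dot y y / 2 - dot (A *m y) (A *m y) / 2)).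
Proof.
apply: measurableT_comp => //; apply: measurable_funB.
  by apply: measurable_funM => //; exact: measurable_dot.
by apply: measurable_funM => //; apply: measurable_dot; exact: measurable_mulmx_cst.
Qed.

(** The invariance under [diag(A, A^-1)] is applied to the product of [f] with the Gaussian weight
    [exp(- |y|^2 / 2)]. The integral over [y] is [jacobian A'] on one side and 1 on the other, so
    that no determinant has to be computed. *)
Lemma change_of_variables (A A' : 'M[R]_d) (f : V -> \bar R) :
  A *m A' = 1%:M -> A' *m A = 1%:M ->
  measurable_fun setT f -> (forall x, 0 <= f x)%E ->
  (\int[mu]_x (f (A *m x) * (rho x)%:E) * jacobian A' =
   \int[mu]_x (f x * (rho x)%:E))%E.
Proof.
move=> AA' A'A mf f0.
pose F (p : V * V) := (f p.1 * (expR (- (dot p.2 p.2 / 2)))%:E)%E.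
have mF : measurable_fun setT F.
  apply: emeasurable_funM; first exact: measurableT_comp.
  apply/measurable_EFinP; apply: measurableT_comp => //; apply: measurableT_comp => //.
  by apply: measurable_funM => //; exact: measurable_dot.
have F0 p : (0 <= F p)%E by rewrite mule_ge0// lee_fin expR_ge0.
have mfA : measurable_fun setT (fun x => f (A *m x)).
  by apply: measurableT_comp => //; exact: measurable_mulmx_cst.
have mrhoE : measurable_fun setT (fun x => (rho x)%:E) by exact/measurable_EFinP.
have mquadE : measurable_fun setT
    (fun y : V => (expR (dot y y / 2 - dot (A' *m y) (A' *m y) / 2))%:E).
  by apply/measurable_EFinP; exact: measurable_quad.
transitivity (\int[mu]_x \int[mu]_y (F (A *m x, A' *m y) * (rho x * rho y)%:E))%E.
  rewrite -[LHS]ge0_integralZr; last 4 first.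
  - exact: measurableT.
  - exact: emeasurable_funM.
  - by move=> x _; rewrite mule_ge0// lee_fin.
  - by apply: integral_ge0 => y _; rewrite lee_fin expR_ge0.
  apply: eq_integral => x _; rewrite /jacobian -[LHS]ge0_integralZl//; last first.
    by rewrite mule_ge0// lee_fin.
  apply: eq_integral => y _; rewrite /F /= -!muleA; congr (_ * _)%E.
  rewrite -!EFinM; congr (_%:E); rewrite [RHS]mulrCA; congr (_ * _).
  by rewrite /rho -expRD addrC.
rewrite ((preserving_diag AA' A'A).2 F mF F0); apply: eq_integral => x _.
rewrite (eq_integral (fun=> f x * (rho x)%:E)%E); last first.
  move=> y _; rewrite /F/= -muleA -EFinM mulrCA; congr (_ * _%:E)%E.
  by rewrite /rho -expRD addrC subrr expR0 mulr1.
by rewrite int_cst.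
Qed.

(* The rotation by an angle of 45 degrees is a product of three shears. *)
Lemma preserving_rotation :
  preserving (fun p => ((Num.sqrt 2)^-1 *: (p.1 - p.2), (Num.sqrt 2)^-1 *: (p.1 + p.2))).
Proof.
set r := Num.sqrt 2.
have r0 : 0 < r :> R by rewrite sqrtr_gt0.
have r2 : r ^+ 2 = 2 by rewrite sqr_sqrtr.
have P1 := preserving_shear1 (- (r - 1))%:M.
have := preserving_comp P1 (preserving_comp (preserving_shear2 r^-1%:M) P1).
have -> // : shear1 (- (r - 1))%:M \o (shear2 r^-1%:M \o shear1 (- (r - 1))%:M) =
  (fun p => (r^-1 *: (p.1 - p.2), r^-1 *: (p.1 + p.2))).
apply/funext => -[x y]; rewrite /= /shear1 /shear2 /= !mul_scalar_mx.
congr (_, _); apply/matrixP => i j; rewrite !mxE.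
  exact: rotation_fst.
exact: rotation_snd.
Qed.

(** A rotation by 45 degrees turns [x.Tx - y.Ty] into [- 2 (x.Ty)]. The integral over [y] is then
    the moment generating function at [- T x]. *)
Lemma rotation_quad (T : 'M[R]_d) : T^T = T ->
  (\int[mu]_x \int[mu]_y (expR (dot x (T *m x) / 2 - dot y (T *m y) / 2))%:E =
   \int[mu]_y (expR (dot (T *m y) (T *m y) / 2))%:E)%E.
Proof.
move=> Tsym.
have mq : measurable_fun setT (fun x : V => dot x (T *m x) / 2).
  apply: measurable_funM => //; apply: measurable_dot => //.
  exact: measurable_mulmx_cst.
have mn : measurable_fun setT (fun x : V => dot x x / 2).
  by apply: measurable_funM => //; exact: measurable_dot.
pose f (p : V * V) := (expR (dot p.1 (T *m p.1) / 2 - dot p.2 (T *m p.2) / 2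
  - (dot p.1 p.1 / 2 + dot p.2 p.2 / 2)))%:E.
have mf : measurable_fun setT f.
  apply/measurable_EFinP; apply: measurableT_comp => //.
  apply: measurable_funB; first apply: measurable_funB.
  - exact: (measurableT_comp mq).
  - exact: (measurableT_comp mq).
  - by apply: measurable_funD; exact: (measurableT_comp mn).
have f0 p : (0 <= f p)%E by rewrite lee_fin expR_ge0.
have := preserving_rotation.2 f mf f0.
set r := (Num.sqrt 2)^-1.
have r2 : r * r = 2^-1 by rewrite -expr2 exprVn sqr_sqrtr.
have sym x y : dot x (T *m y) = dot y (T *m x).
  by rewrite -{1}Tsym -dot_mulmx dotC.
move=> h.
transitivity (\int[mu]_x \int[mu]_y (f (x, y) * (rho x * rho y)%:E))%E.
  apply: eq_integral => x _; apply: eq_integral => y _.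
  rewrite /f /= -EFinM -!expRD; congr (expR _)%:E.
  by rewrite subrK.
rewrite -h; apply: eq_integral => x _.
transitivity (\int[mu]_y (expR (dot (- (T *m x)) y))%:E)%E; last first.
  by rewrite std_normal_mgf dotNl dotNr opprK.
apply: eq_integral => y _; rewrite /f /= -EFinM -!expRD; congr (expR _)%:E.
rewrite -!scalemxAr !dotZl !dotZr !mulmxDr ?mulmxN !mulrA r2.
rewrite !dotDl !dotDr ?dotNl ?dotNr (dotC y x) (sym y x) (dotC (T *m x)) (sym y x).
by field.
Qed.

Lemma jensen_expR (I : finType) (p y : I -> R) :
  (forall i, 0 <= p i) -> \sum_i p i = 1 ->
  expR (\sum_i p i * y i) <= \sum_i p i * expR (y i).
Proof.
move=> p0 p1; set m := \sum_i p i * y i.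
have -> : expR m = \sum_i p i * (expR m * (1 + (y i - m))).
  under eq_bigr do rewrite mulrCA mulrDr mulr1 mulrBr.
  by rewrite -mulr_sumr big_split/= sumrB -mulr_suml p1 mul1r subrr addr0 mulr1.
apply: ler_sum => i _; apply: ler_wpM2l => //.
have -> : expR (y i) = expR m * expR (y i - m) by rewrite -expRD addrC subrK.
rewrite ler_pM2l ?expR_gt0//.
by rewrite expR_ge1Dx.
Qed.

(** The square is linearised by an auxiliary normal variable [g]: [exp(y^2/2)] is the mean of
    [exp(y g)]. After exchanging the integrals, the integral over [x] is a moment generating
    function and the one over [g] is [normal01_expR_sqr]. *)
Lemma std_normal_expR_sqr (r : V) : dot r r < 1 ->
  (\int[mu]_x (expR (dot r x ^+ 2 / 2))%:E = ((Num.sqrt (1 - dot r r))^-1)%:E)%E.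
Proof.
move=> r1.
pose N01 := normal_prob (0 : R) 1.
have mr : measurable_fun setT (fun x : V => dot r x).
  by apply: measurable_dot => //; exact: measurable_cst.
have lin (y : R) : (\int[N01]_g (expR (y * g))%:E = (expR (y ^+ 2 / 2))%:E)%E.
  have my : measurable_fun setT (fun g : R => (expR (y * g))%:E).
    by apply/measurable_EFinP; apply: measurableT_comp => //; exact: measurable_funM.
  have := normal01_shift y (measurable_cst (1 : \bar R)%E) (fun=> @lee01 R).
  have -> : (\int[N01]_x cst (1 : \bar R) (x + y)%R = 1)%E.
    exact: etrans (integral_cst N01 (@measurableT _ _) 1%E)
      (etrans (congr1 (fun t => 1 * t)%E (probability_setT N01)) (mule1 _)).
  under eq_integral => x _ do rewrite mul1e expRD EFinM.
  rewrite ge0_integralZr//= expRN => h.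
  have e0 := expR_gt0 (y ^+ 2 / 2).
  rewrite -[LHS]mule1 -[X in (_ * X)%E](_ : ((expR (y ^+ 2 / 2))^-1%:E *
    (expR (y ^+ 2 / 2))%:E)%E = 1%E); last by rewrite -EFinM mulVf// gt_eqF.
  by rewrite muleA -h mul1e.
transitivity (\int[mu]_x \int[N01]_g (expR (dot r x * g))%:E)%E.
  by apply: eq_integral => x _; rewrite lin.
have mg : measurable_fun setT (fun p : V * measurableTypeR R => p.2 : R).
  exact: measurable_snd.
rewrite (fubini_tonelli (fun p : V * measurableTypeR R => (expR (dot r p.1 * p.2))%:E)); last 2 first.
- apply/measurable_EFinP; apply: measurableT_comp => //.
  by apply: measurable_funM => //; exact: (measurableT_comp mr).
- by move=> p; rewrite lee_fin expR_ge0.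
rewrite -normal01_expR_sqr ?dot_ge0//.
apply: eq_integral => g _.
transitivity (\int[mu]_x (expR (dot (g *: r) x))%:E)%E.
  by apply: eq_integral => x _; rewrite dotZl mulrC.
rewrite std_normal_mgf dotZl dotZr; congr (expR (_ / 2))%:E.
by rewrite mulrA mulrC expr2.
Qed.

(** Convexity of the exponential takes the weighted mean out of the exponent, so the bound depends
    on the length of a single [r i] and neither on their number nor on the dimension. *)
Lemma std_normal_expR_avg (I : finType) (p : I -> R) (r : I -> V) (t : R) :
  (forall i, 0 <= p i) -> \sum_i p i = 1 -> t < 1 -> (forall i, dot (r i) (r i) <= t) ->
  (\int[mu]_x (expR ((\sum_i p i * dot (r i) x ^+ 2) / 2))%:E <=
   ((Num.sqrt (1 - t))^-1)%:E)%E.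
Proof.
move=> p0 p1 t1 rt.
have mr i : measurable_fun setT (fun x : V => expR (dot (r i) x ^+ 2 / 2)).
  apply: measurableT_comp => //; apply: measurable_funM => //; apply: measurable_funX.
  by apply: measurable_dot => //; exact: measurable_cst.
apply: (@le_trans _ _ (\int[mu]_x (\sum_i (p i * expR (dot (r i) x ^+ 2 / 2))%:E)))%E.
  apply: ge0_le_integral => //.
  - apply/measurable_EFinP; apply: measurableT_comp => //; apply: measurable_funM => //.
    apply: measurable_sum => i; apply: measurable_funM => //; apply: measurable_funX.
    by apply: measurable_dot => //; exact: measurable_cst.
  - by apply: emeasurable_sum => i; apply/measurable_EFinP; exact: measurable_funM.
  - move=> x _; rewrite sumEFin lee_fin mulr_suml.
    under eq_bigr do rewrite -mulrA.
    exact: jensen_expR.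
rewrite ge0_integral_sum//; last 2 first.
- by move=> i; apply/measurable_EFinP; exact: measurable_funM.
- by move=> i x _; rewrite lee_fin mulr_ge0// expR_ge0.
rewrite (_ : ((Num.sqrt (1 - t))^-1)%:E = \sum_i ((p i)%:E * ((Num.sqrt (1 - t))^-1)%:E))%E;
  last by rewrite -ge0_sume_distrl ?sumEFin ?p1 ?mul1e// => i _; rewrite lee_fin.
apply: lee_sum => i _.
under eq_integral do rewrite EFinM.
rewrite ge0_integralZl//; last 2 first.
- exact/measurable_EFinP.
- by rewrite lee_fin.
rewrite std_normal_expR_sqr; last exact: le_lt_trans (rt i) t1.
rewrite lee_wpmul2l ?lee_fin// lef_pV2 ?posrE ?sqrtr_gt0 ?subr_gt0//; last exact: le_lt_trans (rt i) t1.
by rewrite ler_wsqrtr// lerD2l lerN2.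
Qed.

Definition frob (A : 'M[R]_d) : R := \sum_i \sum_j A i j ^+ 2.

Lemma frob_ge0 A : 0 <= frob A.
Proof. by apply: sumr_ge0 => i _; apply: sumr_ge0 => j _; exact: sqr_ge0. Qed.

(** [|T x|^2] is the sum of the squared products of the rows with [x]. Weighting each row by its
    share [p i] of the squared Frobenius norm and rescaling it to the vector [r i] of squared length
    [frob T] makes this a weighted mean of squares. *)
Lemma std_normal_expR_frob (T : 'M[R]_d) : frob T < 1 ->
  (\int[mu]_x (expR (dot (T *m x) (T *m x) / 2))%:E <=
   ((Num.sqrt (1 - frob T))^-1)%:E)%E.
Proof.
move=> T1.
pose row (i : 'I_d) : V := \col_j T i j.
have rowE i x : (T *m x) i 0 = dot (row i) x.
  by rewrite mxE; apply: eq_bigr => j _; rewrite mxE.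
pose t i := dot (row i) (row i).
have frobE : frob T = \sum_i t i.
  by apply: eq_bigr => i _; apply: eq_bigr => j _; rewrite mxE expr2.
have t0 i : 0 <= t i by exact: dot_ge0.
have [f0|f0] := eqVneq (frob T) 0.
  have T0 : T = 0.
    apply/matrixP => i j; rewrite mxE.
    have ti0 : t i = 0.
      by apply/eqP; move: f0 => /eqP; rewrite frobE psumr_eq0// => /allP/(_ i (mem_index_enum _)).
    by have /colP/(_ j) := dot_eq0 ti0; rewrite !mxE.
  rewrite f0 subr0 sqrtr1 invr1 T0.
  under eq_integral => x _ do rewrite mul0mx dot0l mul0r expR0.
  by rewrite int_cst.
have fp : 0 < frob T by rewrite lt_neqAle eq_sym f0 frob_ge0.
pose p i := t i / frob T.
pose r i := Num.sqrt (frob T / t i) *: row i.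
have pr i x : p i * dot (r i) x ^+ 2 = dot (row i) x ^+ 2.
  have [ti0|ti0] := eqVneq (t i) 0.
    by rewrite /p ti0 mul0r mul0r (dot_eq0 ti0) dot0l expr0n.
  rewrite /r dotZl exprMn sqr_sqrtr ?divr_ge0 ?frob_ge0// mulrA /p.
  by rewrite -[RHS]mul1r; congr (_ * _); field; rewrite ti0 f0.
under eq_integral => x _.
  have -> : dot (T *m x) (T *m x) = \sum_i p i * dot (r i) x ^+ 2.
    by apply: eq_bigr => i _; rewrite pr rowE expr2.
  over.
apply: std_normal_expR_avg => //.
- by move=> i; rewrite divr_ge0// frob_ge0.
- by rewrite -mulr_suml -frobE mulfV.
- move=> i; rewrite /r dotZl dotZr mulrA -expr2 sqr_sqrtr ?divr_ge0 ?frob_ge0//.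
  have [ti0|ti0] := eqVneq (t i) 0; first by rewrite -/(t i) ti0 mulr0 frob_ge0.
  by rewrite -/(t i) divfK.
Qed.

End gaussian_calculus.

(** * Averages over finite types and over independent draws *)

Section averages.
Context (R : realType).

(** Expectation under the uniform law. For the type [{ffun 'I_k -> T}] it is the expectation over
    [k] independent uniform draws from [T]. *)
Definition avg (I : finType) (f : I -> R) : R := #|I|%:R^-1 * \sum_i f i.

Lemma avgD (I : finType) (f g : I -> R) : avg (fun i => f i + g i) = avg f + avg g.
Proof. by rewrite /avg big_split/= mulrDr. Qed.

Lemma avgZ (I : finType) c (f : I -> R) : avg (fun i => c * f i) = c * avg f.
Proof. by rewrite /avg -mulr_sumr mulrCA. Qed.

Lemma avgZr (I : finType) c (f : I -> R) : avg (fun i => f i * c) = avg f * c.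
Proof. by rewrite /avg -mulr_suml mulrA. Qed.

Lemma avgN (I : finType) (f : I -> R) : avg (fun i => - f i) = - avg f.
Proof. by rewrite /avg sumrN mulrN. Qed.

Lemma avgB (I : finType) (f g : I -> R) : avg (fun i => f i - g i) = avg f - avg g.
Proof. by rewrite avgD avgN. Qed.

Lemma eq_avg (I : finType) (f g : I -> R) : f =1 g -> avg f = avg g.
Proof. by move=> fg; rewrite /avg; congr (_ * _); exact: eq_bigr. Qed.

Lemma avg_const (I : finType) c : (0 < #|I|)%N -> avg (fun _ : I => c) = c.
Proof.
by move=> I0; rewrite /avg sumr_const -[c *+ _]mulr_natl mulrA mulVf ?mul1r// pnatr_eq0 -lt0n.
Qed.

Lemma ler_avg (I : finType) (f g : I -> R) : (forall i, f i <= g i) -> avg f <= avg g.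
Proof. by move=> fg; rewrite ler_wpM2l ?invr_ge0// ler_sum. Qed.

Lemma avg_ge0 (I : finType) (f : I -> R) : (forall i, 0 <= f i) -> 0 <= avg f.
Proof. by move=> f0; rewrite mulr_ge0 ?invr_ge0// sumr_ge0. Qed.

Lemma exchange_avg (I J : finType) (f : I -> J -> R) :
  avg (fun i => avg (f i)) = avg (fun j => avg (fun i => f i j)).
Proof.
rewrite /avg -!mulr_sumr !mulrA [_^-1 * _]mulrC; congr (_ * _).
exact: exchange_big.
Qed.

Lemma avg_sum (I : finType) (J : Type) (s : seq J) (P : pred J) (f : I -> J -> R) :
  avg (fun i => \sum_(j <- s | P j) f i j) = \sum_(j <- s | P j) avg (fun i => f i j).
Proof. by rewrite /avg exchange_big/= mulr_sumr. Qed.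

Lemma avg_pair (I J : finType) (f : I * J -> R) :
  avg f = avg (fun i => avg (fun j => f (i, j))).
Proof.
rewrite /avg -mulr_sumr mulrA card_prod natrM invfM; congr (_ * _).
by rewrite pair_bigA; apply: eq_bigr => -[].
Qed.

Lemma avg_sqr_le (I : finType) (f : I -> R) : (0 < #|I|)%N ->
  avg f ^+ 2 <= avg (fun i => f i ^+ 2).
Proof.
move=> I0; rewrite -subr_ge0.
have -> : avg (fun i => f i ^+ 2) - avg f ^+ 2 = avg (fun i => (f i - avg f) ^+ 2).
  under [RHS]eq_avg do rewrite sqrrB.
  rewrite avgD avgB avg_const//.
  under [X in _ = _ - X + _]eq_avg do rewrite -mulrnAr.
  by rewrite avgZr; ring.
by apply: avg_ge0 => i; exact: sqr_ge0.
Qed.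

Definition fcons (T : finType) (k : nat) (x : T) (f : {ffun 'I_k -> T}) :
  {ffun 'I_k.+1 -> T} := [ffun i => if unlift ord0 i is Some j then f j else x].

Lemma fcons0 (T : finType) k (x : T) (f : {ffun 'I_k -> T}) : fcons x f ord0 = x.
Proof. by rewrite ffunE unlift_none. Qed.

Lemma fconsS (T : finType) k (x : T) (f : {ffun 'I_k -> T}) j :
  fcons x f (lift ord0 j) = f j.
Proof. by rewrite ffunE liftK. Qed.

(** Conditioning on the first draw; inductions on the number of draws rest on this. *)
Lemma avg_ffunS (T : finType) k (F : {ffun 'I_k.+1 -> T} -> R) :
  avg F = avg (fun x => avg (fun f => F (fcons x f))).
Proof.
rewrite -(avg_pair (fun p => F (fcons p.1 p.2))).
pose unc (g : {ffun 'I_k.+1 -> T}) := (g ord0, [ffun j => g (lift ord0 j)]).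
have K1 : cancel (fun p => fcons p.1 p.2) unc.
  case=> x f; rewrite /unc /= fcons0; congr (_, _).
  by apply/ffunP => j; rewrite ffunE fconsS.
have K2 : cancel unc (fun p => fcons p.1 p.2).
  move=> g; apply/ffunP => i; rewrite !ffunE /=.
  by case: unliftP => [j ->|->]; rewrite ?ffunE.
have bij : bijective (fun p : T * {ffun 'I_k -> T} => fcons p.1 p.2).
  by exists unc.
by rewrite /avg (bij_eq_card bij) (reindex (fun p => fcons p.1 p.2))//; exact: onW_bij.
Qed.

Lemma avg_ffun0 (T : finType) (F : {ffun 'I_0 -> T} -> R) f : avg F = F f.
Proof.
have e g : g = f by apply/ffunP => -[].
have c1 : #|{ffun 'I_0 -> T}| = 1%N by rewrite card_ffun card_ord expn0.
rewrite /avg c1 invr1 mul1r (bigD1 f)//= big1 ?addr0// => g.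
by rewrite (e g) eqxx.
Qed.

Lemma card_ffun_gt0 (T : finType) k : (0 < #|T|)%N -> (0 < #|{ffun 'I_k -> T}|)%N.
Proof. by move=> T0; rewrite card_ffun expn_gt0 T0. Qed.

Lemma avg_iid_sum0 (T : finType) k (chi : T -> R) : (0 < #|T|)%N -> avg chi = 0 ->
  avg (fun f : {ffun 'I_k -> T} => \sum_j chi (f j)) = 0.
Proof.
move=> T0 chi0; elim: k => [|m IHm].
  by rewrite (avg_ffun0 _ [ffun=> xchoose (card_gt0P T0)])// big_ord0.
rewrite avg_ffunS.
under eq_avg => x.
  under eq_avg => f.
    rewrite big_ord_recl fcons0.
    under eq_bigr do rewrite fconsS.
    over.
  rewrite avgD avg_const ?card_ffun_gt0// IHm addr0; over.
exact: chi0.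
Qed.

(** Products of two different draws average to zero, since the draws are independent and centred,
    and [k] diagonal terms remain. *)
Lemma avg_iid_prod (T : finType) k (phi psi : T -> R) : (0 < #|T|)%N ->
  avg phi = 0 -> avg psi = 0 ->
  avg (fun f : {ffun 'I_k -> T} => (\sum_j phi (f j)) * (\sum_j psi (f j))) =
  k%:R * avg (fun x => phi x * psi x).
Proof.
move=> T0 phi0 psi0; elim: k => [|k IH].
  by rewrite (avg_ffun0 _ [ffun=> xchoose (card_gt0P T0)])// !big_ord0 !mul0r.
rewrite avg_ffunS.
under eq_avg => x.
  under eq_avg => f.
    rewrite !big_ord_recl !fcons0.
    under eq_bigr do rewrite fconsS.
    under [X in _ * (_ + X)]eq_bigr do rewrite fconsS.
    rewrite mulrDl !mulrDr.
    over.
  rewrite !avgD avg_const ?card_ffun_gt0// avgZ avgZr !avg_iid_sum0// IH mulr0 mul0r addr0 add0r.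
  over.
by rewrite avgD avg_const// -natr1 mulrDl mul1r addrC.
Qed.

(** The variance of a sample mean is the variance of one draw divided by [k], and a variance is at
    most the second moment. *)
Lemma avg_iid_sqr (T : finType) k (phi : T -> R) : (0 < #|T|)%N -> (0 < k)%N ->
  avg (fun f : {ffun 'I_k -> T} => (k%:R^-1 * (\sum_j phi (f j)) - avg phi) ^+ 2) <=
  k%:R^-1 * avg (fun x => phi x ^+ 2).
Proof.
move=> T0 k0.
pose psi x := phi x - avg phi.
have psi0 : avg psi = 0 by rewrite /psi avgB avg_const// subrr.
have kn0 : k%:R != 0 :> R by rewrite pnatr_eq0 -lt0n.
have e (f : {ffun 'I_k -> T}) : (k%:R^-1 * (\sum_j phi (f j)) - avg phi) ^+ 2 =
    k%:R^-1 ^+ 2 * ((\sum_j psi (f j)) * (\sum_j psi (f j))).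
  rewrite -expr2 -exprMn; congr (_ ^+ 2).
  by rewrite /psi sumrB sumr_const card_ord -[avg phi *+ _]mulr_natl mulrBr mulKf.
under eq_avg do rewrite e.
rewrite avgZ avg_iid_prod// expr2 -mulrA mulKf//.
apply: ler_wpM2l; first by rewrite invr_ge0.
have -> : avg (fun x => psi x * psi x) = avg (fun x => phi x ^+ 2) - avg phi ^+ 2.
  under eq_avg do rewrite /psi -expr2 sqrrB.
  rewrite avgD avgB avg_const//.
  under [X in _ - X + _ = _]eq_avg do rewrite -mulrnAr.
  by rewrite avgZr; ring.
by rewrite lerBlDr lerDl sqr_ge0.
Qed.

End averages.

(** * Scalar inequalities for the exponential and the inverse square root *)

Section exponential_bounds.
Context (R : realType).
Implicit Types x y : R.

Lemma is_derive_ge0_le (f f' : R -> R) (a b : R) :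
  (forall x, is_derive x 1 f (f' x)) -> a <= b ->
  (forall x, a < x < b -> 0 <= f' x) -> f a <= f b.
Proof.
move=> df ab f'0.
have dfx x : derivable f x 1 by exact: (@ex_derive _ _ _ _ _ _ _ (df x)).
apply: (@ger0_derive1_le_cc _ f a b) => //.
- by move=> x; rewrite in_itv/= => xab; rewrite derive1E (@derive_val _ _ _ _ _ _ _ (df x)) f'0.
- by apply: derivable_within_continuous => x _.
- by rewrite in_itv/= lexx.
- by rewrite in_itv/= lexx andbT.
Qed.

(** From [1 - y <= exp(-y)] the exponential is at most [1/(1 - y)], which the quadratic dominates as
    long as [1 - 2y >= 0]. *)
Lemma expR_le_quad y : y <= 2^-1 -> expR y <= 1 + y + 2 * y ^+ 2.
Proof.
move=> y2; have := expR_ge1Dx (- y); rewrite expRN => h.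
have y1 : 0 < 1 - y by lra.
have : expR y <= (1 - y)^-1 by rewrite -[leLHS]invrK lef_pV2 ?posrE ?invr_gt0 ?expR_gt0.
move=> /le_trans; apply.
rewrite -[leLHS]mul1r ler_pdivrMr// -subr_ge0.
have -> : (1 + y + 2 * y ^+ 2) * (1 - y) - 1 = y ^+ 2 * (1 - 2 * y) by ring.
by apply: mulr_ge0; [exact: sqr_ge0|lra].
Qed.

Lemma expR_le_cubic y : expR y <= 1 + y + y ^+ 2 / 2 + `|y| ^+ 3 / 6 * expR `|y|.
Proof.
have [y0|y0] := leP y 0.
  apply: (@le_trans _ _ (1 + y + y ^+ 2 / 2)); last first.
    by rewrite lerDl mulr_ge0 ?expR_ge0// divr_ge0// exprn_ge0.
  pose k (x : R) := expR x - (1 + x + x ^+ 2 / 2).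
  have dk (x : R) : is_derive x 1 k (expR x - (1 + x)).
    apply: is_derive_eq; rewrite /GRing.scale/=; by field.
  have /(_ y0) := @is_derive_ge0_le k (fun x => expR x - (1 + x)) y 0 dk.
  rewrite {2}/k expR0 expr0n/= mul0r !addr0 subrr subr_le0; apply => x _.
  by rewrite subr_ge0 expR_ge1Dx.
(* This function is nondecreasing on the negative half-line and equals -1 at 0. The claim is its
   value at [- y], compared with -1, after multiplication by [exp(y)]. *)
pose k (t : R) := t ^+ 3 / 6 - expR t * (1 - t + t ^+ 2 / 2).
have dk (t : R) : is_derive t 1 k (t ^+ 2 / 2 * (1 - expR t)).
  apply: is_derive_eq; rewrite /GRing.scale/=; by field.
have yN0 : - y <= 0 by lra.
have := @is_derive_ge0_le k _ (- y) 0 dk yN0.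
rewrite {2}/k expR0 expr0n/= mul0r expr0n mul0r subr0 addr0 mul1r sub0r => h.
have {}h : k (- y) <= - 1.
  apply: h => x /andP[_ x0]; rewrite mulr_ge0 ?divr_ge0 ?sqr_ge0//.
  by rewrite subr_ge0 expR_le1 ltW.
rewrite gtr0_norm//.
have e0 := expR_gt0 y.
have eV : expR y * expR (- y) = 1 by exact: expRxMexpNx_1.
move: h; rewrite /k => /(ler_wpM2l (ltW e0)).
rewrite mulrBr [expR y * (expR _ * _)]mulrA eV mul1r sqrrN opprK (_ : (- y) ^+ 3 = - y ^+ 3); last by ring.
move: (expR y) => e; lra.
Qed.

(* The cubic remainder with the cube absorbed in the exponential. *)
Lemma expR_le_taylor2 (l y : R) : 0 < l ->
  expR y <= 1 + y + y ^+ 2 / 2 + l^-1 ^+ 3 * expR ((1 + l) * `|y|).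
Proof.
move=> l0; apply: le_trans (expR_le_cubic y) _; rewrite lerD2l.
rewrite mulrDl mul1r expRD mulrCA [leLHS]mulrC ler_pM2l ?expR_gt0//.
have ly0 : 0 <= l * `|y| by rewrite mulr_ge0// ltW.
have := expR_ge1Dxn 2 ly0; rewrite /= exprMn => h.
rewrite exprVn [leRHS]mulrC ler_pdivlMr ?exprn_gt0//.
have -> : 6 = 3`!%:R :> R by [].
by apply: le_trans h; rewrite mulrAC [_ ^+ 3 * _]mulrC lerDr.
Qed.

Lemma invsqrt_le (t : R) : 0 <= t <= 2^-1 -> (Num.sqrt (1 - t))^-1 <= 1 + t / 2 + t ^+ 2.
Proof.
move=> /andP[t0 t2].
have s0 : 0 < Num.sqrt (1 - t) by rewrite sqrtr_gt0; lra.
have q0 : 0 < 1 + t / 2 + t ^+ 2 by have := sqr_ge0 t; lra.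
rewrite -[leRHS]invrK lef_pV2 ?posrE ?invr_gt0//.
have i0 : 0 <= (1 + t / 2 + t ^+ 2)^-1 by rewrite invr_ge0 ltW.
rewrite -[leLHS](ger0_norm i0) -sqrtr_sqr; apply: ler_wsqrtr.
rewrite exprVn -[leLHS]mul1r ler_pdivrMr ?exprn_gt0// -subr_ge0.
have -> : (1 - t) * (1 + t / 2 + t ^+ 2) ^+ 2 - 1 =
  t ^+ 2 * ((1 - t) * (5 / 4) - t ^+ 3) by field.
apply: mulr_ge0; first exact: sqr_ge0.
have : t ^+ 3 <= t * (2^-1 * 2^-1).
  by rewrite exprS ler_wpM2l// expr2 ler_pM.
lra.
Qed.

End exponential_bounds.

(** * An exponential moment of the squared norm of a sum of bounded independent vectors *)

Section exponential_moment.
Context (R : realType) (d : nat) (T : finType).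
Variables (X : T -> 'cV[R]_d) (b : R).
Hypotheses (T0 : (0 < #|T|)%N) (Xmean : forall s, avg (fun x => dot s (X x)) = 0)
  (b0 : 0 < b) (Xb : forall x, dot (X x) (X x) <= b).

(** Expanding the square leaves the random factor [exp(y)] with [y = 2 t (s.X)]. The smallness
    condition gives [y <= 1/2], so [expR_le_quad] applies; the linear term averages to zero and the
    quadratic one is controlled by Cauchy-Schwarz. *)
Lemma exp_moment_step (t : R) (s : 'cV[R]_d) :
  0 <= t -> 16 * t ^+ 2 * (dot s s * b) <= 1 ->
  avg (fun x => expR (t * dot (s + X x) (s + X x))) <=
  expR ((t + 8 * t ^+ 2 * b) * dot s s + t * b).
Proof.
move=> t0 small.
pose y x := 2 * t * dot s (X x).
have y2 x : y x ^+ 2 <= 4 * t ^+ 2 * (dot s s * b).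
  rewrite /y !exprMn -[2 ^+ 2]/(2 * 2) (_ : 2 * 2 = 4 :> R); last by ring.
  rewrite ler_wpM2l ?mulr_ge0 ?sqr_ge0//.
  apply: le_trans (dot_CauchySchwarz _ _) _.
  by rewrite ler_wpM2l ?dot_ge0.
have yle x : y x <= 2^-1.
  have h : y x ^+ 2 <= 4^-1 by apply: le_trans (y2 x) _; lra.
  rewrite leNgt; apply/negP => yh.
  have : 2^-1 * 2^-1 < y x * y x by apply: ltr_pM.
  by rewrite -expr2; lra.
apply: (@le_trans _ _ (avg (fun x =>
    expR (t * dot s s + t * b) * (1 + y x + 2 * (4 * t ^+ 2 * (dot s s * b)))))).
  apply: ler_avg => x.
  apply: (@le_trans _ _ (expR (t * dot s s + t * b) * expR (y x))).
    rewrite -expRD ler_expR !dotDl !dotDr (dotC (X x) s) /y.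
    have := ler_wpM2l t0 (Xb x); lra.
  rewrite ler_wpM2l ?expR_ge0//; apply: le_trans (expR_le_quad (yle x)) _.
  by rewrite lerD2l ler_wpM2l.
rewrite avgZ !avgD !avg_const// /y avgZ Xmean mulr0 addr0.
have -> : (t + 8 * t ^+ 2 * b) * dot s s + t * b =
  (t * dot s s + t * b) + 2 * (4 * t ^+ 2 * (dot s s * b)) by ring.
rewrite [leRHS]expRD ler_wpM2l ?expR_ge0//.
by apply: le_trans (expR_ge1Dx _); rewrite lerD2l; lra.
Qed.

(** Averaging out one draw raises the rate in front of [|s|^2] from [t] to [t + 8 t^2 b] and costs a
    factor [exp(t b)]. Starting at [1/(16 N b)], the rate stays bounded by twice its initial value
    over [N] draws, and the total cost is at most [exp(1/8)]. *)
Lemma exp_moment (N : nat) : (0 < N)%N ->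
  avg (fun f : {ffun 'I_N -> T} =>
    expR ((16 * N%:R * b)^-1 * dot (\sum_j X (f j)) (\sum_j X (f j)))) <= 2.
Proof.
move=> N0.
pose q k : R := 2 * N%:R - k%:R.
(* An explicit sequence with [t k.+1 >= t k + 8 b (t k)^2]: the equation [t' = 8 b t^2] is solved by
   the inverse of a decreasing linear function. *)
pose t k := (8 * b * q k)^-1.
have Np : 1 <= N%:R :> R by rewrite ler1n.
have qN k : (k <= N)%N -> N%:R <= q k.
  by rewrite -(ler_nat R) /q; lra.
have q0 k : (k <= N)%N -> 0 < q k by move=> /qN; lra.
have tq k : (k <= N)%N -> t k * b * q k = 8^-1.
  by move=> /q0 qk; rewrite /t; field; rewrite !gt_eqF.
have tp k : (k <= N)%N -> 0 < t k.
  by move=> /q0 qk; rewrite invr_gt0 !mulr_gt0.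
have tb k : (k <= N)%N -> t k * b <= (8 * N%:R)^-1.
  move=> kN; rewrite /t -mulrA mulrC invfM mulrA.
  rewrite -[b * 8^-1]mulrC -!mulrA (invfM b) (mulrA b) divff ?gt_eqF// mul1r invfM ler_pM2l ?invr_gt0//.
  by rewrite lef_pV2 ?posrE ?q0 ?qN//; lra.
(* Here [s] stands for the sum of the [N - k] draws already fixed, whence the bound on its norm.
   This bound provides the smallness condition of [exp_moment_step]. *)
have key k (s : 'cV[R]_d) : (k <= N)%N -> dot s s <= (N%:R - k%:R) ^+ 2 * b ->
    avg (fun f : {ffun 'I_k -> T} =>
      expR (t 0%N * dot (s + \sum_j X (f j)) (s + \sum_j X (f j)))) <=
    expR (k%:R * (8 * N%:R)^-1 + t k * dot s s).
  elim: k s => [|k IH] s kN sb.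
    rewrite (avg_ffun0 _ [ffun=> xchoose (card_gt0P T0)]) big_ord0 addr0.
    by rewrite mul0r add0r.
  have kN' : (k <= N)%N by exact: ltnW.
  have kp : k%:R + 1 <= N%:R :> R by rewrite natr1 ler_nat.
  set m := N%:R - k.+1%:R in sb.
  have mE : N%:R - k%:R = m + 1 by rewrite /m -natr1; ring.
  have m0 : 0 <= m by rewrite /m -natr1; lra.
  rewrite avg_ffunS.
  apply: (@le_trans _ _ (avg (fun x =>
      expR (k%:R * (8 * N%:R)^-1) * expR (t k * dot (s + X x) (s + X x))))).
    apply: ler_avg => x.
    under eq_avg => f.
      rewrite big_ord_recl fcons0 addrA.
      under eq_bigr do rewrite fconsS.
      over.
    rewrite -expRD; apply: IH => //.
    have sx : dot s (X x) <= m * b.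
      rewrite leNgt; apply/negP => h.
      have mb0 : 0 <= m * b by rewrite mulr_ge0// ltW.
      have := dot_CauchySchwarz s (X x); rewrite leNgt => /negP; apply.
      apply: (@le_lt_trans _ _ ((m * b) ^+ 2)).
        apply: (@le_trans _ _ (m ^+ 2 * b * b)); last by rewrite le_eqVlt; apply/orP; left; apply/eqP; ring.
        by apply: ler_pM => //; exact: dot_ge0.
      by rewrite !expr2 ltr_pM.
    rewrite mE !dotDl !dotDr (dotC (X x) s).
    have -> : (m + 1) ^+ 2 * b = m ^+ 2 * b + 2 * (m * b) + b by ring.
    by have := Xb x; move: sx sb; lra.
  rewrite avgZ.
  have small : 16 * t k ^+ 2 * (dot s s * b) <= 1.
    apply: (@le_trans _ _ (16 * t k ^+ 2 * (q k ^+ 2 * b * b))).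
      apply: ler_wpM2l; first by rewrite mulr_ge0 ?sqr_ge0.
      apply: ler_wpM2r; first exact: ltW.
      apply: le_trans sb _; apply: ler_wpM2r; first exact: ltW.
      by rewrite !expr2 ler_pM// /m /q -natr1; lra.
    have -> : 16 * t k ^+ 2 * (q k ^+ 2 * b * b) = 16 * (t k * b * q k) ^+ 2 by ring.
    by rewrite tq//; lra.
  have h := exp_moment_step (ltW (tp k kN')) small.
  apply: le_trans (ler_wpM2l (expR_ge0 _) h) _.
  rewrite -expRD ler_expR.
  have t1 : (t k + 8 * t k ^+ 2 * b) * dot s s <= t k.+1 * dot s s.
    rewrite ler_wpM2r ?dot_ge0// /t.
    have qS : q k = q k.+1 + 1 by rewrite /q -natr1; ring.
    have qS0 := q0 _ kN.
    rewrite qS; set r := q k.+1 in qS0 *.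
    have r1 : 0 < r + 1 by lra.
    rewrite -subr_ge0.
    have -> : (8 * b * r)^-1 - ((8 * b * (r + 1))^-1 + 8 * (8 * b * (r + 1))^-1 ^+ 2 * b) =
        (8 * b * r * (r + 1) ^+ 2)^-1.
      by field; rewrite !gt_eqF.
    by rewrite invr_ge0 !mulr_ge0// ?sqr_ge0// ltW.
  have := tb k kN'; rewrite -natr1 mulrDl mul1r; move: t1; lra.
have := key N 0 (leqnn N); rewrite subrr expr0n/= mul0r dot0l lexx => /(_ isT).
rewrite mulr0 addr0 => h.
apply: (@le_trans _ _ (expR (8^-1))); last first.
  apply: le_trans (expR_le_quad _) _; first lra.
  by lra.
have -> : 8^-1 = N%:R * (8 * N%:R)^-1 :> R by field; rewrite gt_eqF//; lra.
have -> : (16 * N%:R * b)^-1 = t 0%N by rewrite /t /q subr0; congr (_^-1); ring.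
apply: le_trans h; rewrite le_eqVlt; apply/orP; left; apply/eqP; apply: eq_avg => f.
by rewrite add0r.
Qed.

End exponential_moment.

(** * The Frobenius norm *)

Section frobenius.
Context (R : realType) (d : nat).
Implicit Types (A X Y : 'M[R]_d) (u v : 'cV[R]_d).

Lemma frob_tr A : frob A^T = frob A.
Proof.
by rewrite /frob exchange_big; apply: eq_bigr => i _; apply: eq_bigr => j _; rewrite mxE.
Qed.

Lemma frob_col A : frob A = \sum_j dot (col j A) (col j A).
Proof.
by rewrite /frob exchange_big; apply: eq_bigr => j _; apply: eq_bigr => i _; rewrite !mxE expr2.
Qed.

Lemma frob_mulmx_le K A X : (forall v, dot (A *m v) (A *m v) <= K * dot v v) ->
  frob (A *m X) <= K * frob X.
Proof.
move=> AK; rewrite !frob_col mulr_sumr; apply: ler_sum => j _.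
by rewrite colE -mulmxA -colE.
Qed.

Lemma frob_conj_le K A X : 0 <= K -> A^T = A ->
  (forall v, dot (A *m v) (A *m v) <= K * dot v v) ->
  frob (A *m X *m A) <= K ^+ 2 * frob X.
Proof.
move=> K0 As AK; rewrite -mulmxA expr2 -mulrA.
apply: le_trans (frob_mulmx_le _ AK) _; rewrite ler_wpM2l//.
by rewrite -frob_tr trmx_mul As (le_trans (frob_mulmx_le _ AK))// frob_tr.
Qed.

Lemma frob_mulmx A X : frob (A *m X) <= frob A * frob X.
Proof.
apply: frob_mulmx_le => v; rewrite /frob mulr_suml; apply: ler_sum => i _.
have -> : (A *m v) i 0 = dot (\col_j A i j) v.
  by rewrite mxE; apply: eq_bigr => j _; rewrite mxE.
rewrite -expr2; apply: le_trans (dot_CauchySchwarz _ _) _.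
rewrite ler_wpM2r ?dot_ge0//.
by rewrite /dot; apply: ler_sum => j _; rewrite mxE expr2.
Qed.

Lemma frobD_le X Y : frob (X + Y) <= 2 * frob X + 2 * frob Y.
Proof.
rewrite /frob !mulr_sumr -big_split/=; apply: ler_sum => i _.
rewrite !mulr_sumr -big_split/=; apply: ler_sum => j _.
rewrite mxE -subr_ge0.
have -> : 2 * X i j ^+ 2 + 2 * Y i j ^+ 2 - (X i j + Y i j) ^+ 2 = (X i j - Y i j) ^+ 2.
  by move: (X i j) (Y i j) => x y; ring.
exact: sqr_ge0.
Qed.

Lemma frobZ c X : frob (c *: X) = c ^+ 2 * frob X.
Proof.
rewrite /frob mulr_sumr; apply: eq_bigr => i _; rewrite mulr_sumr.
by apply: eq_bigr => j _; rewrite mxE exprMn.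
Qed.

Lemma outerE u v i j : (u *m v^T) i j = u i 0 * v j 0.
Proof. by rewrite mxE big_ord1 mxE. Qed.

Lemma frob_outer u v : frob (u *m v^T) = dot u u * dot v v.
Proof.
rewrite /frob /dot mulr_suml; apply: eq_bigr => i _; rewrite mulr_sumr.
by apply: eq_bigr => j _; rewrite outerE; ring.
Qed.

Lemma mulmx_outer u v x : u *m v^T *m x = dot v x *: u.
Proof.
rewrite -mulmxA; apply/colP => i; rewrite !mxE big_ord1 mulrC; congr (_ * _).
by rewrite mxE; apply: eq_bigr => k _; rewrite mxE.
Qed.

Lemma dot_mulmx_frob A u v : dot u (A *m v) = \sum_i \sum_j A i j * (u i 0 * v j 0).
Proof.
apply: eq_bigr => i _; rewrite mxE mulr_sumr; apply: eq_bigr => j _; ring.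
Qed.

(* Averages over two independent copies: the mixed quadratic terms complete a
   square in Frobenius norm. *)
Lemma frob_avg_square (I : finType) (w : I -> 'cV[R]_d) A : (0 < #|I|)%N ->
  let Sw := \matrix_(i, j) avg (fun k => w k i 0 * w k j 0) in
  avg (fun k => avg (fun l => dot (w k) (w l) ^+ 2)) -
    2 * avg (fun k => dot (w k) (A *m w k)) + frob A = frob (Sw - A).
Proof.
move=> I0 Sw.
have -> : avg (fun k => avg (fun l => dot (w k) (w l) ^+ 2)) =
    \sum_i \sum_j Sw i j ^+ 2.
  have e k l : dot (w k) (w l) ^+ 2 =
      \sum_i \sum_j (w k i 0 * w k j 0) * (w l i 0 * w l j 0).
    rewrite expr2 /dot mulr_suml; apply: eq_bigr => i _; rewrite mulr_sumr.
    by apply: eq_bigr => j _; ring.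
  under eq_avg do under eq_avg do rewrite e.
  under eq_avg do rewrite avg_sum.
  rewrite avg_sum; apply: eq_bigr => i _.
  under eq_avg do rewrite avg_sum.
  rewrite avg_sum; apply: eq_bigr => j _.
  under eq_avg do rewrite avgZ.
  by rewrite avgZr mxE expr2.
have -> : avg (fun k => dot (w k) (A *m w k)) = \sum_i \sum_j A i j * Sw i j.
  under eq_avg do rewrite dot_mulmx_frob.
  rewrite avg_sum; apply: eq_bigr => i _.
  rewrite avg_sum; apply: eq_bigr => j _.
  by rewrite avgZ mxE.
rewrite /frob mulr_sumr -sumrB -big_split/=; apply: eq_bigr => i _.
rewrite mulr_sumr -sumrB -big_split/=; apply: eq_bigr => j _.
have -> : (Sw - A) i j = Sw i j - A i j by rewrite mxE [(- A) i j]mxE.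
by move: (Sw i j) (A i j) => x y; ring.
Qed.

End frobenius.

(** * The corrected noise matrix, its inverse, and the covariance it asks for *)

Section near_identity.
Context (R : realType) (d : nat) (a : R) (S : 'M[R]_d).
Hypotheses (a0 : 0 <= a) (a40 : 40 * a <= 1) (Ssym : S^T = S)
  (Sge0 : forall x, 0 <= dot x (S *m x))
  (Sle : forall x, dot x (S *m x) <= 2 * a * dot x x)
  (SSle : forall x, dot (S *m x) (S *m x) <= 2 * a * dot x (S *m x)).

(** A first-order square root of [1 - S]: its square is [1 - S + S^2/4]. *)
Definition corr : 'M[R]_d := 1%:M - 2^-1 *: S.

Lemma corr_sym : corr^T = corr.
Proof. by rewrite /corr linearB linearZ /= Ssym trmx1. Qed.

Lemma corrE (x : 'cV[R]_d) : corr *m x = x - 2^-1 *: (S *m x).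
Proof. by rewrite /corr mulmxBl mul1mx scalemxAl. Qed.

Lemma dot_corr x : dot x (corr *m x) = dot x x - 2^-1 * dot x (S *m x).
Proof. by rewrite corrE dotDr dotNr dotZr. Qed.

Lemma dot_corr2 x : dot (corr *m x) (corr *m x) =
  dot x x - dot x (S *m x) + 4^-1 * dot (S *m x) (S *m x).
Proof.
by rewrite corrE !dotDl !dotDr !dotNl !dotNr !dotZl !dotZr (dotC (S *m x) x); field.
Qed.

Lemma corr_contract x : dot (corr *m x) (corr *m x) <= dot x x.
Proof.
rewrite dot_corr2; have := Sge0 x; have := SSle x => h1 h2.
have a4 : 2 * a <= 4 by move: a40; lra.
have := ler_wpM2r h2 a4 => h3.
lra.
Qed.

(** The square loses at most [S <= 2a <= 1/20]. The constant [10/11], smaller than [19/20], is the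
    one whose inverse is the round bound [11/10] of [icorr_bound]. *)
Lemma corr_expand x : 10 / 11 * dot x x <= dot (corr *m x) (corr *m x).
Proof.
rewrite dot_corr2; have := Sle x; have := dot_ge0 (S *m x); have := dot_ge0 x => h1 h2 h3.
have a4 : 2 * a <= 20^-1 by move: a40; lra.
have := ler_wpM2r h1 a4 => h4.
lra.
Qed.

Lemma corr_unit : corr \in unitmx.
Proof.
rewrite unitmxE unitfE; apply/negP => /det0P[v v0 vA].
have vT : corr *m v^T = 0 by rewrite -corr_sym -trmx_mul vA trmx0.
have := corr_expand v^T; rewrite vT dot0l => h.
have : dot v^T v^T = 0 by apply/eqP; rewrite eq_le dot_ge0 andbT; lra.
by move=> /dot_eq0/(congr1 trmx); rewrite trmxK trmx0 => /eqP; rewrite (negbTE v0).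
Qed.

Definition icorr : 'M[R]_d := invmx corr.

Lemma mul_corr_icorr : corr *m icorr = 1%:M.
Proof. exact: mulmxV corr_unit. Qed.

Lemma mul_icorr_corr : icorr *m corr = 1%:M.
Proof. exact: mulVmx corr_unit. Qed.

Lemma icorr_sym : icorr^T = icorr.
Proof. by rewrite /icorr trmx_inv corr_sym. Qed.

Lemma icorr_bound x : dot (icorr *m x) (icorr *m x) <= 11 / 10 * dot x x.
Proof.
have := corr_expand (icorr *m x); rewrite !mulmxA mul_corr_icorr mul1mx.
by move=> h; lra.
Qed.

(** The covariance that an independent shift [w] must have for [corr (e + w)] to have identity
    covariance: [corr (1 + X) corr = 1] is solved by [X = corr^-2 - 1]. *)
Definition excess : 'M[R]_d := icorr *m icorr - 1%:M.

Lemma excess_sym : excess^T = excess.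
Proof. by rewrite /excess linearB /= trmx_mul icorr_sym trmx1. Qed.

Lemma dot_excess x :
  dot x (excess *m x) = dot (icorr *m x) (icorr *m x) - dot x x.
Proof.
rewrite /excess mulmxBl mul1mx dotDr dotNr -mulmxA; congr (_ - _).
by rewrite dot_mulmx icorr_sym.
Qed.

(** [excess] is the conjugate by [icorr] of [1 - corr^2], and [1 - corr^2 = S - S^2/4]. With [X] the
    covariance of the batch error, this measures how far the correction misses its target. *)
Lemma excess_conj (X : 'M[R]_d) : icorr *m X *m icorr - excess =
  icorr *m (X - S + 4^-1 *: (S *m S)) *m icorr.
Proof.
have -> : X - S + 4^-1 *: (S *m S) = X - (1%:M - corr *m corr).
  rewrite /corr mulmxBl mulmxBr !mul1mx mulmxBr mulmx1 -scalemxAl -scalemxAr scalerA.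
  have -> : 2^-1 * 2^-1 = 4^-1 :> R by field.
  apply/matrixP => i j; rewrite !mxE.
  by move: (\sum_j0 _) (S i j) (X i j) (i == j)%:R => q s x o; field.
have c2 : icorr *m (corr *m corr) *m icorr = 1%:M.
  by rewrite mulmxA mul_icorr_corr mul1mx mul_corr_icorr.
move: c2; move: (corr *m corr) => C2 c2.
by rewrite !mulmxBr !mulmxBl mulmx1 c2.
Qed.

End near_identity.

(** * Chi-square bound for a mixture of Gaussian translates against a linear image of the Gaussian
    law *)

Lemma ereal_inv_bounds (R : realType) (g j : \bar R) : (0 <= j)%E ->
  (1 <= g)%E -> (g <= 2%:E)%E -> (g * j = 1)%E ->
  j = (fine j)%:E /\ 2^-1 <= fine j <= 1.
Proof.
case: g => [g|//|//] j0; rewrite !lee_fin => g1 g2.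
have g0 : 0 < g by lra.
case: j j0 => [j|_|//]; last by rewrite gt0_muley ?lte_fin.
rewrite lee_fin /= => j0; rewrite -EFinM => -[gj]; split=> //.
have -> : j = g^-1 by rewrite -[RHS]mulr1 -gj mulKf ?gt_eqF.
by apply/andP; split; rewrite -?[leRHS]invr1 lef_pV2 ?posrE.
Qed.

Section chi2_one_step.
Context (R : realType) (d : nat).
Local Notation V := 'cV[R]_d.
Variable mu : probability V R.
Hypothesis hmu : std_normal mu.

Lemma prob_int_cst (c : \bar R) : (\int[mu]_x c = c)%E.
Proof.
exact: etrans (integral_cst mu (@measurableT _ V) c)
  (etrans (congr1 (fun t => c * t)%E (probability_setT mu)) (mule1 c)).
Qed.

Lemma integral_avg (I : finType) (F : I -> V -> R) (c : I -> R) :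
  (forall k, measurable_fun setT (F k)) -> (forall k x, 0 <= F k x) ->
  (forall k, \int[mu]_x (F k x)%:E = (c k)%:E)%E ->
  (\int[mu]_x (avg (fun k => F k x))%:E = (avg c)%:E)%E.
Proof.
move=> mF F0 Fc; rewrite /avg.
have mFE k : measurable_fun setT (fun x => (F k x)%:E) by exact/measurable_EFinP.
under eq_integral do rewrite EFinM -sumEFin.
have I0 : (0 <= (#|I|%:R^-1)%:E :> \bar R)%E by rewrite lee_fin invr_ge0.
have mS : measurable_fun setT (fun x => \sum_k (F k x)%:E)%E by exact: emeasurable_sum.
have S0 x : (0 <= \sum_k (F k x)%:E)%E by apply: sume_ge0 => k _; rewrite lee_fin.
rewrite ge0_integralZl//.
rewrite ge0_integral_sum//; last by move=> k x _; rewrite lee_fin.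
by rewrite EFinM -sumEFin; congr (_ * _)%E; apply: eq_bigr => k _; rewrite Fc.
Qed.

Variables (a : R) (S : 'M[R]_d).
Hypotheses (a0 : 0 <= a) (a40 : 40 * a <= 1) (Ssym : S^T = S)
  (Sge0 : forall x, 0 <= dot x (S *m x))
  (Sle : forall x, dot x (S *m x) <= 2 * a * dot x x)
  (SSle : forall x, dot (S *m x) (S *m x) <= 2 * a * dot x (S *m x))
  (Sexp : (\int[mu]_x (expR (dot x (S *m x) / 2))%:E <= 2%:E)%E).

Local Notation A := (corr S).
Local Notation A' := (icorr S).
Local Notation T := (excess S).

Let AA' : A *m A' = 1%:M := mul_corr_icorr a40 Ssym Sle.
Let A'A : A' *m A = 1%:M := mul_icorr_corr a40 Ssym Sle.

Let mquadA : measurable_fun setT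
  (fun x : V => expR (dot x x / 2 - dot (A *m x) (A *m x) / 2)).
Proof. exact: measurable_quad. Qed.

(** The inverse of [|det A|]; it lies between 1 and 2, which places the constant [c] below between
    1/2 and 1. *)
Let G := (\int[mu]_x (expR (dot x x / 2 - dot (A *m x) (A *m x) / 2))%:E)%E.

Let mgauss : measurable_fun setT (fun x : V => (expR (- (dot x x / 2)))%:E).
Proof.
apply/measurable_EFinP; apply: measurableT_comp => //; apply: measurableT_comp => //.
by apply: measurable_funM => //; exact: measurable_dot.
Qed.

Let G_jac : (G * jacobian mu A' = 1)%E.
Proof.
have := change_of_variables hmu AA' A'A mgauss
  (fun x => (expR_ge0 _ : (0%R <= (expR (- (dot x x / 2)))%:E)%E)).
have -> : (\int[mu]_x ((expR (- (dot (A *m x) (A *m x) / 2)))%:E * (rho x)%:E) = G)%E.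
  by apply: eq_integral => x _; rewrite -EFinM /rho -expRD addrC.
move=> ->; rewrite -[RHS]prob_int_cst; apply: eq_integral => x _.
by rewrite -EFinM /rho -expRD addrC subrr expR0.
Qed.

Let G_ge1 : (1 <= G)%E.
Proof.
rewrite -[leLHS]prob_int_cst; apply: ge0_le_integral => //.
- exact/measurable_EFinP.
- move=> x _; rewrite lee_fin -expR0 ler_expR subr_ge0 ler_pM2r ?invr_gt0//.
  exact: (corr_contract a40 Sge0 SSle).
Qed.

Let G_le2 : (G <= 2%:E)%E.
Proof.
apply: le_trans Sexp; apply: ge0_le_integral => //.
- exact/measurable_EFinP.
- apply/measurable_EFinP; apply: measurableT_comp => //; apply: measurable_funM => //.
  by apply: measurable_dot => //; exact: measurable_mulmx_cst.
- move=> x _; rewrite lee_fin ler_expR dot_corr2.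
  by have := dot_ge0 (S *m x); lra.
Qed.

Let c : R := fine (jacobian mu A').

Let jacE : jacobian mu A' = c%:E /\ 2^-1 <= c <= 1.
Proof.
apply: (ereal_inv_bounds _ G_ge1 G_le2 G_jac).
by apply: integral_ge0 => y _; rewrite lee_fin expR_ge0.
Qed.

(** The density with respect to [mu] of the image of [mu] under [A^-1], as [tilt] states; [c] is
    [|det A|]. *)
Let q (x : V) : R := c * expR (dot x x / 2 - dot (A *m x) (A *m x) / 2).

Let c_ge : 2^-1 <= c. Proof. by have [_ /andP[]] := jacE. Qed.
Let c_gt0 : 0 < c. Proof. by move: c_ge; lra. Qed.

Let mq : measurable_fun setT q.
Proof. exact: measurable_funM. Qed.

(** The exponent is nonnegative because [A] is a contraction. This lower bound makes it possible to
    replace the weight [1/q] by 2. *)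
Let q_ge x : 2^-1 <= q x.
Proof.
apply: le_trans c_ge _; rewrite -[leLHS]mulr1; apply: ler_wpM2l; first exact: ltW.
rewrite -[leLHS]expR0 ler_expR subr_ge0 ler_pM2r ?invr_gt0//.
exact: (corr_contract a40 Sge0 SSle).
Qed.

Let q_gt0 x : 0 < q x. Proof. by have := q_ge x; lra. Qed.

Let tilt (f : V -> \bar R) : measurable_fun setT f -> (forall x, 0 <= f x)%E ->
  (\int[mu]_x (f (A *m x) * (q x)%:E) = \int[mu]_x f x)%E.
Proof.
move=> mf f0.
pose g x := (f x * (expR (- (dot x x / 2)))%:E)%E.
have mg : measurable_fun setT g by exact: emeasurable_funM.
have g0 x : (0 <= g x)%E by rewrite mule_ge0// lee_fin expR_ge0.
transitivity (\int[mu]_x (g x * (rho x)%:E))%E; last first.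
  apply: eq_integral => x _; rewrite /g -muleA -EFinM /rho -expRD addrC subrr.
  by rewrite expR0 mule1.
have [jE _] := jacE.
rewrite -(change_of_variables hmu AA' A'A mg g0) jE.
have mgr : measurable_fun setT (fun x : V => (g (A *m x) * (rho x)%:E)%E).
  apply: emeasurable_funM.
    by apply: measurableT_comp => //; exact: measurable_mulmx_cst.
  by apply/measurable_EFinP; exact: measurable_expR_dot.
have gr0 x : (0 <= g (A *m x) * (rho x)%:E)%E by rewrite mule_ge0// lee_fin expR_ge0.
have c0 : (0 <= c%:E)%E by rewrite lee_fin ltW.
rewrite -[RHS]ge0_integralZr//; apply: eq_integral => x _.
rewrite /g -!muleA -!EFinM /rho; congr (_ * _%:E)%E.
by rewrite /q mulrCA mulrA mulrC -expRD addrC.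
Qed.

Let int_q : (\int[mu]_x (q x)%:E = 1)%E.
Proof.
have := tilt (measurable_cst (1 : \bar R)%E) (fun=> @lee01 R).
by rewrite prob_int_cst => <-; apply: eq_integral => x _; rewrite mul1e.
Qed.

(** Removing one factor [q] by [tilt] leaves [c] times the integral of [exp(x.Tx/2)], and [c] itself
    is the integral of [exp(- y.Ty/2)]. The double integral is the one computed by
    [rotation_quad]. *)
Let int_qq : frob T < 1 ->
  (\int[mu]_x (q x * q x)%:E <= ((Num.sqrt (1 - frob T))^-1)%:E)%E.
Proof.
move=> T1.
apply: le_trans (std_normal_expR_frob hmu T1).
rewrite -(rotation_quad hmu (excess_sym Ssym)).
pose f (x : V) := (q (A' *m x))%:E.
have mf : measurable_fun setT f.
  apply/measurable_EFinP; apply: (measurableT_comp mq).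
  exact: measurable_mulmx_cst.
have f0 x : (0 <= f x)%E by rewrite lee_fin ltW.
have -> : (\int[mu]_x (q x * q x)%:E = \int[mu]_x f x)%E.
  apply: (etrans _ (tilt mf f0)); apply: eq_integral => x _.
  by rewrite /f mulmxA A'A mul1mx EFinM.
have quadE x : dot x (T *m x) / 2 = dot (A' *m x) (A' *m x) / 2 - dot x x / 2.
  by rewrite (dot_excess Ssym) mulrBl.
rewrite le_eqVlt; apply/orP; left; apply/eqP.
apply: eq_integral => x _.
have -> : f x = ((expR (dot x (T *m x) / 2))%:E * jacobian mu A')%E.
  have [-> _] := jacE; rewrite /f /q mulmxA AA' mul1mx -quadE EFinM muleC.
  by [].
rewrite /jacobian -[LHS]ge0_integralZl//.
  by apply: eq_integral => y _; rewrite -EFinM -expRD !quadE opprB.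
by apply/measurable_EFinP; exact: measurable_quad.
Qed.

Variables (I : finType) (w : I -> V).
Hypothesis I0 : (0 < #|I|)%N.

Let e k (x : V) : R := expR (dot (w k) x - dot (w k) (w k) / 2).

Let me k : measurable_fun setT (e k).
Proof.
apply: measurableT_comp => //; apply: measurable_funB => //.
by apply: measurable_dot => //; exact: measurable_cst.
Qed.

Let e_ge0 k x : 0 <= e k x. Proof. exact: expR_ge0. Qed.

(** The density of the mixture of the translates of [mu] by the vectors [w k]. *)
Let p (x : V) : R := avg (fun k => e k x).

Let mp : measurable_fun setT p.
Proof. by apply: measurable_funM => //; exact: measurable_sum. Qed.

Let p_ge0 x : 0 <= p x. Proof. exact: avg_ge0. Qed.

Let int_e (u : V) (s : R) : (\int[mu]_x (expR (dot u x - s))%:E = (expR (dot u u / 2 - s))%:E)%E.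
Proof.
have mu' : measurable_fun setT (fun x : V => (expR (dot u x))%:E).
  apply/measurable_EFinP; apply: measurableT_comp => //.
  by apply: measurable_dot => //; exact: measurable_cst.
have s0 : (0 <= (expR (- s))%:E)%E by rewrite lee_fin expR_ge0.
under eq_integral do rewrite expRD EFinM.
by rewrite ge0_integralZr// std_normal_mgf// -EFinM -expRD.
Qed.

Let int_p : (\int[mu]_x (p x)%:E = 1)%E.
Proof.
rewrite (integral_avg (c := fun=> 1) me e_ge0); last first.
  by move=> k; rewrite /e int_e subrr expR0.
by rewrite avg_const.
Qed.

Let int_pp : (\int[mu]_x (p x * p x)%:E =
  (avg (fun k => avg (fun l => expR (dot (w k) (w l)))))%:E)%E.
Proof.
under eq_integral => x _.
  have -> : p x * p x = avg (fun k => avg (fun l => e k x * e l x)).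
    by rewrite {1}/p -avgZr; apply: eq_avg => k; rewrite avgZ.
  over.
apply: (integral_avg (F := fun k x => avg (fun l => e k x * e l x))).
- move=> k; apply: measurable_funM => //; apply: measurable_sum => l.
  exact: measurable_funM.
- by move=> k x; apply: avg_ge0 => l; rewrite mulr_ge0.
move=> k; apply: (integral_avg (F := fun l x => e k x * e l x)).
- by move=> l; exact: measurable_funM.
- by move=> l x; rewrite mulr_ge0.
move=> l; rewrite /e.
under eq_integral => x _.
  rewrite -expRD.
  have -> : dot (w k) x - dot (w k) (w k) / 2 + (dot (w l) x - dot (w l) (w l) / 2) =
    dot (w k + w l) x - (dot (w k) (w k) / 2 + dot (w l) (w l) / 2).
    by rewrite dotDl; ring.
  over.
rewrite int_e; congr (expR _)%:E.
by rewrite !dotDl !dotDr (dotC (w l) (w k)); field.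
Qed.

(** Each [e k] is of the form [f (A x)] with [f] an exponential of a linear form, so [tilt] removes
    [q] and a moment generating function remains. *)
Let int_pq : (\int[mu]_x (p x * q x)%:E =
  (avg (fun k => expR (dot (w k) (T *m w k) / 2)))%:E)%E.
Proof.
under eq_integral => x _ do rewrite {1}/p -avgZr.
apply: (integral_avg (F := fun k x => e k x * q x)).
- by move=> k; exact: measurable_funM.
- by move=> k x; rewrite mulr_ge0// ltW.
move=> k.
pose f (x : V) := (expR (dot (A' *m w k) x - dot (w k) (w k) / 2))%:E.
have mf : measurable_fun setT f.
  apply/measurable_EFinP; apply: measurableT_comp => //; apply: measurable_funB => //.
  by apply: measurable_dot => //; exact: measurable_cst.
have f0 x : (0 <= f x)%E by rewrite lee_fin expR_ge0.
transitivity (\int[mu]_x (f (A *m x) * (q x)%:E))%E.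
  have fE x : f (A *m x) = (e k x)%:E.
    by rewrite /f dot_mulmx (icorr_sym Ssym) mulmxA A'A mul1mx.
  by apply: eq_integral => x _; rewrite fE EFinM.
rewrite tilt// int_e (dot_excess Ssym); congr (expR _)%:E.
by field.
Qed.

Let P2 := avg (fun k => avg (fun l => expR (dot (w k) (w l)))).
Let wT := avg (fun k => dot (w k) (T *m w k)).

Let V2 := 1 + 2 * (P2 + (Num.sqrt (1 - frob T))^-1 - 2 - wT).

Let qV x : (q x)^-1 = c^-1 * expR (- (dot x x / 2 - dot (A *m x) (A *m x) / 2)).
Proof. by rewrite /q invfM expRN. Qed.

Let mqV : measurable_fun setT (fun x => (q x)^-1).
Proof.
under eq_fun do rewrite qV; apply: measurable_funM => //.
apply: measurableT_comp => //; apply: measurableT_comp => //.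
apply: measurable_funB; apply: measurable_funM => //; apply: measurable_dot => //;
  exact: measurable_mulmx_cst.
Qed.

Let mppq : measurable_fun setT (fun x => p x * p x / q x).
Proof. by do 2?[apply: measurable_funM => //]. Qed.

(** Pointwise, [p^2/q = 2p - q + (p - q)^2/q], and [q >= 1/2] bounds the last term by [2 (p - q)^2].
    It remains to integrate, bounding the integral of [p q] from below through [exp(x) >= 1 + x]. *)
Let int_ppq : frob T < 1 -> (\int[mu]_x (p x * p x / q x)%:E <= V2%:E)%E.
Proof.
move=> T1.
have mE f : measurable_fun setT f -> measurable_fun setT (fun x : V => (f x)%:E).
  by move=> mf; exact/measurable_EFinP.
have mpp : measurable_fun setT (fun x => p x * p x) by exact: measurable_funM.
have mqq : measurable_fun setT (fun x => q x * q x) by exact: measurable_funM.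
have mpq : measurable_fun setT (fun x => p x * q x) by exact: measurable_funM.
have q0 x : 0 <= q x by exact: ltW.
have lin (f g : V -> R) : measurable_fun setT f -> measurable_fun setT g ->
    (forall x, 0 <= f x) -> (forall x, 0 <= g x) ->
    (\int[mu]_x (f x + g x)%:E = \int[mu]_x (f x)%:E + \int[mu]_x (g x)%:E)%E.
  move=> mf mg f0 g0; under eq_integral do rewrite EFinD.
  rewrite ge0_integralD//; try exact: mE; by move=> x _; rewrite lee_fin.
have scal (k : R) (f : V -> R) : 0 <= k -> measurable_fun setT f -> (forall x, 0 <= f x) ->
    (\int[mu]_x (k * f x)%:E = k%:E * \int[mu]_x (f x)%:E)%E.
  move=> k0 mf f0; under eq_integral do rewrite EFinM.
  have mfE : measurable_fun setT (fun x : V => (f x)%:E) by exact: mE.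
  have k0E : (0 <= k%:E)%E by rewrite lee_fin.
  by rewrite ge0_integralZl// => x _; rewrite lee_fin.
(* The inequality is arranged so that both sides are sums of nonnegative terms, which can be
   integrated termwise before finiteness is known. *)
pose lhs x := p x * p x / q x + (q x + 4 * (p x * q x)).
pose rhs x := 2 * p x + (2 * (p x * p x) + 2 * (q x * q x)).
have lr x : lhs x <= rhs x.
  rewrite /lhs /rhs -subr_ge0.
  have qx := q_gt0 x; have qn0 : q x != 0 by rewrite gt_eqF.
  have -> : 2 * p x + (2 * (p x * p x) + 2 * (q x * q x)) -
    (p x * p x / q x + (q x + 4 * (p x * q x))) =
    (p x - q x) ^+ 2 * (2 * (q x - 2^-1) / q x).
    by move: qn0; move: (p x) (q x) => P Q Qn0; field.
  rewrite mulr_ge0 ?sqr_ge0// divr_ge0// mulr_ge0// subr_ge0.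
  exact: q_ge.
have mlhs : measurable_fun setT lhs.
  apply: measurable_funD => //; apply: measurable_funD => //.
  exact: measurable_funM.
have mrhs : measurable_fun setT rhs.
  by apply: measurable_funD; [|apply: measurable_funD]; exact: measurable_funM.
have ppq0 x : 0 <= p x * p x / q x by apply: divr_ge0 => //; exact: mulr_ge0.
have pq0 x : 0 <= p x * q x by rewrite mulr_ge0.
have lhs0 x : 0 <= lhs x by apply: addr_ge0 => //; apply: addr_ge0 => //; exact: mulr_ge0.
have int_le : (\int[mu]_x (lhs x)%:E <= \int[mu]_x (rhs x)%:E)%E.
  apply: ge0_le_integral; first exact: measurableT.
  - by move=> x _; rewrite lee_fin.
  - exact: mE.
  - exact: mE.
  - by move=> x _; rewrite lee_fin.
have pp0 x : 0 <= p x * p x by rewrite mulr_ge0.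
have qq0 x : 0 <= q x * q x by rewrite mulr_ge0.
have m4 (k : R) f : measurable_fun setT f -> measurable_fun setT (fun x : V => k * f x).
  by move=> mf; exact: measurable_funM.
have n4 (k : R) (f : V -> R) : 0 <= k -> (forall x, 0 <= f x) -> forall x, 0 <= k * f x.
  by move=> k0 f0 x; rewrite mulr_ge0.
have k2 : 0 <= 2 :> R by []. have k4 : 0 <= 4 :> R by [].
move: int_le; rewrite /lhs /rhs.
rewrite (lin (fun x => p x * p x / q x) (fun x => q x + 4 * (p x * q x)))//; last 2 first.
- by apply: measurable_funD => //; exact: m4.
- by move=> x; rewrite addr_ge0// mulr_ge0.
rewrite (lin q (fun x => 4 * (p x * q x)))//; [|exact: m4|exact: n4].
rewrite (scal 4 (fun x => p x * q x))// int_q int_pq.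
rewrite (lin (fun x => 2 * p x) (fun x => 2 * (p x * p x) + 2 * (q x * q x)))//; last 4 first.
- exact: m4.
- by apply: measurable_funD => //; exact: m4.
- exact: n4.
- by move=> x; rewrite addr_ge0// mulr_ge0.
rewrite (lin (fun x => 2 * (p x * p x)) (fun x => 2 * (q x * q x)))//; last 4 first.
- exact: m4.
- exact: m4.
- exact: n4.
- exact: n4.
rewrite !(scal 2)// int_p int_pp.
have := int_qq T1.
have : (0 <= \int[mu]_x (p x * p x / q x)%:E)%E.
  by apply: integral_ge0 => x _; rewrite lee_fin.
have : (0 <= \int[mu]_x (q x * q x)%:E)%E.
  by apply: integral_ge0 => x _; rewrite lee_fin.
move: (\int[mu]_x (p x * p x / q x)%:E)%E (\int[mu]_x (q x * q x)%:E)%E => Z Q2.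
have PQ : 1 + wT / 2 <= avg (fun k => expR (dot (w k) (T *m w k) / 2)).
  rewrite -[X in X + _](avg_const 1 I0) /wT -avgZr -avgD; apply: ler_avg => k.
  exact: expR_ge1Dx.
case: Q2 => [Q2|//|//]; case: Z => [Z|//|//]; rewrite !lee_fin -/P2 /V2.
move: PQ; move: (avg _) => PQ hPQ _ _; lra.
Qed.

(** The optimal [t] is [y/X]. For [X = 0] a large [t] forces [y = 0]. This yields Cauchy-Schwarz for
    integrals out of a pointwise inequality. *)
Lemma amgm_sqr (y X Z : R) : 0 <= X -> 0 <= Z ->
  (forall t, 0 < t -> y <= t / 2 * X + t^-1 / 2 * Z) -> 0 <= y -> y ^+ 2 <= Z * X.
Proof.
move=> X0 Z0 h y0; have [->|yn0] := eqVneq y 0; first by rewrite expr0n mulr_ge0.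
have yp : 0 < y by rewrite lt_neqAle eq_sym yn0.
have [X00|Xn0] := eqVneq X 0.
  have := h ((Z + 1) / y); rewrite X00 mulr0 add0r invf_div => /(_ _).
  move=> /(_ (divr_gt0 (ltr_wpDl Z0 ltr01) yp)) hh.
  have : y / (Z + 1) / 2 * Z < y; last by rewrite ltNge hh.
  rewrite (_ : _ * Z = y * (Z / (Z + 1) / 2)); last by ring.
  rewrite -[ltRHS]mulr1 ltr_pM2l// ltr_pdivrMr// ltr_pdivrMr; lra.
have Xp : 0 < X by rewrite lt_neqAle eq_sym Xn0.
have := h (y / X) (divr_gt0 yp Xp); rewrite invf_div => hh.
have e1 : y / X / 2 * X = y / 2 by field.
rewrite e1 in hh.
have {}hh : y / 2 <= X / y / 2 * Z by lra.
move: hh; rewrite -(ler_pM2l yp).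
rewrite (_ : y * (y / 2) = y ^+ 2 / 2); last by ring.
rewrite (_ : y * (X / y / 2 * Z) = Z * X / 2); last by field.
by rewrite ler_pM2r.
Qed.

(** Write [h(Ax) p] as [h(Ax) sqrt(q)] times [p / sqrt(q)] and apply Cauchy-Schwarz: the first
    factor contributes the integral of [h^2] by [tilt], the second the integral of [p^2/q]. *)
Lemma chi2_step (h : V -> R) (b : R) : frob T < 1 ->
  measurable_fun setT h -> (forall x, 0 <= h x <= b) ->
  avg (fun k => fine (\int[mu]_x (h (A *m (x + w k)))%:E)) ^+ 2 <=
  (1 + 2 * (avg (fun k => avg (fun l => expR (dot (w k) (w l)))) +
     (Num.sqrt (1 - frob T))^-1 - 2 - avg (fun k => dot (w k) (T *m w k)))) *
  fine (\int[mu]_x (h x ^+ 2)%:E).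
Proof.
rewrite -/P2 -/wT -/V2 => T1 mh hb.
have h0 x : 0 <= h x by have /andP[] := hb x.
have b0 : 0 <= b by have /andP[h1 h2] := hb 0; exact: le_trans h1 h2.
have finE (f : V -> R) : measurable_fun setT f -> (forall x, 0 <= f x) ->
    (exists M, forall x, f x <= M) -> (\int[mu]_x (f x)%:E)%E \is a fin_num.
  move=> mf f0 [M fM]; rewrite ge0_fin_numE; last first.
    by apply: integral_ge0 => x _; rewrite lee_fin.
  apply: (@le_lt_trans _ _ (\int[mu]_x M%:E)%E); last by rewrite prob_int_cst ltry.
  apply: ge0_le_integral; first exact: measurableT.
  - by move=> x _; rewrite lee_fin.
  - exact/measurable_EFinP.
  - exact: measurable_cst.
  - by move=> x _; rewrite lee_fin.
have mhA : measurable_fun setT (fun x => h (A *m x)).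
  by apply: (measurableT_comp mh); exact: measurable_mulmx_cst.
have hpE : (\int[mu]_x (h (A *m x) * p x)%:E =
    (avg (fun k => fine (\int[mu]_x (h (A *m (x + w k)))%:E)))%:E)%E.
  under eq_integral => x _ do rewrite mulrC {1}/p -avgZr.
  apply: (integral_avg (F := fun k x => e k x * h (A *m x))).
  - by move=> k; exact: measurable_funM.
  - by move=> k x; rewrite mulr_ge0.
  move=> k; rewrite fineK; last first.
    apply: finE.
    - by apply: (measurableT_comp mhA); apply: measurable_mxD => //; exact: measurable_cst.
    - by move=> x.
    - by exists b => x; have /andP[] := hb (A *m (x + w k)).
  have mhAE : measurable_fun setT (fun x => (h (A *m x))%:E) by exact/measurable_EFinP.
  have hAE0 x : (0 <= (h (A *m x))%:E)%E by rewrite lee_fin.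
  rewrite (std_normal_shift (w k) hmu mhAE hAE0).
  by apply: eq_integral => x _; rewrite mulrC EFinM.
have hhE : (\int[mu]_x (h (A *m x) ^+ 2 * q x)%:E = \int[mu]_x (h x ^+ 2)%:E)%E.
  have mh2 : measurable_fun setT (fun x => (h x ^+ 2)%:E).
    by apply/measurable_EFinP; exact: measurable_funX.
  rewrite -(tilt mh2); last by move=> x; rewrite lee_fin sqr_ge0.
  by apply: eq_integral => x _; rewrite EFinM.
have X2fin : (\int[mu]_x (h x ^+ 2)%:E)%E \is a fin_num.
  apply: finE; [exact: measurable_funX|by move=> x; rewrite sqr_ge0|].
  exists (b ^+ 2) => x; have /andP[h1 h2] := hb x.
  by rewrite ler_pXn2r ?nnegrE.
set X2 := fine _; have X2E : (\int[mu]_x (h x ^+ 2)%:E = X2%:E)%E by rewrite fineK.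
have X20 : 0 <= X2.
  by rewrite -lee_fin -X2E; apply: integral_ge0 => x _; rewrite lee_fin sqr_ge0.
have := int_ppq T1.
have : (0 <= \int[mu]_x (p x * p x / q x)%:E)%E.
  by apply: integral_ge0 => x _; rewrite lee_fin; apply: divr_ge0; [exact: mulr_ge0|exact: ltW].
case ZE : (\int[mu]_x (p x * p x / q x)%:E)%E => [Z|//|//]; rewrite !lee_fin => Z0 ZV.
apply: (@le_trans _ _ (Z * X2)); last by rewrite ler_wpM2r.
apply: amgm_sqr => //; last first.
  by apply: avg_ge0 => k; apply: fine_ge0; apply: integral_ge0 => x _; rewrite lee_fin.
move=> t t0; rewrite -lee_fin -hpE EFinD !EFinM -X2E -ZE -hhE.
have t2 : (0 <= (t / 2)%:E)%E by rewrite lee_fin divr_ge0// ltW.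
have t3 : (0 <= (t^-1 / 2)%:E)%E by rewrite lee_fin divr_ge0// invr_ge0 ltW.
have mf1 : measurable_fun setT (fun x => (h (A *m x) ^+ 2 * q x)%:E).
  by apply/measurable_EFinP; apply: measurable_funM => //; exact: measurable_funX.
have mf2 : measurable_fun setT (fun x => (p x * p x / q x)%:E) by exact/measurable_EFinP.
have f10 x : (0 <= (h (A *m x) ^+ 2 * q x)%:E)%E by rewrite lee_fin mulr_ge0 ?sqr_ge0// ltW.
have f20 x : (0 <= (p x * p x / q x)%:E)%E.
  by rewrite lee_fin; apply: divr_ge0; [exact: mulr_ge0|exact: ltW].
rewrite -!ge0_integralZl// -ge0_integralD//; last 4 first.
- by move=> x _; rewrite mule_ge0.
- by apply: emeasurable_funM => //; exact: measurable_cst.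
- by move=> x _; rewrite mule_ge0.
- by apply: emeasurable_funM => //; exact: measurable_cst.
apply: ge0_le_integral; first exact: measurableT.
- by move=> x _; rewrite lee_fin mulr_ge0.
- by apply/measurable_EFinP; exact: measurable_funM.
- by apply: emeasurable_funD; apply: emeasurable_funM => //; exact: measurable_cst.
move=> x _; rewrite -!EFinM -EFinD lee_fin -subr_ge0.
have qx := q_gt0 x; have qn0 : q x != 0 by rewrite gt_eqF.
have tn0 : t != 0 by rewrite gt_eqF.
have -> : t / 2 * (h (A *m x) ^+ 2 * q x) + t^-1 / 2 * (p x * p x / q x) - h (A *m x) * p x =
  (t * h (A *m x) * q x - p x) ^+ 2 / (2 * t * q x).
  by move: qn0; move: (h (A *m x)) (p x) (q x) => H P Q Qn0; field; rewrite tn0 Qn0.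
by rewrite divr_ge0 ?sqr_ge0// !mulr_ge0// ltW.
Qed.

End chi2_one_step.

(** * The batch error and its estimated covariance *)

Section batch_noise.
Context (R : realType) (d n B B' : nat).
Local Notation V := 'cV[R]_d.
Variables (f : 'I_n -> V) (kap M : R).

Definition batch_mean : V := n%:R^-1 *: \sum_j f j.
(** In the application [kap] is [sqrt(eta) / sigma], so that deviations are measured in units of the
    injected noise. *)
Definition batch_dev (j : 'I_n) : V := (kap / B%:R) *: (f j - batch_mean).
Definition batch_fluct (I : {ffun 'I_B -> 'I_n}) : V := \sum_j batch_dev (I j).
Definition pair_dev (p : 'I_n * 'I_n) : V := (kap / Num.sqrt (2 * B%:R)) *: (f p.1 - f p.2).
Definition batch_Sigma (J : {ffun 'I_B' -> 'I_n * 'I_n}) : 'M[R]_d :=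
  B'%:R^-1 *: \sum_l pair_dev (J l) *m (pair_dev (J l))^T.

Hypotheses (n0 : (0 < n)%N) (B0 : (0 < B)%N) (B'0 : (0 < B')%N) 
  (fM : forall j, dot (f j) (f j) <= M ^+ 2).

(** The small parameter of all the estimates: each draw adds a vector of squared length at most
    [4a/B] to the batch error, and [S <= 2a]. *)
Let a : R := kap ^+ 2 * M ^+ 2 / B%:R.
Hypothesis a40 : 40 * a <= 1.

Let a0 : 0 <= a. Proof. by rewrite divr_ge0// mulr_ge0// sqr_ge0. Qed.

Let cardn : (0 < #|'I_n|)%N. Proof. by rewrite card_ord. Qed.
Let cardnn : (0 < #|{: 'I_n * 'I_n}|)%N. Proof. by rewrite card_prod card_ord muln_gt0 n0. Qed.
Let cardI : (0 < #|{ffun 'I_B -> 'I_n}|)%N. Proof. exact: card_ffun_gt0. Qed.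
Let Bp : 0 < B%:R :> R. Proof. by rewrite ltr0n. Qed.
Let B'p : 0 < B'%:R :> R. Proof. by rewrite ltr0n. Qed.

Let dot_mean s : dot s batch_mean = avg (fun j => dot s (f j)).
Proof.
rewrite dotZr /avg card_ord; congr (_ * _).
by rewrite dotC dot_suml; apply: eq_bigr => j _; rewrite dotC.
Qed.

Let mean_le : dot batch_mean batch_mean <= M ^+ 2.
Proof.
have h j : dot batch_mean (f j) <= (dot batch_mean batch_mean + M ^+ 2) / 2.
  have := dot_AMGM batch_mean (f j); have := fM j.
  have := ler_norm (dot batch_mean (f j)); lra.
have := ler_avg h; rewrite -dot_mean avg_const//; lra.
Qed.

Let dist_le (u v : V) : dot u u <= M ^+ 2 -> dot v v <= M ^+ 2 -> dot (u - v) (u - v) <= 4 * M ^+ 2.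
Proof.
move=> hu hv; have := dot_AMGM u v; have := ler_norm (- dot u v); rewrite normrN.
rewrite !dotDl !dotDr !dotNl !dotNr opprK (dotC v u); lra.
Qed.

Lemma avg_batch_dev s : avg (fun j => dot s (batch_dev j)) = 0.
Proof.
under eq_avg => j do rewrite dotZr dotDr dotNr.
by rewrite avgZ avgB avg_const// dot_mean subrr mulr0.
Qed.

Lemma batch_dev_le j : dot (batch_dev j) (batch_dev j) <= 4 * a / B%:R.
Proof.
rewrite dotZl dotZr mulrA.
have -> : 4 * a / B%:R = kap / B%:R * (kap / B%:R) * (4 * M ^+ 2).
  by rewrite /a; field; rewrite gt_eqF.
by apply: ler_wpM2l; [rewrite -expr2 sqr_ge0|exact: dist_le].
Qed.

Let sqrt2B : (kap / Num.sqrt (2 * B%:R)) * (kap / Num.sqrt (2 * B%:R)) = kap ^+ 2 / (2 * B%:R).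
Proof. by rewrite -expr2 expr_div_n sqr_sqrtr// mulr_ge0// ltW. Qed.

Lemma pair_dev_le p : dot (pair_dev p) (pair_dev p) <= 2 * a.
Proof.
rewrite dotZl dotZr mulrA sqrt2B.
have -> : 2 * a = kap ^+ 2 / (2 * B%:R) * (4 * M ^+ 2).
  by rewrite /a; field; rewrite gt_eqF.
by apply: ler_wpM2l; [rewrite divr_ge0 ?sqr_ge0// mulr_ge0// ltW|exact: dist_le].
Qed.

(** [batch_Sigma] is unbiased: the batch error is a sum of [B] independent centred terms, and half
    the mean square of a difference of two independent copies is a variance. The scalings of
    [batch_dev] and [pair_dev] are matched accordingly. *)
Lemma avg_batch_fluct i j :
  avg (fun I => batch_fluct I i 0 * batch_fluct I j 0) =
  avg (fun p => pair_dev p i 0 * pair_dev p j 0).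
Proof.
have mean0 k : avg (fun j => batch_dev j k 0) = 0.
  rewrite -[RHS](avg_batch_dev (delta_mx k 0)); apply: eq_avg => l.
  by rewrite dot_delta.
under eq_avg do rewrite /batch_fluct !summxE.
rewrite (avg_iid_prod B cardn (mean0 i) (mean0 j)).
have meanE k : batch_mean k 0 = avg (fun l => f l k 0).
  rewrite -dot_delta dot_mean; apply: eq_avg => l; exact: dot_delta.
have devE x k : batch_dev x k 0 = kap / B%:R * (f x k 0 - batch_mean k 0).
  by rewrite /batch_dev; move: batch_mean => m; rewrite !mxE.
have -> : avg (fun x => batch_dev x i 0 * batch_dev x j 0) =
    (kap / B%:R) ^+ 2 * (avg (fun x => f x i 0 * f x j 0) - batch_mean i 0 * batch_mean j 0).
  have e x : batch_dev x i 0 * batch_dev x j 0 = (kap / B%:R) ^+ 2 *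
      (f x i 0 * f x j 0 - batch_mean j 0 * f x i 0 - batch_mean i 0 * f x j 0 +
       batch_mean i 0 * batch_mean j 0) by rewrite !devE; ring.
  under eq_avg do rewrite e.
  rewrite avgZ avgD !avgB !avgZ avg_const// -!meanE; congr (_ * _).
  by ring.
rewrite avg_pair.
have -> : avg (fun x => avg (fun y => pair_dev (x, y) i 0 * pair_dev (x, y) j 0)) =
    kap ^+ 2 / (2 * B%:R) *
    (2 * avg (fun x => f x i 0 * f x j 0) - 2 * (batch_mean i 0 * batch_mean j 0)).
  have e x y : pair_dev (x, y) i 0 * pair_dev (x, y) j 0 = kap ^+ 2 / (2 * B%:R) *
      (f x i 0 * f x j 0 - f x i 0 * f y j 0 - f x j 0 * f y i 0 + f y i 0 * f y j 0).
    by rewrite -sqrt2B /pair_dev !mxE /=; ring.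
  under eq_avg do under eq_avg do rewrite e.
  under eq_avg do rewrite avgZ avgD !avgB !avgZ avg_const// -!meanE.
  rewrite avgZ avgD !avgB !avgZr avg_const// -!meanE; congr (_ * _).
  by rewrite /avg; ring.
by field; rewrite gt_eqF.
Qed.

Section Sigma.
Variable J : {ffun 'I_B' -> 'I_n * 'I_n}.
Local Notation S := (batch_Sigma J).
Local Notation u := (fun l => pair_dev (J l)).

Lemma batch_Sigma_sym : S^T = S.
Proof.
rewrite /batch_Sigma linearZ /=; congr (_ *: _).
rewrite raddf_sum; apply: eq_bigr => l _ /=.
by rewrite trmx_mul trmxK.
Qed.

Lemma dot_batch_Sigma (x y : V) : dot y (S *m x) = B'%:R^-1 * \sum_l dot (u l) x * dot (u l) y.
Proof.
rewrite /batch_Sigma -scalemxAl dotZr mulmx_suml dotC dot_suml; congr (_ * _).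
by apply: eq_bigr => l _; rewrite mulmx_outer dotZl.
Qed.

Lemma batch_Sigma_ge0 (x : V) : 0 <= dot x (S *m x).
Proof.
rewrite dot_batch_Sigma mulr_ge0 ?invr_ge0// sumr_ge0// => l _.
by rewrite -expr2 sqr_ge0.
Qed.

Lemma batch_Sigma_le (x : V) : dot x (S *m x) <= 2 * a * dot x x.
Proof.
rewrite dot_batch_Sigma mulrC ler_pdivrMr// mulrC.
have -> : B'%:R * (2 * a * dot x x) = \sum_(l < B') 2 * a * dot x x.
  by rewrite sumr_const card_ord -[RHS]mulr_natl.
apply: ler_sum => l _; rewrite -expr2; apply: le_trans (dot_CauchySchwarz _ _) _.
by rewrite ler_wpM2r ?dot_ge0// pair_dev_le.
Qed.

(** The mean of the squares [(2a (u.x) - u.y)^2] with [y = S x] is [4a^2 (x.y) - 4a |y|^2 + y.Sy],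
    which is nonnegative. Bounding [y.Sy] by [2a |y|^2] and dividing by [2a] gives the claim; the
    case [a = 0] is separate. *)
Lemma batch_Sigma_sqr_le (x : V) : dot (S *m x) (S *m x) <= 2 * a * dot x (S *m x).
Proof.
set y := S *m x.
have h : 0 <= 4 * a ^+ 2 * dot x y - 4 * a * dot y y + dot y (S *m y).
  rewrite [dot y y]dot_batch_Sigma /y [dot x _]dot_batch_Sigma dot_batch_Sigma -/y.
  have -> : 4 * a ^+ 2 * (B'%:R^-1 * \sum_l dot (u l) x * dot (u l) x)
      - 4 * a * (B'%:R^-1 * \sum_l dot (u l) x * dot (u l) y)
      + B'%:R^-1 * \sum_l dot (u l) y * dot (u l) y =
      B'%:R^-1 * \sum_l (2 * a * dot (u l) x - dot (u l) y) ^+ 2.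
    rewrite !mulrA !mulr_sumr -sumrB -big_split/=; apply: eq_bigr => l _.
    by ring.
  by rewrite mulr_ge0 ?invr_ge0// sumr_ge0// => l _; rewrite sqr_ge0.
have := batch_Sigma_le y => hy.
have [az|an] := eqVneq a 0.
  rewrite az mulr0 mul0r.
  have u0 l : u l = 0.
    by apply: dot_eq0; apply/eqP; rewrite eq_le dot_ge0 andbT; have := pair_dev_le (J l); rewrite az mulr0.
  by rewrite /y dot_batch_Sigma big1 ?mulr0// => l _; rewrite u0 dot0l mul0r.
have ap : 0 < a by rewrite lt_neqAle eq_sym an a0.
rewrite -(ler_pM2l ap); move: h hy; rewrite expr2; lra.
Qed.

(** [S] is a mean of rank-one matrices [u u^T], each of Frobenius norm [|u|^2 <= 2a], and the
    squared norm is convex. *)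
Lemma batch_Sigma_frob : frob S <= (2 * a) ^+ 2.
Proof.
have h p : frob (pair_dev p *m (pair_dev p)^T) <= (2 * a) ^+ 2.
  by rewrite frob_outer expr2 ler_pM ?dot_ge0 ?pair_dev_le.
rewrite /batch_Sigma frobZ exprVn mulrC ler_pdivrMr ?exprn_gt0//.
rewrite /frob.
apply: (@le_trans _ _ (\sum_i \sum_j B'%:R * \sum_l (pair_dev (J l) *m (pair_dev (J l))^T) i j ^+ 2)).
  apply: ler_sum => i _; apply: ler_sum => j _; rewrite summxE.
  have cB : (0 < #|'I_B'|)%N by rewrite card_ord.
  have := avg_sqr_le (fun l => (pair_dev (J l) *m (pair_dev (J l))^T) i j) cB.
  rewrite /avg card_ord exprMn exprVn mulrC ler_pdivrMr ?exprn_gt0// => hh.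
  apply: le_trans hh _; rewrite le_eqVlt; apply/orP; left; apply/eqP.
  by rewrite mulrAC expr2 mulKf ?gt_eqF.
rewrite (_ : \sum_i _ = B'%:R * \sum_l frob (pair_dev (J l) *m (pair_dev (J l))^T)); last first.
  under eq_bigr do rewrite -mulr_sumr exchange_big.
  by rewrite -mulr_sumr exchange_big.
rewrite expr2 mulrCA ler_pM2l// mulrC.
apply: le_trans (ler_sum _ (fun l _ => h (J l))) _.
by rewrite sumr_const card_ord -[leLHS]mulr_natl.
Qed.

(** The form [x.Sx] is a mean of squares [(u.x)^2] with [|u|^2 <= 2a], so the bound
    [(1 - 2a)^(-1/2)] of [std_normal_expR_avg] applies in every dimension. *)
Lemma batch_Sigma_exp (mu : probability V R) : std_normal mu ->
  (\int[mu]_x (expR (dot x (S *m x) / 2))%:E <= 2%:E)%E.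
Proof.
move=> hmu.
under eq_integral => x _.
  have -> : dot x (S *m x) = \sum_l B'%:R^-1 * dot (u l) x ^+ 2.
    by rewrite dot_batch_Sigma mulr_sumr; apply: eq_bigr => l _; rewrite expr2.
  over.
apply: le_trans (std_normal_expR_avg hmu (t := 2 * a) (p := fun=> B'%:R^-1) _ _ _ _) _.
- by move=> _; rewrite invr_ge0.
- by rewrite sumr_const card_ord -[LHS]mulr_natl mulfV// gt_eqF.
- by move: a40; lra.
- by move=> l; exact: pair_dev_le.
rewrite lee_fin; apply: le_trans (invsqrt_le _) _; first by apply/andP; split; move: a0 a40; lra.
have a2 : 0 <= 2 * a by rewrite mulr_ge0.
have a20 : 2 * a <= 20^-1 by move: a40; lra.
have : (2 * a) ^+ 2 <= 20^-1 * 20^-1 by rewrite expr2 ler_pM.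
by move: a20; lra.
Qed.

End Sigma.
End batch_noise.

(** * Chi-square bound for the noise of one particle update *)

Section batch_chi2.
Context (R : realType) (d n B B' : nat).
Local Notation V := 'cV[R]_d.
Variables (f : 'I_n -> V) (kap M : R).
Hypotheses (n0 : (0 < n)%N) (B0 : (0 < B)%N) (B'0 : (0 < B')%N) (fM : forall j, dot (f j) (f j) <= M ^+ 2).

Let a : R := kap ^+ 2 * M ^+ 2 / B%:R.
Hypothesis a40 : 40 * a <= 1.

Let a0 : 0 <= a. Proof. by rewrite divr_ge0// mulr_ge0// sqr_ge0. Qed.
Let cardn : (0 < #|'I_n|)%N. Proof. by rewrite card_ord. Qed.
Let cardnn : (0 < #|{: 'I_n * 'I_n}|)%N. Proof. by rewrite card_prod card_ord muln_gt0 n0. Qed.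
Let cardI : (0 < #|{ffun 'I_B -> 'I_n}|)%N. Proof. exact: card_ffun_gt0. Qed.
Let cardJ : (0 < #|{ffun 'I_B' -> 'I_n * 'I_n}|)%N. Proof. exact: card_ffun_gt0. Qed.
Let Bp : 0 < B%:R :> R. Proof. by rewrite ltr0n. Qed.

Local Notation U := (batch_fluct (B := B) f kap).
Local Notation S := (batch_Sigma (B' := B') B f kap).

Definition fluct_cov : 'M[R]_d := \matrix_(i, j) avg (fun I => U I i 0 * U I j 0).

(** Entrywise variance of the mean of [B'] independent unbiased estimates. The second moments of the
    entries of one estimate [u u^T] add up to [|u|^4 <= (2a)^2]. *)
Lemma avg_frob_cov : avg (fun J => frob (fluct_cov - S J)) <= (2 * a) ^+ 2 / B'%:R.
Proof.
pose u := pair_dev B f kap.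
have e J : frob (fluct_cov - S J) = \sum_i \sum_j
    (B'%:R^-1 * (\sum_l u (J l) i 0 * u (J l) j 0) -
     avg (fun p => u p i 0 * u p j 0)) ^+ 2.
  apply: eq_bigr => i _; apply: eq_bigr => j _.
  rewrite -[RHS]sqrrN opprB -avg_batch_fluct//; congr (_ ^+ 2).
  rewrite mxE [fluct_cov i j]mxE; congr (_ + _).
  rewrite [LHS]mxE [S J i j]mxE summxE; congr (- (_ * _)).
  by apply: eq_bigr => l _; rewrite outerE.
under eq_avg do rewrite e.
rewrite avg_sum.
apply: (@le_trans _ _ (\sum_i \sum_j B'%:R^-1 * avg (fun p => (u p i 0 * u p j 0) ^+ 2))).
  apply: ler_sum => i _; rewrite avg_sum; apply: ler_sum => j _.
  exact: (avg_iid_sqr (fun p => u p i 0 * u p j 0)).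
under eq_bigr do rewrite -mulr_sumr -avg_sum.
rewrite -mulr_sumr -avg_sum mulrC ler_wpM2r ?invr_ge0//.
rewrite -[leRHS](avg_const _ cardnn); apply: ler_avg => p.
rewrite (_ : \sum_i _ = dot (u p) (u p) * dot (u p) (u p)).
  by rewrite expr2 ler_pM ?dot_ge0// pair_dev_le.
rewrite {1}/dot mulr_suml; apply: eq_bigr => i _; rewrite mulr_sumr.
by apply: eq_bigr => j _; ring.
Qed.

Section fixed_J.
Variable J : {ffun 'I_B' -> 'I_n * 'I_n}.
Local Notation SJ := (S J).

Let Ssym := batch_Sigma_sym B f kap J.
Let Sge0 := batch_Sigma_ge0 B f kap J.
Let Sle := batch_Sigma_le kap B0 B'0 fM J.
Let SSle := batch_Sigma_sqr_le kap B0 B'0 fM J.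

(** Chosen so that [corr S] applied to [e + w] is the noise [U + corr S e]. *)
Definition white_fluct (I : {ffun 'I_B -> 'I_n}) : V := icorr SJ *m U I.
Local Notation w := white_fluct.

(** The left side is the squared Frobenius norm of the covariance of [w] minus [excess], by
    [frob_avg_square]. By [excess_conj] it is the norm of a conjugate of [Cov U - S + S^2/4], where
    [S^2/4] has squared norm at most [a^4]. *)
Lemma white_fluct_sqr : avg (fun I => avg (fun I' => dot (w I) (w I') ^+ 2)) -
    2 * avg (fun I => dot (w I) (excess SJ *m w I)) + frob (excess SJ) <=
  (11 / 10) ^+ 2 * (2 * frob (fluct_cov - SJ) + 2 * a ^+ 4).
Proof.
rewrite (frob_avg_square w (excess SJ) cardI).
have -> : \matrix_(i, j) avg (fun k => w k i 0 * w k j 0) =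
    icorr SJ *m fluct_cov *m icorr SJ.
  apply/matrixP => i j; rewrite mxE [in RHS]mxE.
  have e k : w k i 0 * w k j 0 =
      \sum_l \sum_m icorr SJ i m * (U k m 0 * U k l 0) * icorr SJ j l.
    rewrite /w !mxE mulrC mulr_suml; apply: eq_bigr => l _; rewrite mulr_sumr.
    by apply: eq_bigr => m _; ring.
  under eq_avg do rewrite e.
  rewrite avg_sum; apply: eq_bigr => l _.
  rewrite avg_sum mxE mulr_suml; apply: eq_bigr => m _.
  rewrite avgZr avgZ [fluct_cov _ _]mxE; congr (_ * _).
  by rewrite -[in RHS](icorr_sym Ssym) mxE.
rewrite (excess_conj a40 Ssym Sle).
apply: le_trans (frob_conj_le (K := 11 / 10) _ _ _ _) _ => //.
- exact: icorr_sym Ssym.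
- exact: (icorr_bound a40 Ssym Sle).
rewrite ler_wpM2l ?sqr_ge0//.
apply: le_trans (frobD_le _ _) _; rewrite lerD2l ler_wpM2l//.
rewrite frobZ.
have hS : frob SJ <= (2 * a) ^+ 2 by exact: batch_Sigma_frob.
have : frob (SJ *m SJ) <= (2 * a) ^+ 2 * (2 * a) ^+ 2.
  by apply: le_trans (frob_mulmx _ _) _; rewrite ler_pM ?frob_ge0.
rewrite (_ : (2 * a) ^+ 2 * (2 * a) ^+ 2 = 16 * a ^+ 4); last by ring.
move=> h; rewrite (_ : a ^+ 4 = 4^-1 ^+ 2 * (16 * a ^+ 4)); last by field.
by rewrite ler_wpM2l ?sqr_ge0.
Qed.

Lemma frob_excess_le : frob (excess SJ) <= 10 * a ^+ 2.
Proof.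
have := excess_conj a40 Ssym Sle 0; rewrite mulmx0 mul0mx !sub0r => e.
have -> : frob (excess SJ) = frob (- excess SJ) by rewrite -scaleN1r frobZ sqrrN expr1n mul1r.
rewrite e.
apply: le_trans (frob_conj_le (K := 11 / 10) _ _ _ _) _ => //.
- exact: icorr_sym Ssym.
- exact: (icorr_bound a40 Ssym Sle).
have h1 := frobD_le (- SJ) (4^-1 *: (SJ *m SJ)).
have hS : frob SJ <= (2 * a) ^+ 2 by exact: batch_Sigma_frob.
have h2 : frob (SJ *m SJ) <= (2 * a) ^+ 2 * (2 * a) ^+ 2.
  by apply: le_trans (frob_mulmx _ _) _; rewrite ler_pM ?frob_ge0.
have h3 : frob (- SJ) = frob SJ by rewrite -scaleN1r frobZ sqrrN expr1n mul1r.
rewrite frobZ h3 in h1.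
have h4 : a ^+ 4 <= 1600^-1 * a ^+ 2.
  have -> : a ^+ 4 = a ^+ 2 * a ^+ 2 by ring.
  rewrite ler_wpM2r ?sqr_ge0//.
  have a25 : a <= 40^-1 by move: a40; lra.
  by rewrite (_ : 1600^-1 = 40^-1 * 40^-1 :> R); [rewrite expr2 ler_pM|field].
move: h1 hS h2 h4 (sqr_ge0 a).
rewrite (_ : (2 * a) ^+ 2 * (2 * a) ^+ 2 = 16 * a ^+ 4); last by ring.
rewrite (_ : (2 * a) ^+ 2 = 4 * a ^+ 2); last by ring.
move: (frob _) (frob _) (frob _) (a ^+ 4) (a ^+ 2) => X Y Z a4 a2.
lra.
Qed.

(** A second-order Taylor expansion of the exponential: the linear term vanishes because [w] is
    centred, and the remainder is of order [a^3] times an exponential moment that factors over the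
    two independent batches. *)
Lemma white_fluct_mgf :
  avg (fun I => avg (fun I' => expR (dot (w I) (w I')))) <=
  1 + avg (fun I => avg (fun I' => dot (w I) (w I') ^+ 2)) / 2 + 4 * (500 * a) ^+ 3.
Proof.
have [az|an] := eqVneq a 0.
  have dev0 j : batch_dev B f kap j = 0.
    apply: dot_eq0; apply/eqP; rewrite eq_le dot_ge0 andbT.
    by have := batch_dev_le kap n0 B0 fM j; rewrite -/a az mulr0 mul0r.
  have w0 I : w I = 0 by rewrite /w /batch_fluct big1 ?mulmx0.
  under eq_avg do under eq_avg do rewrite w0 dot0l expR0.
  under [X in _ <= _ + X / 2 + _]eq_avg do under eq_avg do rewrite w0 dot0l expr0n.
  by rewrite az mulr0 expr0n mulr0 !avg_const// mul0r !addr0.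
have ap : 0 < a by rewrite lt_neqAle eq_sym an a0.
(* The factor [l^-3] of the Taylor remainder becomes [(500 a)^3]. The number 500 is large enough for
   [(1 + l) * 11/20 <= 1/(64 a)] to follow from [a <= 1/40], which is needed for [bound]. *)
pose l := (500 * a)^-1.
have l0 : 0 < l by rewrite /l invr_gt0; apply: mulr_gt0; [rewrite ltr0n|exact: ap].
have lV : l^-1 = 500 * a by rewrite /l invrK.
have k0 : 0 <= (500 * a) ^+ 3.
  by apply: exprn_ge0; apply: mulr_ge0; [rewrite ler0n|exact: a0].
have meanU s : avg (fun I => dot s (U I)) = 0.
  under eq_avg do rewrite dotC /batch_fluct dot_suml.
  apply: (@avg_iid_sum0 _ _ _ (fun j => dot (batch_dev B f kap j) s)) => //.
  by under eq_avg do rewrite dotC; exact: avg_batch_dev.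
have meanw s : avg (fun I => dot s (w I)) = 0.
  under eq_avg do rewrite /w dotC dot_mulmx dotC.
  under eq_avg do rewrite dotC.
  by under eq_avg do rewrite dotC; exact: meanU.
(* The rate [1/(64 a)] is that of [exp_moment] for [B] vectors of squared norm at most [4a/B]. *)
pose E I := expR ((64 * a)^-1 * dot (U I) (U I)).
have EE : avg E <= 2.
  have b0 : 0 < 4 * a / B%:R by rewrite divr_gt0// mulr_gt0.
  have := exp_moment cardn (avg_batch_dev B f kap n0) b0
    (batch_dev_le kap n0 B0 fM) B0.
  rewrite (_ : (16 * B%:R * (4 * a / B%:R))^-1 = (64 * a)^-1)//.
  by congr (_^-1); field; rewrite gt_eqF.
have bound I I' : expR ((1 + l) * `|dot (w I) (w I')|) <= E I * E I'.
  rewrite -expRD ler_expR.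
  have h1 := icorr_bound a40 Ssym Sle (U I).
  have h2 := icorr_bound a40 Ssym Sle (U I').
  have h3 := dot_AMGM (w I) (w I').
  rewrite -/(w I) -/(w I') in h1 h2.
  have la : (1 + l) * (11 / 20) <= (64 * a)^-1.
    have an0 : a != 0 by rewrite gt_eqF.
    rewrite -(ler_pM2r ap) /l.
    have -> : (1 + (500 * a)^-1) * (11 / 20) * a = (a + 500^-1) * (11 / 20) by field.
    have -> : (64 * a)^-1 * a = 64^-1 by field.
    by move: a40; lra.
  have s0 : 0 <= dot (U I) (U I) + dot (U I') (U I') by rewrite addr_ge0 ?dot_ge0.
  have := ler_wpM2r s0 la => h4.
  rewrite -mulrDr; apply: le_trans h4; rewrite -[leRHS]mulrA ler_wpM2l; first lra.
    by rewrite addr_ge0// ltW.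
  by move: h1 h2 h3; lra.
have le1 I I' : expR (dot (w I) (w I')) <=
    1 + dot (w I) (w I') + dot (w I) (w I') ^+ 2 / 2 + (500 * a) ^+ 3 * (E I * E I').
  apply: le_trans (expR_le_taylor2 _ l0) _; rewrite lV lerD2l.
  exact: (ler_wpM2l k0).
apply: (@le_trans _ _ (avg (fun I => avg (fun I' =>
  1 + dot (w I) (w I') + dot (w I) (w I') ^+ 2 / 2 + (500 * a) ^+ 3 * (E I * E I'))))).
  by apply: ler_avg => I; apply: ler_avg => I'; exact: le1.
under eq_avg do rewrite !avgD avg_const// meanw avgZr !avgZ addr0.
rewrite !avgD avg_const// avgZr avgZ avgZr lerD2l [leRHS]mulrC.
apply: (ler_wpM2l k0).
have E0 : 0 <= avg E by apply: avg_ge0 => I; exact: expR_ge0.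
by rewrite (_ : 4 = 2 * 2 :> R); [exact: ler_pM|ring].
Qed.

(** The first term is the factor 2 of [chi2_step] times the remainder [4 (500 a)^3] of
    [white_fluct_mgf]; the 10 absorbs the terms in [a^4], as [a <= 1/40]. *)
Definition chi2_const : R := 8 * 500 ^+ 3 + 10.

(** In the constant of [chi2_step] the second-order terms form half of the square in
    [white_fluct_sqr]. The coefficient 3 of the estimation error dominates [2 * (11/10)^2]. *)
Lemma chi2_step_batch (mu : probability V R) (h : V -> R) (b : R) : std_normal mu ->
  measurable_fun setT h -> (forall x, 0 <= h x <= b) ->
  avg (fun I => fine (\int[mu]_x (h (U I + corr SJ *m x))%:E)) ^+ 2 <=
  (1 + 3 * frob (fluct_cov - SJ) + chi2_const * a ^+ 3) * fine (\int[mu]_x (h x ^+ 2)%:E).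
Proof.
move=> hmu mh hb.
have T1 := frob_excess_le.
have a25 : a <= 40^-1 by move: a40; lra.
have a2 : a ^+ 2 <= 1600^-1.
  by rewrite (_ : 1600^-1 = 40^-1 * 40^-1 :> R); [rewrite expr2 ler_pM|field].
have T2 : frob (excess SJ) <= 2^-1 by move: a2 T1; lra.
have T3 : frob (excess SJ) < 1 by move: T2; lra.
have Sexp := batch_Sigma_exp B0 B'0 fM a40 J hmu.
have := chi2_step hmu a40 Ssym Sge0 Sle SSle Sexp w cardI T3 mh hb.
have e I : (\int[mu]_x (h (corr SJ *m (x + w I)))%:E =
    \int[mu]_x (h (U I + corr SJ *m x))%:E)%E.
  apply: eq_integral => x _.
  by rewrite mulmxDr /w mulmxA (mul_corr_icorr a40 Ssym Sle) mul1mx addrC.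
under eq_avg do rewrite e.
move=> /le_trans; apply; apply: ler_wpM2r.
  by apply: fine_ge0; apply: integral_ge0 => x _; rewrite lee_fin sqr_ge0.
have h1 := white_fluct_mgf; have h2 := white_fluct_sqr.
have h3 : (Num.sqrt (1 - frob (excess SJ)))^-1 <=
    1 + frob (excess SJ) / 2 + frob (excess SJ) ^+ 2.
  by apply: invsqrt_le; rewrite frob_ge0.
have h4 : frob (excess SJ) ^+ 2 <= 100 * a ^+ 4.
  rewrite (_ : 100 * a ^+ 4 = (10 * a ^+ 2) * (10 * a ^+ 2)); last by ring.
  by rewrite expr2 ler_pM ?frob_ge0.
have h5 : a ^+ 4 <= 40^-1 * a ^+ 3.
  by rewrite exprS ler_wpM2r// exprn_ge0.
have h6 : 0 <= a ^+ 3 by rewrite exprn_ge0.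
have h7 := frob_ge0 (fluct_cov - SJ).
have -> : chi2_const * a ^+ 3 = 8 * (500 * a) ^+ 3 + 10 * a ^+ 3.
  by rewrite /chi2_const mulrDl [(500 * a) ^+ 3]exprMn [in RHS](mulrA 8).
move: h1 h2 h3 h4 h5 h6 h7.
move: ((500 * a) ^+ 3) (a ^+ 4) (a ^+ 3) (frob (fluct_cov - SJ)) => k a4 a3 D.
lra.
Qed.

End fixed_J.

(** The square of a mean over the pairs is at most the mean of the squares, so the bound for fixed
    pairs can be averaged, and [avg_frob_cov] gives the order [a^2/B']. *)
Theorem batch_chi2 (mu : probability V R) (h : V -> R) (b : R) : std_normal mu ->
  measurable_fun setT h -> (forall x, 0 <= h x <= b) ->
  avg (fun J => avg (fun I => fine (\int[mu]_x (h (U I + corr (S J) *m x))%:E))) ^+ 2 <=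
  (1 + chi2_const * (a ^+ 2 / B'%:R + a ^+ 3)) * fine (\int[mu]_x (h x ^+ 2)%:E).
Proof.
move=> hmu mh hb.
apply: le_trans (avg_sqr_le _ cardJ) _.
apply: le_trans (ler_avg (fun J => chi2_step_batch J hmu mh hb)) _.
rewrite avgZr; apply: ler_wpM2r.
  by apply: fine_ge0; apply: integral_ge0 => x _; rewrite lee_fin sqr_ge0.
rewrite !avgD !avg_const// avgZ.
have := avg_frob_cov.
(* The factor 12 is 3 from [chi2_step_batch] times 4 from [avg_frob_cov]. *)
have c12 : 12 <= chi2_const.
  by rewrite /chi2_const; have : 1 <= 500 ^+ 3 :> R by [rewrite exprn_ege1// ler1n]; lra.
have a2 : 0 <= a ^+ 2 / B'%:R by rewrite divr_ge0// sqr_ge0.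
have := ler_wpM2r a2 c12.
rewrite (_ : (2 * a) ^+ 2 / B'%:R = 4 * (a ^+ 2 / B'%:R)); last by ring.
move: (a ^+ 2 / B'%:R) (a ^+ 3) chi2_const (avg _) => x y c X.
rewrite mulrDr; lra.
Qed.

End batch_chi2.

(** * Markov chains driven by independent noise and random indices *)

Section joint_law.
Context d d1 d2 (T : measurableType d) (S : measurableType d1) (E : measurableType d2)
  (R : realType) (P : probability T R).
Variables (W : {RV P >-> S}) (e : {RV P >-> E}) (mu : probability E R).

(** Restricted to the event [Q], the joint law of [W] and [e] agrees on rectangles with the product
    of the law of [W] and [c] times [mu], hence is that product; Tonelli does the rest. *)
Lemma ge0_integral_joint (Q : set T) (c : {nonneg R}) (f : S * E -> \bar R) :
  measurable Q ->
  (forall A B, measurable A -> measurable B ->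
    P (W @^-1` A `&` (e @^-1` B `&` Q)) = (P (W @^-1` A) * (mu B * c%:num%:E))%E) ->
  measurable_fun setT f -> (forall p, 0 <= f p)%E ->
  (\int[P]_w (f (W w, e w) * (\1_Q w)%:E) =
   c%:num%:E * \int[distribution P W]_s \int[mu]_v f (s, v))%E.
Proof.
move=> mQ indep mf f0.
have mWe : measurable_fun setT (fun w => (W w, e w)).
  by apply/measurable_fun_pairP; split; exact: measurable_funPT.
pose m2 : {finite_measure set E -> \bar R} := mscale c mu.
pose m' := pushm (mrestr P mQ) mWe.
have m'E A B : measurable A -> measurable B -> m' (A `*` B) = (distribution P W A * m2 B)%E.
  move=> mA mB.
  have -> : m' (A `*` B) = P (W @^-1` A `&` (e @^-1` B `&` Q)).
    by rewrite setIA.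
  by rewrite indep// [(mu B * _)%E]muleC.
transitivity (\int[m']_z f z)%E.
  rewrite ge0_integral_pushm// ge0_integral_mrestr//.
  exact: measurableT_comp.
transitivity (\int[distribution P W \x m2]_z f z)%E.
  apply: eq_measure_integral => A mA _; apply/esym.
  apply: (@product_measure_unique _ _ _ _ _ (distribution P W) m2 m') => //; exact: m'E.
rewrite fubini_tonelli1//.
transitivity (\int[distribution P W]_s (c%:num%:E * \int[mu]_v f (s, v)))%E.
  apply: eq_integral => s _; rewrite /fubini_F ge0_integral_mscale//.
  exact: measurableT_comp.
rewrite ge0_integralZl//.
  exact: measurable_fun_fubini_tonelli_F.
by move=> s _; apply: integral_ge0.
Qed.

End joint_law.

Section chain.
Context d d1 d2 (T : measurableType d) (S : measurableType d1) (E : measurableType d2)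
  (R : realType) (P : probability T R) (Th : finType).
Variables (W : nat -> {RV P >-> S}) (e : nat -> {RV P >-> E}) (mu : probability E R)
  (th : nat -> T -> Th) (Phi : nat -> Th -> S * E -> S).
(* [fut t] consists of events determined by the randomness used from step [t] on. *)
Variable fut : nat -> set (set T).
Hypotheses (mPhi : forall t i, measurable_fun setT (Phi t i))
  (WS : forall t w, W t.+1 w = Phi t (th t w) (W t w, e t w))
  (futm : forall t Q, fut t Q -> measurable Q)
  (futT : forall t, fut t setT)
  (W0 : forall A Q, measurable A -> fut 0%N Q ->
    P (W 0%N @^-1` A `&` Q) = (P (W 0%N @^-1` A) * P Q)%E)
  (futS : forall t Q i B, fut t.+1 Q -> measurable B ->
    fut t (e t @^-1` B `&` (th t @^-1` [set i] `&` Q)) /\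
    P (e t @^-1` B `&` (th t @^-1` [set i] `&` Q)) = (mu B * ((#|Th|%:R^-1)%:E * P Q))%E).

(** Split according to the value of the index [th t]: on each piece the new state is a fixed
    function of the old state and the noise, independent of each other and of the later event
    [Q]. *)
Let step_integral t Q (f : S -> \bar R) : fut t.+1 Q ->
  (forall A Q', measurable A -> fut t Q' ->
    P (W t @^-1` A `&` Q') = (P (W t @^-1` A) * P Q')%E) ->
  measurable_fun setT f -> (forall x, 0 <= f x)%E ->
  (\int[P]_w (f (W t.+1 w) * (\1_Q w)%:E) =
   (#|Th|%:R^-1 * fine (P Q))%:E *
     \sum_i \int[distribution P (W t)]_s \int[mu]_v f (Phi t i (s, v)))%E.
Proof.
move=> hQ indep mf f0.
have c0 : 0 <= #|Th|%:R^-1 * fine (P Q) :> R.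
  by rewrite mulr_ge0 ?invr_ge0 ?ler0n ?fine_ge0.
have mQi i : measurable (th t @^-1` [set i] `&` Q).
  have [/futm + _] := futS i hQ measurableT.
  by rewrite preimage_setT setTI.
have mfP i : measurable_fun setT (f \o Phi t i) by exact: measurableT_comp.
rewrite (_ : (fun w => _) = (fun w => \sum_i
    ((f \o Phi t i) (W t w, e t w) * (\1_(th t @^-1` [set i] `&` Q) w)%:E))%E); last first.
  apply/funext => w; rewrite (bigD1 (th t w))//= big1 ?adde0.
    rewrite WS !indicE; congr (_ * (_ : bool)%:R%:E)%E.
    by apply/idP/idP; rewrite !inE => /=; tauto.
  move=> i /eqP hi; rewrite indicE memNset ?mule0// => -[/= h _]; exact/hi/esym.
rewrite ge0_integral_sum//; first last.
  by move=> i w _; rewrite mule_ge0//; exact: f0.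
  move=> i; apply: emeasurable_funM.
    apply: measurableT_comp => //.
    by apply/measurable_fun_pairP; split; exact: measurable_funPT.
  by apply/measurable_EFinP; exact: measurable_indic.
rewrite ge0_sume_distrr; last first.
  by move=> i _; apply: integral_ge0 => s _; apply: integral_ge0.
apply: eq_bigr => i _.
rewrite (ge0_integral_joint (mu := mu) (c := NngNum c0) (mQi i))//= => A B mA mB.
have [h1 h2] := futS i hQ mB.
rewrite indep// h2; congr (_ * (_ * _))%E.
by rewrite EFinM fineK// fin_num_measure//; exact: futm hQ.
Qed.

(** By [step_integral], the probability for [Q] is [P Q] times a quantity that does not involve [Q];
    comparison with [Q = setT] identifies that quantity. *)
Lemma chain_indep t A Q : measurable A -> fut t Q ->
  P (W t @^-1` A `&` Q) = (P (W t @^-1` A) * P Q)%E.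
Proof.
elim: t A Q => [|t IH] A Q mA hQ; first exact: W0.
have h Q' : fut t.+1 Q' -> P (W t.+1 @^-1` A `&` Q') =
   ((#|Th|%:R^-1 * fine (P Q'))%:E *
     \sum_i \int[distribution P (W t)]_s \int[mu]_v (\1_A (Phi t i (s, v)))%:E)%E.
  move=> hQ'; rewrite -(step_integral (f := fun s => (\1_A s)%:E) hQ' IH).
  - transitivity (\int[P]_w (\1_(W t.+1 @^-1` A `&` Q') w)%:E)%E.
      rewrite integral_indic ?setIT//; apply: measurableI; last exact: futm hQ'.
      by rewrite -[X in measurable X]setTI; exact: measurable_funPT.
    by apply: eq_integral => w _; rewrite indicI.
  - by apply/measurable_EFinP; exact: measurable_indic.
  - by move=> x; rewrite lee_fin indicE ler0n.
have hT := h _ (futT _); rewrite setIT probability_setT mulr1 in hT.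
rewrite (h _ hQ) hT EFinM fineK ?fin_num_measure//; last exact: futm hQ.
by rewrite muleAC.
Qed.

Lemma chain_integral t (f : S -> \bar R) : measurable_fun setT f -> (forall x, 0 <= f x)%E ->
  (\int[distribution P (W t.+1)]_s f s =
   (#|Th|%:R^-1)%:E *
     \sum_i \int[distribution P (W t)]_s \int[mu]_v f (Phi t i (s, v)))%E.
Proof.
move=> mf f0.
rewrite ge0_integral_distribution//.
have -> : (#|Th|%:R^-1 : R) = #|Th|%:R^-1 * fine (P setT) by rewrite probability_setT mulr1.
rewrite -(step_integral (futT _))//; last exact: chain_indep.
by apply: eq_integral => w _; rewrite /= indicE in_setT mule1.
Qed.

End chain.

Lemma bigcap_in_seq1 (T : Type) (I : eqType) (i : I) (A : I -> set T) :
  \bigcap_(j in [set` [:: i]]) A j = A i.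
Proof.
apply/seteqP; split => w; first by apply; rewrite /= inE.
by move=> h j; rewrite /= inE => /eqP ->.
Qed.

(** * Cylinder events of an independent family *)

Section cylinder.
Context d (T : measurableType d) (R : realType) (P : probability T R) (I : eqType).
Variable F : I -> set (set T).

Definition cylinder (ok : pred I) (Q : set T) : Prop :=
  exists (s : seq I) (A : I -> set T), [/\ uniq s, all ok s,
    (forall i, i \in s -> F i (A i)) & Q = \bigcap_(i in [set` s]) A i].

Lemma cylinderT ok : cylinder ok setT.
Proof.
exists [::], (fun=> setT); split => //.
by apply/seteqP; split => // w _ i.
Qed.

Lemma cylinder_measurable ok Q : (forall i A, F i A -> measurable A) ->
  cylinder ok Q -> measurable Q.
Proof.
move=> Fm [s [A [_ _ FA ->]]].
by apply: fin_bigcap_measurable => [|i /FA /Fm]//; exact: finite_seq.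
Qed.

Hypothesis indep : mutually_independent P F.

(** An event on finitely many new sources and a cylinder on the sources in [ok] together form a
    cylinder on a duplicate-free list, so mutual independence factors its probability. This supplies
    the class [fut] of future events of the chains. *)
Lemma cylinder_cat (ok ok' : pred I) s A Q : uniq s -> (forall i, i \in s -> F i (A i)) ->
  cylinder ok Q -> (forall i, i \in s -> ok' i && ~~ ok i) -> (forall i, ok i -> ok' i) ->
  cylinder ok' ((\bigcap_(i in [set` s]) A i) `&` Q) /\
  (P ((\bigcap_(i in [set` s]) A i) `&` Q) = \prod_(i <- s) P (A i) * P Q)%E.
Proof.
move=> us FA [s2 [A2 [us2 oks2 FA2 ->]]] oks okok'.
pose A' i := if ok i then A2 i else A i.
have A's i : i \in s -> A' i = A i.
  by move=> /oks /andP[_ /negbTE h]; rewrite /A' h.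
have A's2 i : i \in s2 -> A' i = A2 i.
  by move=> /(allP oks2) h; rewrite /A' h.
have E : (\bigcap_(i in [set` s]) A i) `&` (\bigcap_(i in [set` s2]) A2 i) =
   \bigcap_(i in [set` s ++ s2]) A' i.
  apply/seteqP; split => w.
    move=> [h1 h2] i /=; rewrite mem_cat => /orP[] hi.
      by rewrite A's//; exact: h1.
    by rewrite A's2//; exact: h2.
  move=> h; split => i hi.
    by rewrite -A's//; apply: h; rewrite /= mem_cat; apply/orP; left.
  by rewrite -A's2//; apply: h; rewrite /= mem_cat; apply/orP; right.
have u' : uniq (s ++ s2).
  rewrite cat_uniq us us2 andbT; apply/hasPn => i /(allP oks2) h.
  by apply/negP => /oks /andP[_]; rewrite h.
have F' i : i \in s ++ s2 -> F i (A' i).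
  rewrite mem_cat => /orP[] hi; first by rewrite A's//; exact: FA.
  by rewrite A's2//; exact: FA2.
rewrite E; split.
  exists (s ++ s2), A'; split => //.
  rewrite all_cat; apply/andP; split; apply/allP => i hi.
    by have /andP[] := oks _ hi.
  by apply: okok'; exact: (allP oks2).
rewrite indep// big_cat/= (indep us2 FA2); congr (_ * _)%E.
  by apply: eq_big_seq => i /A's ->.
by apply: eq_big_seq => i /A's2 ->.
Qed.

End cylinder.

Lemma integral_prob_cst d (T : measurableType d) (R : realType) (mu : probability T R)
  (c : \bar R) : (\int[mu]_x c = c)%E.
Proof.
exact: etrans (integral_cst mu (@measurableT _ T) c)
  (etrans (congr1 (fun t => c * t)%E (probability_setT mu)) (mule1 c)).
Qed.

(** * From chi-square to relative entropy *)

Section kl.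
Context d (T : measurableType d) (R : realType).
Implicit Types mu nu : probability T R.

(* Equivalently, mu << nu and the second moment of dmu/dnu under nu is at most V. *)
Definition chi2_le mu nu (V : R) : Prop :=
  forall (h : T -> R) (b : R), measurable_fun setT h -> (forall x, 0 <= h x <= b) ->
  fine (\int[mu]_x (h x)%:E) ^+ 2 <= V * fine (\int[nu]_x (h x ^+ 2)%:E).

Lemma bounded_fin_num mu (h : T -> R) (b : R) : measurable_fun setT h ->
  (forall x, 0 <= h x <= b) -> (\int[mu]_x (h x)%:E)%E \is a fin_num.
Proof.
move=> mh hb.
have h0 x : 0 <= h x by case/andP: (hb x).
rewrite ge0_fin_numE; last by apply: integral_ge0 => x _; rewrite lee_fin.
apply: (@le_lt_trans _ _ (\int[mu]_x (b%:E))%E).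
  apply: ge0_le_integral => //.
  - by move=> x _; rewrite lee_fin.
  - exact/measurable_EFinP.
  - by move=> x _; rewrite lee_fin; case/andP: (hb x).
by rewrite integral_prob_cst ltry.
Qed.

Lemma le_integral_measurable mu (f g : T -> \bar R) :
  measurable_fun setT f -> measurable_fun setT g -> (forall x, f x <= g x)%E ->
  (\int[mu]_x f x <= \int[mu]_x g x)%E.
Proof.
move=> mf mg fg.
rewrite integralE [leRHS]integralE; apply: leeB.
  apply: ge0_le_integral => //.
  - exact: measurable_funepos.
  - exact: measurable_funepos.
  - by move=> x _; apply: (@funepos_le _ _ setT) => //; rewrite inE.
apply: ge0_le_integral => //.
- exact: measurable_funeneg.
- exact: measurable_funeneg.
- by move=> x _; apply: (@funeneg_le _ _ setT) => //; rewrite inE.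
Qed.

Lemma measurable_lne_comp (f : T -> \bar R) : measurable_fun setT f ->
  (forall x, f x \is a fin_num) -> measurable_fun setT (fun x => lne (f x)).
Proof.
move=> mf ffin.
rewrite (_ : (fun x => _) = fun x => if (f x <= 0)%E then -oo%E else (ln (fine (f x)))%:E).
  apply: measurable_fun_ifT => //.
    by apply: measurable_fun_lee.
  apply/measurable_EFinP; apply: measurableT_comp; first exact: measurable_ln.
  by apply: measurableT_comp.
apply/funext => x; rewrite -[in lne _](fineK (ffin x)) -[in (_ <= _)%E](fineK (ffin x)) /=.
by rewrite lee_fin.
Qed.

Variables (mu nu : probability T R) (V : R).
Hypothesis hV : chi2_le mu nu V.

Lemma chi2_le_ge1 : 1 <= V.
Proof.
have := hV (h := fun=> 1) (b := 1) (@measurable_cst _ _ _ _ _ _) (fun=> ltac:(by rewrite ler01 lexx)).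
by rewrite expr1n !integral_prob_cst/= expr1n mulr1.
Qed.

(** Testing with an indicator gives [mu(A)^2 <= V nu(A)]. *)
Lemma chi2_le_dominates : mu `<< nu.
Proof.
apply/null_content_dominatesP => A mA A0.
have hA x : 0 <= (\1_A x : R) <= 1 by rewrite indicE ler0n lern1 leq_b1.
have := hV (measurable_indic mA) hA.
rewrite (_ : (fun x => (_ ^+ 2)%:E) = fun x => (\1_A x)%:E); last first.
  by apply/funext => x; rewrite indicE; case: (x \in A); rewrite ?expr1n ?expr0n.
rewrite !integral_indic// !setIT A0/= mulr0 => h.
have : fine (mu A) == 0 by rewrite -sqrf_eq0 eq_le h sqr_ge0.
by move=> /eqP h0; rewrite -(fineK (fin_num_measure mu A mA)) h0.
Qed.

Let munu : mu `<< nu := chi2_le_dominates.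
Let f := Radon_Nikodym_SigmaFinite.f mu nu.
Let f0 x : (0 <= f x)%E := Radon_Nikodym_SigmaFinite.f_ge0 munu x.
Let ffin x : f x \is a fin_num := Radon_Nikodym_SigmaFinite.f_fin_num munu x.
Let mf : measurable_fun setT f.
Proof. exact: measurable_int (Radon_Nikodym_SigmaFinite.f_integrable munu). Qed.
Let r x := fine (f x).
Let mr : measurable_fun setT r. Proof. exact: measurableT_comp. Qed.
Let r0 x : 0 <= r x. Proof. exact: fine_ge0. Qed.

(** Test with the truncated density [h = r] on [r <= N]. Since [h r = h^2], the integral of [h]
    against [mu] equals that of [h^2] against [nu], so its square is at most [V] times itself and it
    is at most [V]; then let [N] grow. *)
Let density_moment : (\int[mu]_x f x <= V%:E)%E.
Proof.
pose h (N : nat) x := r x * \1_[set x | r x <= N%:R] x.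
have mh N : measurable_fun setT (h N).
  apply: measurable_funM => //; apply: measurable_indic.
  rewrite (_ : [set _ | _] = setT `&` r @^-1` [set` `]-oo, N%:R]]); last first.
    by rewrite setTI; apply/seteqP; split => x /=; rewrite in_itv.
  exact: mr measurableT _ (measurable_itv _).
have hN N x : 0 <= h N x <= N%:R.
  rewrite /h indicE; case: (boolP (x \in _)) => [|_]; last by rewrite mulr0 lexx ler0n.
  by rewrite inE/= mulr1 r0.
have bound N : (\int[mu]_x (h N x)%:E <= V%:E)%E.
  have := hV (mh N) (hN N).
  rewrite (_ : (\int[nu]_x _)%E = \int[mu]_x (h N x)%:E)%E; last first.
    rewrite -(Radon_Nikodym_SigmaFinite.change_of_variables munu)//.
    - apply: eq_integral => x _; rewrite -[X in (_ * X)%E](fineK (ffin x)) -EFinM.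
      rewrite /h indicE; case: (x \in _); rewrite ?mulr1 ?mulr0 ?expr0n ?mul0r// expr2.
    - by move=> x; rewrite lee_fin; case/andP: (hN N x).
    - exact/measurable_EFinP.
  have fi := bounded_fin_num mu (mh N) (hN N).
  rewrite -[X in (X <= _)%E](fineK fi) lee_fin.
  have : 0 <= fine (\int[mu]_x (h N x)%:E).
    by apply: fine_ge0; apply: integral_ge0 => x _; rewrite lee_fin; case/andP: (hN N x).
  move: (fine _) => y y0 hy.
  have [->|yn0] := eqVneq y 0; first exact: le_trans ler01 chi2_le_ge1.
  by move: hy; rewrite expr2 ler_pM2r// lt_def yn0.
have fE : f = fun x => limn (fun N => (h N x)%:E).
  apply/funext => x; apply/esym/cvg_lim => //.
  apply: cvg_near_cst; near=> N.
  rewrite /h indicE mem_set/=; first by rewrite mulr1 fineK.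
  by near: N; exact: nbhs_infty_ger.
have h_nd x m n : (m <= n)%N -> ((h m x)%:E <= (h n x)%:E)%E.
  move=> mn; rewrite lee_fin ler_wpM2l// !indicE.
  have [xm|_] := boolP (x \in [set y | r y <= m%:R]); last by rewrite ler0n.
  rewrite inE/= in xm; rewrite mem_set//=.
  by apply: le_trans xm _; rewrite ler_nat.
rewrite fE monotone_convergence//.
- apply: lime_le.
  + apply: ereal_nondecreasing_is_cvgn => m n mn.
    apply: ge0_le_integral => //.
    * by move=> x _; rewrite lee_fin; case/andP: (hN m x).
    * exact/measurable_EFinP.
    * exact/measurable_EFinP.
    * by move=> x _; exact: h_nd.
  + by apply: nearW.
- by move=> n; exact/measurable_EFinP.
- by move=> n x _; rewrite lee_fin; case/andP: (hN n x).
- by move=> x _ m n; exact: h_nd.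
Unshelve. all: by end_near.
Qed.

(** Jensen's inequality for the logarithm, by means of the tangent: [ln r <= ln V - 1 + r/V], and
    the mean of [r/V] under [mu] is at most 1. *)
Lemma KL_le_ln : (KL mu nu <= (ln V)%:E)%E.
Proof.
rewrite /KL; case: asboolP => // _.
have V0 : 0 < V := lt_le_trans ltr01 chi2_le_ge1.
have mg : measurable_fun setT (Radon_Nikodym (charge_of_finite_measure mu) nu) by [].
(* The two versions of the derivative agree [nu]-almost everywhere, hence [mu]-almost everywhere by
   domination. *)
rewrite (_ : (\int[mu]_y _)%E = \int[mu]_y lne (f y))%E; last first.
  apply: ae_eq_integral => //.
  - apply: measurable_lne_comp => // x; exact: Radon_Nikodym_fin_num.
  - exact: measurable_lne_comp.
  - have := null_dominates_ae_eq measurableT munu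
      (ae_eq_Radon_Nikodym_SigmaFinite munu measurableT).
    by apply: filterS => x /[apply] <-.
apply: (@le_trans _ _ (\int[mu]_x (ln V - 1 + r x / V)%:E)%E).
  apply: le_integral_measurable => //.
  - exact: measurable_lne_comp.
  - apply/measurable_EFinP; apply: measurable_funD => //.
    exact: measurable_funM.
  - move=> x; rewrite -(fineK (ffin x)) -/(r x)/=; case: ifPn; first by rewrite leNye.
    rewrite -ltNge => rx; rewrite lee_fin.
    have -> : r x = V * (r x / V) by rewrite mulrCA mulfV ?mulr1// gt_eqF.
    have y0 : 0 < r x / V by rewrite divr_gt0.
    rewrite lnM ?posrE// mulrCA mulfV ?gt_eqF// mulr1.
    have := @le_ln1Dx _ (r x / V - 1); rewrite addrCA subrr addr0 => /(_ ltac:(lra)); lra.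
have hr : (\int[mu]_x (r x / V)%:E <= 1)%E.
  rewrite (_ : (fun x => _) = fun x => (V^-1%:E * f x)%E); last first.
    by apply/funext => x; rewrite mulrC EFinM fineK.
  have Vi : 0 <= V^-1 by rewrite invr_ge0 ltW.
  rewrite ge0_integralZl_EFin//.
  apply: (@le_trans _ _ (V^-1%:E * V%:E)%E); last by rewrite -EFinM mulVf// gt_eqF.
  by apply: lee_wpmul2l.
under eq_integral do rewrite EFinD.
rewrite integralD//; first last.
- apply/integrableP; split.
    by apply/measurable_EFinP; exact: measurable_funM.
  rewrite (eq_integral (fun x => (r x / V)%:E)).
    exact: le_lt_trans hr (ltry _).
  by move=> x _; rewrite gee0_abs// lee_fin divr_ge0// ltW.
- exact: finite_measure_integrable_cst.
rewrite integral_prob_cst (le_trans (leeD2l _ hr))// -EFinD lee_fin.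
by rewrite subrK.
Qed.

End kl.

(** * Propagation of the chi-square bound through one Markov step *)

Section chi2_step_markov.
Context d d2 (S : measurableType d) (E : measurableType d2) (R : realType) (I : finType).
Variables (mu nu mu' nu' : probability S R) (gam : probability E R).
Variables (Phi : S * E -> S) (Psi : I -> S * E -> S) (V0 V : R).
Hypotheses (mPhi : measurable_fun setT Phi) (mPsi : forall i, measurable_fun setT (Psi i)).
Hypothesis mu'E : forall f : S -> \bar R, measurable_fun setT f -> (forall x, 0 <= f x)%E ->
  (\int[mu']_s f s =
   (#|I|%:R^-1)%:E * \sum_i \int[mu]_s \int[gam]_v f (Psi i (s, v)))%E.
Hypothesis nu'E : forall f : S -> \bar R, measurable_fun setT f -> (forall x, 0 <= f x)%E ->
  (\int[nu']_s f s = \int[nu]_s \int[gam]_v f (Phi (s, v)))%E.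
Hypothesis step : {ae mu, forall s, forall (h : S -> R) (b : R), measurable_fun setT h ->
  (forall x, 0 <= h x <= b) ->
  avg (fun i => fine (\int[gam]_v (h (Psi i (s, v)))%:E)) ^+ 2 <=
  V * fine (\int[gam]_v (h (Phi (s, v)) ^+ 2)%:E)}.
Hypotheses (V_ge0 : 0 <= V) (V0_ge0 : 0 <= V0).

Let fine_kernel (f : S -> R) (G : S * E -> S) b : measurable_fun setT f ->
  (forall x, 0 <= f x <= b) -> measurable_fun setT G ->
  measurable_fun setT (fun s => fine (\int[gam]_v (f (G (s, v)))%:E)) /\
  forall s, 0 <= fine (\int[gam]_v (f (G (s, v)))%:E) <= b /\
    (fine (\int[gam]_v (f (G (s, v)))%:E))%:E = (\int[gam]_v (f (G (s, v)))%:E)%E.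
Proof.
move=> mf fb mG.
have f0 x : 0 <= f x by case/andP: (fb x).
have mfG : measurable_fun setT (fun p => (f (G p))%:E).
  by apply/measurable_EFinP; exact: measurableT_comp.
have mF : measurable_fun setT (fun s => \int[gam]_v (f (G (s, v)))%:E)%E.
  have mfG0 p : (0 <= (f (G p))%:E)%E by rewrite lee_fin.
  exact: (measurable_fun_fubini_tonelli_F (m2 := gam) _ mfG mfG0).
have mv s : measurable_fun setT (fun v => f (G (s, v))).
  exact: (measurableT_comp (measurableT_comp mf mG) (pair1_measurable s)).
split; first exact: measurableT_comp.
move=> s; have fi := bounded_fin_num gam (mv s) (fun v => fb (G (s, v))).
split; last by rewrite fineK.
rewrite fine_ge0/=; last by apply: integral_ge0 => v _; rewrite lee_fin.
rewrite -lee_fin fineK// -[leRHS](integral_prob_cst gam).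
apply: ge0_le_integral => //.
- by move=> v _; rewrite lee_fin.
- exact/measurable_EFinP.
- by move=> v _; rewrite lee_fin; case/andP: (fb (G (s, v))).
Qed.

(** For a test function [h], the one-step bound dominates the mean of [h] under the first kernel by
    [k = sqrt(V B)], where [B] is the mean of [h^2] under the second. Using [k] as a test function
    for the initial laws multiplies the constants. The one-step bound is needed only [mu]-almost
    everywhere. *)
Lemma chi2_le_step : chi2_le mu nu V0 -> chi2_le mu' nu' (V0 * V).
Proof.
move=> hV h b mh hb.
have h0 x : 0 <= h x by case/andP: (hb x).
have sb x : 0 <= h x ^+ 2 <= b ^+ 2.
  by rewrite sqr_ge0 ler_sqr ?nnegrE//; case/andP: (hb x) => // /le_trans; apply.
have msq : measurable_fun setT (fun x => h x ^+ 2) by exact: measurable_funX.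
pose A s := avg (fun i => fine (\int[gam]_v (h (Psi i (s, v)))%:E)).
pose B s := fine (\int[gam]_v (h (Phi (s, v)) ^+ 2)%:E).
have [mB hB] := fine_kernel msq sb mPhi.
pose k s := Num.sqrt (V * B s).
have mk : measurable_fun setT k.
  by apply: measurableT_comp; [apply: continuous_measurable_fun; exact: sqrt_continuous|exact: measurable_funM].
have kb s : 0 <= k s <= Num.sqrt (V * b ^+ 2).
  have [/andP[_ h1] _] := hB s.
  by rewrite sqrtr_ge0 ler_sqrt ?ler_wpM2l// mulr_ge0// sqr_ge0.
have := hV _ _ mk kb.
have -> : fine (\int[nu]_x (k x ^+ 2)%:E) = V * fine (\int[nu']_x (h x ^+ 2)%:E).
  rewrite nu'E; first last.
  - by move=> x; rewrite lee_fin sqr_ge0.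
  - exact/measurable_EFinP.
  rewrite [in RHS](eq_integral (fun s => (B s)%:E)); last by move=> s _; exact/esym/(hB s).2.
  rewrite [in LHS](eq_integral (fun s => (V%:E * (B s)%:E)%E)); last first.
    by move=> s _; rewrite sqr_sqrtr ?EFinM// mulr_ge0//; case/andP: (hB s).1.
  rewrite ge0_integralZl_EFin//; first last.
  - exact/measurable_EFinP.
  - by move=> s _; rewrite lee_fin; case/andP: (hB s).1.
  by rewrite fineM//; exact: (bounded_fin_num nu mB (fun s => (hB s).1)).
rewrite mulrA; apply: le_trans.
rewrite ler_sqr ?nnegrE; first last.
- by apply: fine_ge0; apply: integral_ge0 => x _; rewrite lee_fin; case/andP: (kb x).
- by apply: fine_ge0; apply: integral_ge0 => x _; rewrite lee_fin.
rewrite fine_le//; first exact: bounded_fin_num hb.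
  exact: bounded_fin_num kb.
rewrite mu'E//; last exact/measurable_EFinP.
have hA i := fine_kernel mh hb (mPsi i).
have A_ge0 s : 0 <= A s.
  by apply: avg_ge0 => i; case/andP: ((hA i).2 s).1.
have mA : measurable_fun setT A.
  apply: measurable_funM => //.
  by apply: measurable_sum => i; exact: (hA i).1.
rewrite (_ : (_ * _)%E = \int[mu]_s (A s)%:E)%E; last first.
  rewrite (eq_integral (fun s => (#|I|%:R^-1)%:E *
    \sum_i (fine (\int[gam]_v (h (Psi i (s, v)))%:E))%:E)%E); last first.
    by move=> s _; rewrite /A /avg EFinM sumEFin.
  have I0 : 0 <= #|I|%:R^-1 :> R by rewrite invr_ge0.
  rewrite [RHS]ge0_integralZl_EFin//; first last.
  - by under eq_fun do rewrite sumEFin; apply/measurable_EFinP; apply: measurable_sum => i; exact: (hA i).1.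
  - by move=> s _; apply: sume_ge0 => i _; rewrite lee_fin; case/andP: ((hA i).2 s).1.
  rewrite [in RHS]ge0_integral_sum//; first last.
  - by move=> i s _; rewrite lee_fin; case/andP: ((hA i).2 s).1.
  - by move=> i; apply/measurable_EFinP; exact: (hA i).1.
  by congr (_ * _)%E; apply: eq_bigr => i _; apply: eq_integral => s _; rewrite ((hA i).2 s).2.
apply: ae_ge0_le_integral => //.
- by move=> s _; rewrite lee_fin.
- exact/measurable_EFinP.
- by move=> s _; rewrite lee_fin; case/andP: (kb s).
- exact/measurable_EFinP.
apply: filterS step => s /(_ h b mh hb) hs _.
rewrite lee_fin -(@ler_pXn2r _ 2) ?nnegrE ?sqrtr_ge0// sqr_sqrtr//.
by rewrite mulr_ge0//; case/andP: (hB s).1.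
Qed.

End chi2_step_markov.

(** * Encoding of paths as states of a chain that moves one particle at a time *)

Section path_state.
Context (R : realType) (d n K : nat).
Local Notation V := 'cV[R]_d.
(* Particles are moved one at a time: micro-step [t] moves particle [particle t] from time
   [time t] to the next time. A state records the positions at times 0..K known so far, with
   [0] for those which are not. *)
Local Notation S := 'M[V]_(K.+1, n.+1).

Definition time (t : nat) : nat := t %/ n.+1.
Definition particle (t : nat) : 'I_n.+1 := inord (t %% n.+1).

Definition place (t : nat) (s : S) (v : V) : S :=
  \matrix_(k, i) if (k == (time t).+1 :> nat) && (i == particle t) then v else s k i.

Definition config (k : nat) (s : S) (i : 'I_n.+1) : V := s (inord k) i.

(** Row 0 is known from the start; the entry [(k, i)] with [k > 0] is written by micro-step
    [(k - 1) * n.+1 + i]. *)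
Definition known (t : nat) (k : 'I_K.+1) (i : 'I_n.+1) : bool :=
  (k == 0%N :> nat) || (k.-1 * n.+1 + i < t)%N.

Definition partial_path (y : nat -> 'I_n.+1 -> V) (t : nat) : S :=
  \matrix_(k, i) if known t k i then y k i else 0.

Lemma particleE t : particle t = (t %% n.+1)%N :> nat.
Proof. by rewrite inordK// ltn_mod. Qed.

Lemma timeE t : (time t * n.+1 + particle t = t)%N.
Proof. by rewrite particleE -divn_eq. Qed.

Lemma time_lt t : (t < K * n.+1)%N -> (time t < K)%N.
Proof. by move=> h; rewrite ltn_divLR. Qed.

Lemma micro_step_inj k (i : 'I_n.+1) t : (k * n.+1 + i = t)%N -> k = time t /\ i = particle t.
Proof.
move=> <-; split; first by rewrite /time divnMDl// divn_small// addn0.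
by apply: val_inj; rewrite /= particleE modnMDl modn_small.
Qed.

Lemma partial_pathS y t :
  partial_path y t.+1 = place t (partial_path y t) (y (time t).+1 (particle t)).
Proof.
apply/matrixP => k i; rewrite !mxE.
have [|h] := boolP (known t.+1 k i); last first.
  have [/andP[/eqP hk /eqP hi]|_] := boolP (_ && _).
    by case/negP: h; rewrite /known hk hi/= ltnS timeE leqnn.
  have [h'|//] := boolP (known t k i); case/negP: h; move: h'; rewrite /known.
  by case: eqP => //= _ /ltnW.
rewrite {1}/known; case: eqP => [k0 _|k0 /=].
  by rewrite k0/= /known k0.
rewrite ltnS leq_eqVlt => /orP[/eqP/micro_step_inj[hk hi]|h].
  have hk' : k = (time t).+1 :> nat by rewrite -hk prednK// lt0n; apply/eqP.
  by rewrite hk' hi !eqxx.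
case: ifPn => [/andP[/eqP -> /eqP ->]//|_].
by rewrite /known h orbT.
Qed.

(** At micro-step [t] the whole configuration at time [time t] has been written, so the forces are
    evaluated at the old positions of all particles. *)
Lemma config_partial_path y t : (time t <= K)%N ->
  config (time t) (partial_path y t) = y (time t).
Proof.
move=> hK; apply/funext => i.
rewrite /config mxE /known inordK// ; case: ifPn => // /norP[/eqP h].
rewrite -leqNgt => ht; exfalso.
move: (timeE t) (ltn_ord i) (ltn_ord (particle t)).
move: ht h; case: (time t) => // k' /=; rewrite mulSn; lia.
Qed.

Definition path_of_state (s : S) : K.-tuple (n.+1.-tuple V) :=
  [tuple [tuple s (lift ord0 k) i | i < n.+1] | k < K].

Lemma path_of_partial_path y :
  path_of_state (partial_path y (K * n.+1)) =
  [tuple [tuple y (lift ord0 k) i | i < n.+1] | k < K].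
Proof.
apply: eq_from_tnth => k; rewrite !tnth_mktuple; apply: eq_from_tnth => i.
rewrite !tnth_mktuple mxE /known /=.
by rewrite (_ : (k * n.+1 + i < K * n.+1)%N)// ; have := ltn_ord k; have := ltn_ord i; nia.
Qed.

End path_state.

(** * CC-RBM as IPD with a modified noise *)

Section effective_noise.
Context (R : realType) (d n B B' : nat).
Local Notation V := 'cV[R]_d.
Variables (eta sigma : R) (g : 'I_n -> V -> V) (F : 'I_n -> 'I_n -> V -> V -> V).
Local Notation Theta := ({ffun 'I_B' -> 'I_n * 'I_n} * {ffun 'I_B -> 'I_n})%type.

Definition effective_noise (z : 'I_n -> V) (i : 'I_n) (th : Theta) (e : V) : V :=
  let f j := F i j (z i) (z j) in
  let kap := Num.sqrt eta / sigma in
  batch_fluct f kap th.2 + corr (batch_Sigma B f kap th.1) *m e.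

Hypotheses (n0 : (0 < n)%N) (B0 : (0 < B)%N) (eta0 : 0 < eta) (sigma0 : 0 < sigma).

(* The batch mean deviates from the full mean by an amount which is absorbed in the noise. *)
Lemma ccrbm_stepE z i (I : 'I_B -> 'I_n) (J Jbar : 'I_B' -> 'I_n) e :
  ccrbm_step eta sigma g F z i I J Jbar e =
  ipd_step eta sigma g F z i
    (effective_noise z i ([ffun l => (J l, Jbar l)], [ffun j => I j]) e).
Proof.
have s0 : sigma != 0 by rewrite gt_eqF.
have q0 : Num.sqrt eta != 0 by rewrite gt_eqF// sqrtr_gt0.
have nn : n%:R != 0 :> R by rewrite pnatr_eq0 -lt0n.
have BB : B%:R != 0 :> R by rewrite pnatr_eq0 -lt0n.
have qq : Num.sqrt eta * Num.sqrt eta = eta by rewrite -expr2 sqr_sqrtr// ltW.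
set f := fun j => F i j (z i) (z j).
pose J' : {ffun 'I_B' -> 'I_n * 'I_n} := [ffun l => (J l, Jbar l)].
pose I' : {ffun 'I_B -> 'I_n} := [ffun j => I j].
have h1 : eta *: batch_force F z i I = (eta / n%:R) *: (\sum_j f j) +
    (sigma * Num.sqrt eta) *: batch_fluct f (Num.sqrt eta / sigma) I'.
  rewrite /batch_force /batch_fluct /batch_dev /batch_mean.
  rewrite [X in _ = _ + _ *: X](eq_bigr (fun j => (Num.sqrt eta / sigma / B%:R) *: (f (I j)) -
      (Num.sqrt eta / sigma / B%:R) *: (n%:R^-1 *: \sum_j f j))); last first.
    by move=> j _; rewrite /I' ffunE scalerBr.
  rewrite sumrB -scaler_sumr sumr_const card_ord scalerBr !scalerA.
  rewrite scalerMnl scalerA.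
  rewrite (_ : sigma * Num.sqrt eta * _ = eta / B%:R); last by move: (Num.sqrt eta) qq => q <-; field; rewrite BB s0.
  rewrite (_ : sigma * Num.sqrt eta * (_ *+ B) = eta / n%:R); last first.
    rewrite -mulr_natl.
    by move: (Num.sqrt eta) qq => q <-; field; rewrite nn BB s0.
  by rewrite addrCA subrr addr0.
have h2 : 1%:M - (eta / (2 * sigma ^+ 2)) *: batch_cov B F z i J Jbar =
    corr (batch_Sigma B f (Num.sqrt eta / sigma) J').
  rewrite /corr /batch_Sigma /batch_cov; congr (_ - _).
  rewrite !scalerA !scaler_sumr; apply: eq_bigr => l _.
  rewrite /pair_dev /J' ffunE /= linearZ/= -scalemxAl -scalemxAr !scalerA; congr (_ *: _).
  have B2 : Num.sqrt (2 * B%:R) * Num.sqrt (2 * B%:R) = 2 * B%:R :> R.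
    by rewrite -expr2 sqr_sqrtr// mulr_ge0.
  have r0 : Num.sqrt (2 * B%:R) != 0 :> R by rewrite gt_eqF// sqrtr_gt0 mulr_gt0// ltr0n.
  rewrite (_ : _ * (_ / _) * (_ / _) = 2^-1 * B'%:R^-1 * (eta / sigma ^+ 2 / (2 * B%:R))); last first.
    move: (Num.sqrt eta) (Num.sqrt (2 * _)) qq B2 r0 => q r <- <- r0.
    by move: (B'%:R^-1) => c; field; rewrite s0 r0.
  by rewrite [(2 * B%:R * _)^-1]invfM; move: (B'%:R^-1) => c; field; rewrite s0 BB.
rewrite /ccrbm_step /ipd_step /effective_noise h1 h2 -/f -/I' -/J'.
by rewrite [Num.sqrt eta * sigma]mulrC scalerDr !addrA.
Qed.

End effective_noise.

Section measurable_steps.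
Context dT (T : measurableType dT) (R : realType) (d n : nat).
Local Notation V := 'cV[R]_d.
Variables (eta sigma : R) (g : 'I_n -> V -> V) (F : 'I_n -> 'I_n -> V -> V -> V).
Hypotheses (mg : forall i, measurable_fun setT (g i))
  (mF : forall i j, measurable_fun setT (fun p : V * V => F i j p.1 p.2)).
Variables (z : T -> 'I_n -> V) (e : T -> V) (i : 'I_n).
Hypotheses (mz : forall i, measurable_fun setT (fun x => z x i)) (me : measurable_fun setT e).

Lemma measurable_pair_force j : measurable_fun setT (fun x => F i j (z x i) (z x j)).
Proof.
apply: (measurableT_comp (mF i j) (g := fun x => (z x i, z x j))).
exact: measurable_fun_pair.
Qed.

Lemma measurable_ipd_step :
  measurable_fun setT (fun x => ipd_step eta sigma g F (z x) i (e x)).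
Proof.
apply: measurable_mxD; last exact: measurable_mxZ.
apply: measurable_mxD.
  by apply: measurable_mxD => //; apply: measurable_mxZ; exact: measurableT_comp.
by apply/measurable_mxZ/measurable_mx_sum => j; exact: measurable_pair_force.
Qed.

Lemma measurable_trmx m k (A : T -> 'M[R]_(m, k)) :
  measurable_fun setT A -> measurable_fun setT (fun x => (A x)^T).
Proof.
move=> mA; apply: measurable_mxP => a b; under eq_fun do rewrite mxE.
exact: measurableT_comp (measurable_mx_entry _ _) mA.
Qed.

Lemma measurable_mxB m k (A B : T -> 'M[R]_(m, k)) :
  measurable_fun setT A -> measurable_fun setT B -> measurable_fun setT (fun x => A x - B x).
Proof.
move=> mA mB; under eq_fun do rewrite -scaleN1r.
by apply: measurable_mxD => //; exact: measurable_mxZ.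
Qed.

Lemma measurable_effective_noise B B' (th : {ffun 'I_B' -> 'I_n * 'I_n} * {ffun 'I_B -> 'I_n}) :
  measurable_fun setT (fun x => effective_noise eta sigma F (z x) i th (e x)).
Proof.
have mf := measurable_pair_force.
apply: measurable_mxD.
  apply: measurable_mx_sum => j; apply: measurable_mxZ; apply: measurable_mxB => //.
  by apply/measurable_mxZ/measurable_mx_sum.
apply: measurable_mulmx => //; apply: measurable_mxB; first exact: measurable_cst.
apply/measurable_mxZ/measurable_mxZ/measurable_mx_sum => l.
have mp : measurable_fun setT (fun x =>
    pair_dev B (fun j => F i j (z x i) (z x j)) (Num.sqrt eta / sigma) (th.1 l)).
  by apply: measurable_mxZ; exact: measurable_mxB.
by apply: measurable_mulmx => //; exact: measurable_trmx.
Qed.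

End measurable_steps.

(** * The two path-valued Markov chains *)

Section micro_steps.
Context (R : realType) (d n B B' K : nat).
Local Notation V := 'cV[R]_d.
Local Notation S := 'M[V]_(K.+1, n.+1).
Local Notation Theta := ({ffun 'I_B' -> 'I_n.+1 * 'I_n.+1} * {ffun 'I_B -> 'I_n.+1})%type.
Variables (eta sigma : R) (g : nat -> 'I_n.+1 -> V -> V)
  (F : nat -> 'I_n.+1 -> 'I_n.+1 -> V -> V -> V).
Hypotheses (mg : forall k i, measurable_fun setT (g k i))
  (mF : forall k i j, measurable_fun setT (fun p : V * V => F k i j p.1 p.2)).

Definition ipd_micro (t : nat) (p : S * V) : S :=
  place t p.1 (ipd_step eta sigma (g (time n t)) (F (time n t)) (config (time n t) p.1)
    (particle n t) p.2).

(** The same update map as for IPD, so that the two chains differ in the law of the noise alone. *)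
Definition ccrbm_micro (t : nat) (th : Theta) (p : S * V) : S :=
  ipd_micro t (p.1, effective_noise eta sigma (F (time n t)) (config (time n t) p.1)
    (particle n t) th p.2).

Lemma measurable_ipd_micro dT (T : measurableType dT) t (s : T -> S) (v : T -> V) :
  measurable_fun setT s -> measurable_fun setT v ->
  measurable_fun setT (fun x => ipd_micro t (s x, v x)).
Proof.
move=> ms mv.
have me k i : measurable_fun setT (fun x => s x k i).
  exact: (measurableT_comp (measurable_mx_entry k i) ms).
apply: measurable_mxP => k i; rewrite /ipd_micro/=.
under eq_fun do rewrite mxE.
case: (_ && _) => /=; last exact: me.
by apply: measurable_ipd_step => // j; exact: me.
Qed.

Lemma measurable_ccrbm_micro dT (T : measurableType dT) t th (s : T -> S) (v : T -> V) :
  measurable_fun setT s -> measurable_fun setT v ->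
  measurable_fun setT (fun x => ccrbm_micro t th (s x, v x)).
Proof.
move=> ms mv; apply: measurable_ipd_micro => //=.
apply: measurable_effective_noise => // i.
exact: (measurableT_comp (measurable_mx_entry _ i) ms).
Qed.

End micro_steps.

Section partial_path_rv.
Context dT (T : measurableType dT) (R : realType) (P : probability T R) (d n K : nat).
Local Notation V := 'cV[R]_d.
Variable x : nat -> 'I_n.+1 -> {RV P >-> V}.

Definition path_rv (t : nat) (w : T) : 'M[V]_(K.+1, n.+1) :=
  partial_path K (fun k i => x k i w) t.

Lemma measurable_path_rv t : measurable_fun setT (path_rv t).
Proof.
apply: measurable_mxP => k i; rewrite /path_rv; under eq_fun do rewrite mxE.
case: (known t k i); last exact: measurable_cst.
exact: measurable_funPT.
Qed.

HB.instance Definition _ t := isMeasurableFun.Build _ _ _ _ (path_rv t) (measurable_path_rv t).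

End partial_path_rv.

Section path_chain.
Context dT (T : measurableType dT) (R : realType) (P : probability T R) (d n K : nat).
Local Notation V := 'cV[R]_d.
Local Notation S := 'M[V]_(K.+1, n.+1).
Variables (eta sigma : R) (g : nat -> 'I_n.+1 -> V -> V)
  (F : nat -> 'I_n.+1 -> 'I_n.+1 -> V -> V -> V).
Variables (x : nat -> 'I_n.+1 -> {RV P >-> V}).

(** The row to be written lies outside the state, which is thus frozen after time [K]; the
    recursions then hold for every [t]. *)
Lemma place_id t (s : S) v : (K <= time n t)%N -> place t s v = s.
Proof.
move=> h; apply/matrixP => k i; rewrite mxE.
by case: eqP => //= hk; have := ltn_ord k; rewrite hk ltnS ltnNge h.
Qed.

Lemma path_rvS (v : nat -> 'I_n.+1 -> T -> V) t w :
  (forall k i, x k.+1 i w = ipd_step eta sigma (g k) (F k) (fun j => x k j w) i (v k i w)) ->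
  path_rv K x t.+1 w = ipd_micro eta sigma g F t (path_rv K x t w, v (time n t) (particle n t) w).
Proof.
move=> rec; rewrite /path_rv partial_pathS /ipd_micro /=.
have [h|h] := leqP K (time n t); first by rewrite !place_id.
by rewrite config_partial_path ?(ltnW h)// -rec.
Qed.

(** The noise of CC-RBM is computed from the configuration stored in the state, which is the true
    one only up to time [K]; afterwards the state is frozen and a discrepancy is harmless. *)
Lemma ipd_micro_noise t (s : S) v v' : ((time n t < K)%N -> v = v') ->
  ipd_micro eta sigma g F t (s, v) = ipd_micro eta sigma g F t (s, v').
Proof.
rewrite /ipd_micro /=; have [h|h] := ltnP (time n t) K; first by move=> ->.
by rewrite !place_id.
Qed.

Definition initial_state (u : n.+1.-tuple V) : S :=
  \matrix_(k, i) if k == 0%N :> nat then tnth u i else 0.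

Lemma measurable_initial_state : measurable_fun setT initial_state.
Proof.
apply: measurable_mxP => k i; under eq_fun do rewrite mxE.
by case: (_ == _); [exact: measurable_tnth|exact: measurable_cst].
Qed.

Lemma path_rv0 : path_rv K x 0%N = initial_state \o tuple_fun (x 0%N).
Proof.
apply/funext => w; apply/matrixP => k i; rewrite !mxE /= tnth_mktuple /known ltn0 orbF.
by case: eqP => // ->.
Qed.

Lemma path_rv0_sigma (A : set S) : measurable A ->
  generated_sigma (tuple_fun (x 0%N)) (path_rv K x 0%N @^-1` A).
Proof.
move=> mA; exists (initial_state @^-1` A).
  by rewrite -[X in measurable X]setTI; exact: measurable_initial_state.
by rewrite setTI path_rv0.
Qed.

End path_chain.

Lemma generated_sigma_measurable dT (T : measurableType dT) dS (S : measurableType dS)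
  (X : T -> S) A : measurable_fun setT X -> generated_sigma X A -> measurable A.
Proof. by move=> mX [B mB <-]; exact: mX. Qed.

Lemma std_gaussian_law dT (T : measurableType dT) (R : realType) (P : probability T R) d
  (X : {RV P >-> 'cV[R]_d}) (gam : probability 'cV[R]_d R) B : std_normal gam ->
  std_gaussian P X -> measurable B -> P (X @^-1` B) = gam B.
Proof.
move=> hg hX mB.
exact: (std_normal_unique (m1 := distribution P X) (std_gaussian_std_normal hX) hg mB).
Qed.

Section ipd_chain.
Context dT (T : measurableType dT) (R : realType) (P : probability T R) (d n K : nat).
Local Notation V := 'cV[R]_d.
Local Notation S := 'M[V]_(K.+1, n.+1).
Variables (eta sigma : R) (g : nat -> 'I_n.+1 -> V -> V)
  (F : nat -> 'I_n.+1 -> 'I_n.+1 -> V -> V -> V).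
Hypotheses (mg : forall k i, measurable_fun setT (g k i))
  (mF : forall k i j, measurable_fun setT (fun p : V * V => F k i j p.1 p.2)).
Variables (x eps : nat -> 'I_n.+1 -> {RV P >-> V}) (gam : probability V R).
Hypotheses (hgam : std_normal gam) (hx : is_IPD eta sigma g F x eps).

Let sources (s : option (nat * 'I_n.+1)) : set (set T) :=
  if s is Some (k, i) then generated_sigma (eps k i) else generated_sigma (tuple_fun (x 0%N)).

(** The noise of particle [i] at time [k] is consumed by micro-step [k * n.+1 + i]; the initial
    positions are consumed before the first one. *)
Let future t (s : option (nat * 'I_n.+1)) : bool :=
  if s is Some (k, i) then (t <= k * n.+1 + i)%N else false.

Let sources_measurable s A : sources s A -> measurable A.
Proof. by case: s => [[k i]|] /=; apply: generated_sigma_measurable. Qed.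

(** The general chain with a one-point type of random indices. *)
Lemma ipd_chain t (f : S -> \bar R) : measurable_fun setT f -> (forall s, 0 <= f s)%E ->
  (\int[distribution P (path_rv K x t.+1)]_s f s =
   \int[distribution P (path_rv K x t)]_s \int[gam]_v f (ipd_micro eta sigma g F t (s, v)))%E.
Proof.
move=> mf f0; have ind := ipd_independent hx.
pose W t : {RV P >-> S} := path_rv K x t.
rewrite (@chain_integral _ _ _ _ _ _ _ P unit W (fun t => eps (time n t) (particle n t)) gam
  (fun _ _ => tt) (fun t _ => ipd_micro eta sigma g F t)
  (fun t => cylinder sources (future t)))//.
- by rewrite card_unit invr1 mul1e big_const card_unit /= adde0.
- by move=> t' _; apply: measurable_ipd_micro.
- move=> t' w; apply: (@path_rvS _ _ _ _ _ _ _ _ _ _ _ _ (fun k i => eps k i)) => k i.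
  exact: ipd_recursion hx _ _ _.
- by move=> t' Q; exact: cylinder_measurable.
- by move=> t'; exact: cylinderT.
- move=> A Q mA hQ.
  have h1 s : s \in [:: None] -> sources s (path_rv K x 0%N @^-1` A).
    by rewrite inE => /eqP ->; exact: path_rv0_sigma.
  have h2 s : s \in [:: None] -> predT s && ~~ future 0 s by rewrite inE => /eqP ->.
  have [_] := cylinder_cat ind (isT : uniq [:: None]) h1 hQ h2 (fun _ _ => isT).
  by rewrite bigcap_in_seq1 !big_seq1.
move=> t' Q [] B hQ mB.
pose src := Some (time n t', particle n t').
have h1 s : s \in [:: src] -> sources s (eps (time n t') (particle n t') @^-1` B).
  by rewrite inE => /eqP -> /=; exists B; rewrite // setTI.
have h2 s : s \in [:: src] -> future t' s && ~~ future t'.+1 s.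
  by rewrite inE => /eqP -> /=; rewrite timeE leqnn ltnn.
have h3 s : future t'.+1 s -> future t' s by case: s => [[k i]|]//= /ltnW.
have := cylinder_cat ind (isT : uniq [:: src]) h1 hQ h2 h3.
rewrite bigcap_in_seq1 !big_seq1 (std_gaussian_law hgam (ipd_gaussian hx _ _) mB).
rewrite card_unit invr1 mul1e.
by rewrite (_ : (fun=> tt) @^-1` [set tt] = setT) ?setTI//; apply/seteqP; split.
Qed.

End ipd_chain.

Section ccrbm_chain.
Context dT (T : measurableType dT) (R : realType) (P : probability T R) (d n B B' K : nat).
Local Notation V := 'cV[R]_d.
Local Notation S := 'M[V]_(K.+1, n.+1).
Local Notation Theta := ({ffun 'I_B' -> 'I_n.+1 * 'I_n.+1} * {ffun 'I_B -> 'I_n.+1})%type.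
Variables (eta sigma : R) (g : nat -> 'I_n.+1 -> V -> V)
  (F : nat -> 'I_n.+1 -> 'I_n.+1 -> V -> V -> V).
Hypotheses (mg : forall k i, measurable_fun setT (g k i))
  (mF : forall k i j, measurable_fun setT (fun p : V * V => F k i j p.1 p.2)).
Variables (x eps : nat -> 'I_n.+1 -> {RV P >-> V}) (gam : probability V R).
Variables (I : nat -> 'I_n.+1 -> 'I_B -> T -> 'I_n.+1)
  (J Jbar : nat -> 'I_n.+1 -> 'I_B' -> T -> 'I_n.+1).
Hypotheses (B0 : (0 < B)%N) (eta0 : 0 < eta) (sigma0 : 0 < sigma).
Hypotheses (hgam : std_normal gam) (hx : is_CCRBM eta sigma g F x eps I J Jbar).

Let sources (s : source n.+1 B B') : set (set T) :=
  match s with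
  | Init => generated_sigma (tuple_fun (x 0%N))
  | Noise k i => generated_sigma (eps k i)
  | Batch k i j => index_sigma (I k i j)
  | Cov k i l => index_sigma (J k i l)
  | Covbar k i l => index_sigma (Jbar k i l)
  end.

Let future t (s : source n.+1 B B') : bool :=
  match s with
  | Init => false
  | Noise k i | Batch k i _ | Cov k i _ | Covbar k i _ => (t <= k * n.+1 + i)%N
  end.

Let index_measurable (X : T -> 'I_n.+1) A : uniform_index P X -> index_sigma X A -> measurable A.
Proof.
move=> hX [Y _ <-]; rewrite setTI.
rewrite (_ : _ @^-1` _ = \bigcup_(i in Y) X @^-1` [set i]).
  by apply: fin_bigcup_measurable => [|i _]; [exact: finite_finset|exact: (hX i).1].
by apply/seteqP; split => w /= => [h|[i Yi ->//]]; exists (X w).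
Qed.

Let sources_measurable s A : sources s A -> measurable A.
Proof.
case: s => [|k i|k i j|k i l|k i l] /=.
- exact: generated_sigma_measurable.
- exact: generated_sigma_measurable.
- exact: index_measurable (ccrbm_uniform_I hx k i j).
- exact: index_measurable (ccrbm_uniform_J hx k i l).
- exact: index_measurable (ccrbm_uniform_Jbar hx k i l).
Qed.

Let indices t w : Theta :=
  ([ffun l => (J (time n t) (particle n t) l w, Jbar (time n t) (particle n t) l w)],
   [ffun j => I (time n t) (particle n t) j w]).

Let step_sources t : seq (source n.+1 B B') :=
  let k := time n t in let i := particle n t in
  Noise B B' k i :: [seq Batch B' k i j | j <- enum 'I_B] ++
  [seq Cov B k i l | l <- enum 'I_B'] ++ [seq Covbar B k i l | l <- enum 'I_B'].

Let step_event t (th : Theta) (Y : set V) (s : source n.+1 B B') : set T :=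
  let k := time n t in let i := particle n t in
  match s with
  | Init => setT
  | Noise _ _ => eps k i @^-1` Y
  | Batch _ _ j => I k i j @^-1` [set th.2 j]
  | Cov _ _ l => J k i l @^-1` [set (th.1 l).1]
  | Covbar _ _ l => Jbar k i l @^-1` [set (th.1 l).2]
  end.

Let step_sourcesP t s : s \in step_sources t ->
  let k := time n t in let i := particle n t in
  [\/ s = Noise B B' k i, exists j, s = Batch B' k i j, exists l, s = Cov B k i l
    | exists l, s = Covbar B k i l].
Proof.
rewrite in_cons !mem_cat => /or4P[/eqP ->|/mapP[j _ ->]|/mapP[j _ ->]|/mapP[j _ ->]].
- by constructor 1.
- by constructor 2; exists j.
- by constructor 3; exists j.
- by constructor 4; exists j.
Qed.

Let step_sources_uniq t : uniq (step_sources t).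
Proof.
rewrite /step_sources cons_uniq !cat_uniq !map_inj_uniq ?enum_uniq; try by move=> ? ? [].
rewrite -!enumT !enum_uniq !mem_cat andTb andTb andbT; apply/and3P; split.
- by apply/negP => /or3P[] /mapP[].
- by apply/hasPn => s; rewrite mem_cat => /orP[] /mapP[l _ ->]; apply/negP => /mapP[].
- by apply/hasPn => s /mapP[l _ ->]; apply/negP => /mapP[].
Qed.

Let step_eventE t th Y :
  \bigcap_(s in [set` step_sources t]) step_event t th Y s =
  eps (time n t) (particle n t) @^-1` Y `&` (indices t @^-1` [set th]).
Proof.
set k := time n t; set i := particle n t.
apply/seteqP; split => w.
  move=> h; split.
    by apply: (h (Noise B B' k i)); rewrite /= in_cons eqxx.
  case: th h => th1 th2 h; rewrite /= /indices -/k -/i; congr (_, _).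
    apply/ffunP => l; rewrite ffunE [RHS]surjective_pairing; congr (_, _).
      apply: (h (Cov B k i l)).
      by rewrite /= in_cons !mem_cat (map_f (Cov B k i)) ?mem_enum// !orbT.
    apply: (h (Covbar B k i l)).
    by rewrite /= in_cons !mem_cat (map_f (Covbar B k i)) ?mem_enum// !orbT.
  apply/ffunP => j; rewrite ffunE; apply: (h (Batch B' k i j)).
  by rewrite /= in_cons !mem_cat (map_f (Batch B' k i)) ?mem_enum// !orbT.
move=> [hY <-] s /= /step_sourcesP[->//|[j ->]|[l ->]|[l ->]] /=; by rewrite ffunE.
Qed.

(** Each index has probability [1/n.+1], and the product of these over all draws is the inverse of
    the number of elements of [Theta]: jointly the indices are uniform on [Theta]. *)
Let step_event_prob t th Y : measurable Y ->
  (\prod_(s <- step_sources t) P (step_event t th Y s) =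
   gam Y * (#|{: Theta}|%:R^-1)%:E)%E.
Proof.
move=> mY; rewrite /step_sources big_cons !big_cat !big_map. rewrite -!enumT !big_enum /=.
rewrite (std_gaussian_law hgam (ccrbm_gaussian hx _ _) mY); congr (_ * _)%E.
rewrite (eq_bigr (fun=> (n.+1%:R^-1)%:E)); last first.
  by move=> j _; exact: (ccrbm_uniform_I hx _ _ _ _).2.
rewrite [X in (_ * (X * _))%E](eq_bigr (fun=> (n.+1%:R^-1)%:E)); last first.
  by move=> j _; exact: (ccrbm_uniform_J hx _ _ _ _).2.
rewrite [X in (_ * (_ * X))%E](eq_bigr (fun=> (n.+1%:R^-1)%:E)); last first.
  by move=> j _; exact: (ccrbm_uniform_Jbar hx _ _ _ _).2.
rewrite !prodEFin !prodr_const !card_ord -!EFinM; congr _%:E.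
rewrite card_prod !card_ffun card_prod !card_ord !natrM !natrX natrM.
by rewrite invfM -!exprVn invfM exprMn mulrC.
Qed.

Lemma ccrbm_chain t (f : S -> \bar R) : measurable_fun setT f -> (forall s, 0 <= f s)%E ->
  (\int[distribution P (path_rv K x t.+1)]_s f s = (#|{: Theta}|%:R^-1)%:E *
   \sum_(th : Theta) \int[distribution P (path_rv K x t)]_s
     \int[gam]_v f (ccrbm_micro eta sigma g F t th (s, v)))%E.
Proof.
move=> mf f0; have ind := ccrbm_independent hx.
pose W t : {RV P >-> S} := path_rv K x t.
apply: (@chain_integral _ _ _ _ _ _ _ P _ W (fun t => eps (time n t) (particle n t)) gam
  indices (fun t th => ccrbm_micro eta sigma g F t th)
  (fun t => cylinder sources (future t)))=> //.
- by move=> t' th; apply: measurable_ccrbm_micro.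
- move=> t' w.
  pose v k i w := effective_noise eta sigma (F k) (fun j => x k j w) i
    ([ffun l => (J k i l w, Jbar k i l w)], [ffun j => I k i j w]) (eps k i w).
  have rec k i : x k.+1 i w = ipd_step eta sigma (g k) (F k) (fun j => x k j w) i (v k i w).
    by rewrite (ccrbm_recursion hx) ccrbm_stepE.
  apply: etrans (path_rvS K t' rec) _.
  apply: ipd_micro_noise => h.
  rewrite /v.
  have <- : config (time n t') (path_rv K x t' w) = fun j => x (time n t') j w.
    exact: config_partial_path (ltnW h).
  reflexivity.
- by move=> t' Q; exact: cylinder_measurable.
- by move=> t'; exact: cylinderT.
- move=> A Q mA hQ.
  have h1 s : s \in [:: Init n.+1 B B'] -> sources s (path_rv K x 0%N @^-1` A).
    by rewrite inE => /eqP ->; exact: path_rv0_sigma.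
  have h2 s : s \in [:: Init n.+1 B B'] -> predT s && ~~ future 0 s by rewrite inE => /eqP ->.
  have [_] := cylinder_cat ind (isT : uniq [:: Init n.+1 B B']) h1 hQ h2 (fun _ _ => isT).
  by rewrite bigcap_in_seq1 !big_seq1.
move=> t' Q th Y hQ mY.
have h1 s : s \in step_sources t' -> sources s (step_event t' th Y s).
  move=> /step_sourcesP[->|[j ->]|[l ->]|[l ->]] /=.
  - by exists Y; rewrite // setTI.
  - by exists [set th.2 j]; rewrite // setTI.
  - by exists [set (th.1 l).1]; rewrite // setTI.
  - by exists [set (th.1 l).2]; rewrite // setTI.
have h2 s : s \in step_sources t' -> future t' s && ~~ future t'.+1 s.
  by move=> /step_sourcesP[->|[j ->]|[l ->]|[l ->]] /=; rewrite timeE leqnn ltnn.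
have h3 s : future t'.+1 s -> future t' s.
  by case: s => [|k i|k i j|k i l|k i l]//= /ltnW.
have := cylinder_cat ind (step_sources_uniq t') h1 hQ h2 h3.
by rewrite step_eventE setIA step_event_prob// muleA.
Qed.

End ccrbm_chain.

(** * Comparison of the two path laws *)

Lemma chi2_const_gt0 (R : realType) : 0 < chi2_const R.
Proof.
apply: ltr_wpDl; last by rewrite ltr0n.
by apply: mulr_ge0; [exact: ler0n | apply: exprn_ge0; exact: ler0n].
Qed.

Lemma chi2_const_ge0 (R : realType) : 0 <= chi2_const R.
Proof. exact/ltW/chi2_const_gt0. Qed.

(** Nonnegativity of the variance, obtained by integrating [2 m h <= h^2 + m^2] with [m] the mean of
    [h]. *)
Lemma chi2_le_eq d (T : measurableType d) (R : realType) (mu nu : probability T R) :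
  (forall A, measurable A -> mu A = nu A) -> chi2_le mu nu 1.
Proof.
move=> mn h b mh hb.
have h0 x : 0 <= h x by case/andP: (hb x).
have sb x : 0 <= h x ^+ 2 <= b ^+ 2.
  by rewrite sqr_ge0 ler_sqr ?nnegrE//; case/andP: (hb x) => // /le_trans; apply.
have msq : measurable_fun setT (fun x => h x ^+ 2) by exact: measurable_funX.
rewrite (_ : (\int[mu]_x _)%E = (\int[nu]_x (h x)%:E)%E); last first.
  by apply: eq_measure_integral => A mA _; exact: mn.
have fi := bounded_fin_num nu mh hb; have fi2 := bounded_fin_num nu msq sb.
set m := fine _; have m0 : 0 <= m.
  by apply: fine_ge0; apply: integral_ge0 => x _; rewrite lee_fin.
have : (\int[nu]_x ((2 * m)%:E * (h x)%:E) <= \int[nu]_x ((h x ^+ 2)%:E + (m ^+ 2)%:E))%E.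
  apply: ge0_le_integral => //.
  - by move=> x _; rewrite -EFinM lee_fin !mulr_ge0.
  - by apply/measurable_EFinP; exact: measurable_funM.
  - by apply/measurable_EFinP; exact: measurable_funD.
  - move=> x _; rewrite -EFinM -EFinD lee_fin -subr_ge0.
    rewrite (_ : _ - _ = (h x - m) ^+ 2); [exact: sqr_ge0|ring].
have m2 : 0 <= 2 * m by rewrite mulr_ge0.
have hE0 x : setT x -> (0 <= (h x)%:E)%E by rewrite lee_fin.
have hE2 x : setT x -> (0 <= (h x ^+ 2)%:E)%E by rewrite lee_fin sqr_ge0.
have mhE : measurable_fun setT (EFin \o h) by exact/measurable_EFinP.
have msqE : measurable_fun setT (fun x => (h x ^+ 2)%:E) by exact/measurable_EFinP.
rewrite ge0_integralZl_EFin//. rewrite ge0_integralD//; last first.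
  by move=> x _; rewrite lee_fin sqr_ge0.
rewrite integral_prob_cst mul1r.
rewrite -(fineK fi) -[X in (_ <= X + _)%E](fineK fi2) -/m -EFinM -EFinD lee_fin.
by rewrite -mulrA -expr2 mulr_natl mulr2n lerD2r.
Qed.

(** Data processing: a test function on the image space pulls back along [phi]. *)
Lemma chi2_le_image dP dQ dS dS' (TP : measurableType dP) (TQ : measurableType dQ)
  (S : measurableType dS) (S' : measurableType dS') (R : realType)
  (P : probability TP R) (Q : probability TQ R) (V : R)
  (X : {RV P >-> S}) (Y : {RV Q >-> S}) (X' : {RV P >-> S'}) (Y' : {RV Q >-> S'})
  (phi : S -> S') : measurable_fun setT phi ->
  (forall w, X' w = phi (X w)) -> (forall w, Y' w = phi (Y w)) ->
  chi2_le (distribution P X) (distribution Q Y) V ->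
  chi2_le (distribution P X') (distribution Q Y') V.
Proof.
move=> mphi hX hY hV h b mh hb.
have h0 x : 0 <= h x by case/andP: (hb x).
have := hV (h \o phi) b (measurableT_comp mh mphi) (fun x => hb (phi x)).
have ge1 y : (0 <= (h y)%:E)%E by rewrite lee_fin.
have ge2 y : (0 <= (h y ^+ 2)%:E)%E by rewrite lee_fin sqr_ge0.
have m1 : measurable_fun setT (fun y => (h y)%:E) by exact/measurable_EFinP.
have m2 : measurable_fun setT (fun y => (h y ^+ 2)%:E).
  by apply/measurable_EFinP; exact: measurable_funX.
have ge1' y : (0 <= ((h \o phi) y)%:E)%E by exact: ge1.
have ge2' y : (0 <= ((h \o phi) y ^+ 2)%:E)%E by exact: ge2.
have m1' : measurable_fun setT (fun y => ((h \o phi) y)%:E) by exact: measurableT_comp m1 mphi.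
have m2' : measurable_fun setT (fun y => ((h \o phi) y ^+ 2)%:E).
  exact: measurableT_comp m2 mphi.
rewrite !ge0_integral_distribution//.
rewrite (eq_integral (EFin \o (h \o X'))); last by move=> w _; rewrite /= hX.
by rewrite [X in V * fine X](eq_integral (fun w => ((h \o Y') w ^+ 2)%:E))//;
  move=> w _; rewrite /= hY.
Qed.

Lemma enorm_dot (R : realType) d (v : 'cV[R]_d) (M : R) :
  enorm v <= M -> dot v v <= M ^+ 2.
Proof.
move=> h; have e : \sum_(a < d) v a 0 ^+ 2 = dot v v by apply: eq_bigr => a _; rewrite expr2.
rewrite /enorm e in h.
by rewrite -(sqr_sqrtr (dot_ge0 v)) ler_sqr ?nnegrE// ?sqrtr_ge0//; apply: le_trans h; exact: sqrtr_ge0.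
Qed.

Lemma path_of_path_rv dT (T : measurableType dT) (R : realType) (P : probability T R)
    (d n K : nat) (x : nat -> 'I_n.+1 -> {RV P >-> 'cV[R]_d}) w :
  tuple_fun (fun k : 'I_K => tuple_fun (x k.+1)) w = path_of_state (path_rv K x (K * n.+1) w).
Proof.
rewrite /path_rv path_of_partial_path.
by apply: eq_from_tnth => k; rewrite !tnth_mktuple; apply: eq_from_tnth => i; rewrite !tnth_mktuple.
Qed.

Section comparison.
Context dT (T : measurableType dT) dT' (T' : measurableType dT') (R : realType)
  (P : probability T R) (P' : probability T' R) (d n B B' K : nat).
Local Notation V := 'cV[R]_d.
Local Notation S := 'M[V]_(K.+1, n.+1).
Variables (eta sigma M : R) (g : nat -> 'I_n.+1 -> V -> V)
  (F : nat -> 'I_n.+1 -> 'I_n.+1 -> V -> V -> V).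
Hypotheses (mg : forall k i, measurable_fun setT (g k i))
  (mF : forall k i j, measurable_fun setT (fun p : V * V => F k i j p.1 p.2)).
Variables (x eps : nat -> 'I_n.+1 -> {RV P >-> V}).
Variables (xh epsh : nat -> 'I_n.+1 -> {RV P' >-> V}).
Variables (I : nat -> 'I_n.+1 -> 'I_B -> T' -> 'I_n.+1)
  (J Jbar : nat -> 'I_n.+1 -> 'I_B' -> T' -> 'I_n.+1).
Hypotheses (B0 : (0 < B)%N) (B'0 : (0 < B')%N) (eta0 : 0 < eta) (sigma0 : 0 < sigma).
Hypotheses (hx : is_IPD eta sigma g F x eps) (hxh : is_CCRBM eta sigma g F xh epsh I J Jbar).
Hypothesis h0 : forall A, measurable A -> initial_law xh A = initial_law x A.
Hypothesis FM : forall k i j, (k <= K)%N ->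
  {ae P', forall w, dot (F k i j (xh k i w) (xh k j w)) (F k i j (xh k i w) (xh k j w)) <= M ^+ 2}.

Let a : R := (Num.sqrt eta / sigma) ^+ 2 * M ^+ 2 / B%:R.
Hypothesis a40 : 40 * a <= 1.

Let delta : R := chi2_const R * (a ^+ 2 / B'%:R + a ^+ 3).

Let good t (s : S) : Prop := forall j,
  dot (F (time n t) (particle n t) j (config (time n t) s (particle n t)) (config (time n t) s j))
      (F (time n t) (particle n t) j (config (time n t) s (particle n t)) (config (time n t) s j))
  <= M ^+ 2.

(** The force bound is assumed along the trajectories of CC-RBM. The set of good states is
    measurable, so the bound passes to the law of the state, which is the measure for which
    [chi2_le_step] asks an almost sure bound. *)
Let good_ae t : (time n t <= K)%N -> {ae distribution P' (path_rv K xh t), forall s, good t s}.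
Proof.
move=> ht.
have mgood : measurable [set s | good t s].
  rewrite (_ : [set s | good t s] = \bigcap_(j in [set: 'I_n.+1]) (setT `&`
      (fun s : S => dot
        (F (time n t) (particle n t) j (config (time n t) s (particle n t)) (config (time n t) s j))
        (F (time n t) (particle n t) j (config (time n t) s (particle n t)) (config (time n t) s j)))
      @^-1` [set` `]-oo, M ^+ 2]])); last first.
    apply/seteqP; split => s /= hs j; first by move=> _; split => //=; rewrite in_itv/=.
    by have [_] := hs j Logic.I; rewrite /= in_itv/=.
  apply: fin_bigcap_measurable => [|j _]; first exact: finite_finset.
  have mFt : measurable_fun setT (fun s : S =>
      F (time n t) (particle n t) j (config (time n t) s (particle n t)) (config (time n t) s j)).
    apply: (measurable_pair_force (mF (time n t)) (z := fun s i => config (time n t) s i)).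
    by move=> i; exact: measurable_mx_entry.
  by apply: (measurable_dot mFt mFt) => //; exact: measurable_itv.
exists (~` [set s | good t s]); split => //; first exact: measurableC.
have ae0 : {ae P', forall w, good t (path_rv K xh t w)}.
  have fP : Filter (almost_everywhere P') by exact: ae_filter_ringOfSetsType.
  apply: filterS (filter_forall fP (fun j => FM (particle n t) j ht)) => w hw j.
  by rewrite /path_rv config_partial_path.
case: ae0 => N [mN N0 hN].
apply/eqP; rewrite -measure_le0 -[leRHS]N0.
apply: (@le_measure _ _ _ P' (path_rv K xh t @^-1` (~` [set s | good t s])) N).
- rewrite inE -[X in measurable X]setTI.
  exact: (measurable_path_rv xh t measurableT (measurableC mgood)).
- by rewrite inE.
- by move=> w hw; apply: hN.
Qed.

Let gam : probability V R := distribution P (eps 0%N ord0).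
Let hgam : std_normal gam. Proof. exact: std_gaussian_std_normal (ipd_gaussian hx _ _). Qed.

Let delta_ge0 : 0 <= delta.
Proof.
have a0 : 0 <= a by rewrite divr_ge0// mulr_ge0// sqr_ge0.
apply: mulr_ge0; first exact: chi2_const_ge0.
by apply: addr_ge0; [rewrite divr_ge0// sqr_ge0 | exact: exprn_ge0].
Qed.

(** The initial laws agree, and each micro-step contributes the factor [1 + delta] of [batch_chi2],
    applied at every good state to the test function composed with the IPD update. *)
Lemma path_chi2_le t : (t <= K * n.+1)%N ->
  chi2_le (distribution P' (path_rv K xh t)) (distribution P (path_rv K x t)) ((1 + delta) ^+ t).
Proof.
elim: t => [_|t IH ht].
  rewrite expr0; apply: chi2_le_eq => A mA.
  have mI : measurable (@initial_state R d n K @^-1` A).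
    by rewrite -[X in measurable X]setTI; exact: measurable_initial_state.
  have E1 : path_rv K xh 0 @^-1` A = tuple_fun (xh 0%N) @^-1` (@initial_state R d n K @^-1` A).
    by rewrite path_rv0.
  have E2 : path_rv K x 0 @^-1` A = tuple_fun (x 0%N) @^-1` (@initial_state R d n K @^-1` A).
    by rewrite path_rv0.
  exact: etrans (congr1 P' E1) (etrans (h0 mI) (esym (congr1 P E2))).
rewrite exprSr.
apply: (chi2_le_step (gam := gam) (Phi := ipd_micro eta sigma g F t)
  (Psi := fun th => @ccrbm_micro R d n B B' K eta sigma g F t th)
  (mu := distribution P' (path_rv K xh t)) (nu := distribution P (path_rv K x t))).
- by apply: measurable_ipd_micro.
- by move=> th; apply: measurable_ccrbm_micro.
- by move=> f mf f0; exact: (ccrbm_chain mg mF B0 eta0 sigma0 hgam hxh t mf f0).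
- by move=> f mf f0; exact: (ipd_chain mg mF hgam hx t mf f0).
- have htK : (time n t <= K)%N by exact/ltnW/time_lt.
  apply: filterS (good_ae htK) => s gs h b mh hb.
  have mh' : measurable_fun setT (fun v => h (ipd_micro eta sigma g F t (s, v))).
    by apply: measurableT_comp => //; apply: measurable_ipd_micro.
  have := batch_chi2 (isT : (0 < n.+1)%N) B0 B'0 gs a40 hgam mh' (fun v => hb _).
  by rewrite avg_pair; apply.
- by rewrite addr_ge0.
by apply: IH; exact: ltnW.
Qed.

(** The path is a function of the final state, and the logarithm of [(1 + delta)^(K n)] is at most
    [K n delta]. *)
Lemma path_law_KL_le :
  (KL (path_law xh K) (path_law x K) <= ((K * n.+1)%:R * delta)%:E)%E.
Proof.
have mphi : measurable_fun setT (@path_of_state R d n K).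
  apply/measurable_fun_tnthP => k; apply/measurable_fun_tnthP => i.
  rewrite (_ : _ \o _ = fun s : S => s (lift ord0 k) i).
    exact: measurable_mx_entry.
  by apply/funext => s; rewrite /= !tnth_mktuple.
have hV := chi2_le_image mphi (path_of_path_rv K xh) (path_of_path_rv K x)
  (path_chi2_le (leqnn _)).
apply: le_trans (KL_le_ln hV) _.
rewrite lee_fin lnXn; last by rewrite ltr_wpDr.
rewrite mulr_natl; apply: ler_wMn2r; apply: le_ln1Dx.
by apply: lt_le_trans delta_ge0; rewrite ltrN10.
Qed.

End comparison.


(** * The bound in terms of the parameters of the dynamics *)

Theorem theorem11 (R : realType) :
  exists C : R, 0 < C /\
  forall (d n B B' K : nat) (eta sigma M : R)
    (g : nat -> 'I_n -> 'cV[R]_d -> 'cV[R]_d)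
    (F : nat -> 'I_n -> 'I_n -> 'cV[R]_d -> 'cV[R]_d -> 'cV[R]_d)
    (disp : measure_display) (T : measurableType disp) (P : probability T R)
    (x eps : nat -> 'I_n -> {RV P >-> 'cV[R]_d})
    (disp' : measure_display) (T' : measurableType disp')
    (P' : probability T' R)
    (xh epsh : nat -> 'I_n -> {RV P' >-> 'cV[R]_d})
    (I : nat -> 'I_n -> 'I_B -> T' -> 'I_n)
    (J Jbar : nat -> 'I_n -> 'I_B' -> T' -> 'I_n),
  (0 < B <= n)%N -> (0 < B' <= n)%N -> 0 < eta -> 0 < sigma ->
  (forall k i, measurable_fun setT (g k i)) ->
  (forall k i j, measurable_fun setT
     (fun p : 'cV[R]_d * 'cV[R]_d => F k i j p.1 p.2)) ->
  is_IPD eta sigma g F x eps ->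
  is_CCRBM eta sigma g F xh epsh I J Jbar ->
  (forall A, measurable A -> initial_law xh A = initial_law x A) ->
  (forall k i j, (k <= K)%N ->
     {ae P', forall w, enorm (F k i j (xh k i w) (xh k j w)) <= M}) ->
  eta * (40 * M ^+ 2 * d%:R) <= B%:R * sigma ^+ 2 ->
  (KL (path_law xh K) (path_law x K) <=
    (C * (eta ^+ 2 * M ^+ 4 * n%:R * K%:R / (B%:R ^+ 2 * B'%:R * sigma ^+ 4)
          + eta ^+ 3 * M ^+ 6 * n%:R * K%:R / (B%:R ^+ 3 * sigma ^+ 6)
          + d%:R * eta ^+ 3 * M ^+ 6 * n%:R * K%:R * (1 + ln B%:R) ^+ 2
            / (B%:R ^+ 4 * sigma ^+ 6)))%:E)%E.
Proof.
exists (chi2_const R); split.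
  exact: chi2_const_gt0.
move=> d [|n] B B' K eta sigma M g F disp T P x eps disp' T' P' xh epsh I J Jbar.
  by case: B I => //.
move=> /andP[B0 _] /andP[B'0 _] eta0 sigma0 mg mF hx hxh hinit hM hstep.
(* In dimension 0 the step-size condition reads [0 <= B sigma^2] and does not bound [a]; there all
   vectors vanish and the forces are bounded by [N = 0]. *)
have FM N : (d = 0%N \/ N = M) -> forall k i j, (k <= K)%N ->
    {ae P', forall w, dot (F k i j (xh k i w) (xh k j w)) (F k i j (xh k i w) (xh k j w)) <= N ^+ 2}.
  move=> hN k i j hk; apply: filterS (hM k i j hk) => w /enorm_dot.
  case: hN => [d0 _|-> //]; rewrite /dot big1 ?sqr_ge0// => a.
  by exfalso; move: a; rewrite d0 => -[].
have Bp : 0 < B%:R :> R by rewrite ltr0n.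
have B'p : 0 < B'%:R :> R by rewrite ltr0n.
have bound N : (d = 0%N \/ N = M) -> N ^+ 2 <= M ^+ 2 ->
    40 * ((Num.sqrt eta / sigma) ^+ 2 * N ^+ 2 / B%:R) <= 1 ->
    (KL (path_law xh K) (path_law x K) <= (chi2_const R *
      (eta ^+ 2 * M ^+ 4 * n.+1%:R * K%:R / (B%:R ^+ 2 * B'%:R * sigma ^+ 4)
       + eta ^+ 3 * M ^+ 6 * n.+1%:R * K%:R / (B%:R ^+ 3 * sigma ^+ 6)))%:E)%E.
  move=> hN NM a40.
  apply: le_trans (path_law_KL_le mg mF B0 B'0 eta0 sigma0 hx hxh hinit (FM N hN) a40) _.
  rewrite lee_fin [leLHS]mulrCA; apply: ler_wpM2l; first exact: chi2_const_ge0.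
  rewrite ![(Num.sqrt eta / sigma) ^+ 2]expr_div_n sqr_sqrtr ?(ltW eta0)//.
  set a := eta / sigma ^+ 2 * M ^+ 2 / B%:R.
  have -> : eta ^+ 2 * M ^+ 4 * n.+1%:R * K%:R / (B%:R ^+ 2 * B'%:R * sigma ^+ 4)
       + eta ^+ 3 * M ^+ 6 * n.+1%:R * K%:R / (B%:R ^+ 3 * sigma ^+ 6) =
      (K * n.+1)%:R * (a ^+ 2 / B'%:R + a ^+ 3).
    rewrite natrM /a; field.
    by rewrite !gt_eqF.
  have aN0 : 0 <= eta / sigma ^+ 2 * N ^+ 2 / B%:R.
    by rewrite divr_ge0 ?(ltW Bp)// mulr_ge0 ?sqr_ge0// divr_ge0 ?sqr_ge0 ?(ltW eta0).
  have aN : eta / sigma ^+ 2 * N ^+ 2 / B%:R <= a.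
    apply: ler_wpM2r; first by rewrite invr_ge0 (ltW Bp).
    by apply: ler_wpM2l => //; rewrite divr_ge0 ?sqr_ge0 ?(ltW eta0).
  apply: ler_wpM2l; first exact: ler0n.
  apply: lerD; last by rewrite lerXn2r ?nnegrE// (le_trans aN0).
  apply: ler_wpM2r; first by rewrite invr_ge0 (ltW B'p).
  by rewrite lerXn2r ?nnegrE// (le_trans aN0).
(* The third term is nonnegative, so it suffices to bound the divergence by the first two. *)
have drop_log : ((chi2_const R *
      (eta ^+ 2 * M ^+ 4 * n.+1%:R * K%:R / (B%:R ^+ 2 * B'%:R * sigma ^+ 4)
       + eta ^+ 3 * M ^+ 6 * n.+1%:R * K%:R / (B%:R ^+ 3 * sigma ^+ 6)))%:E <=
    (chi2_const R *
      (eta ^+ 2 * M ^+ 4 * n.+1%:R * K%:R / (B%:R ^+ 2 * B'%:R * sigma ^+ 4)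
       + eta ^+ 3 * M ^+ 6 * n.+1%:R * K%:R / (B%:R ^+ 3 * sigma ^+ 6)
       + d%:R * eta ^+ 3 * M ^+ 6 * n.+1%:R * K%:R * (1 + ln B%:R) ^+ 2
            / (B%:R ^+ 4 * sigma ^+ 6)))%:E)%E.
  rewrite lee_fin; apply: ler_wpM2l; first exact: chi2_const_ge0.
  rewrite lerDl; apply: divr_ge0.
    apply: mulr_ge0; last exact: sqr_ge0.
    have M6 : 0 <= M ^+ 6 by rewrite (exprM M 3 2) sqr_ge0.
    have e3 : 0 <= eta ^+ 3 by apply: exprn_ge0; exact: ltW.
    by do 4 (apply: mulr_ge0 => //); exact: ler0n.
  by apply: mulr_ge0; apply: exprn_ge0; exact: ltW.
apply: le_trans drop_log.
have [d0|dn0] := eqVneq d 0%N.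
  apply: (bound 0 (or_introl d0)); first by rewrite expr0n sqr_ge0.
  by rewrite expr0n/= mulr0 mul0r mulr0.
apply: (bound M (or_intror erefl)) => //.
(* For [d >= 1] the condition on [eta] implies [40 a <= 1]. *)
rewrite ![(Num.sqrt eta / sigma) ^+ 2]expr_div_n sqr_sqrtr ?(ltW eta0)//.
have s0 : 0 < B%:R * sigma ^+ 2 by rewrite mulr_gt0// exprn_gt0.
rewrite (_ : 40 * _ = (eta * (40 * M ^+ 2)) / (B%:R * sigma ^+ 2)); last first.
  by field; rewrite !gt_eqF.
rewrite ler_pdivrMr// mul1r; apply: le_trans hstep.
apply: ler_wpM2l; first exact: ltW.
rewrite ler_peMr//; first by rewrite mulr_ge0// sqr_ge0.
by rewrite ler1n lt0n.
Qed.
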